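(* Let $(\mathcal{A},\mathcal{D})$ be a $C^*$-inclusion with $\mathcal{A}$ abelian. Then the mapping $\Psi \mapsto \ker(\Psi)$ is a bijection from $\operatorname{PsExp}^\times(\mathcal{A},\mathcal{D})$ onto the set of maximal $\mathcal{D}$-disjoint ideals of $\mathcal{A}$. In particular, $\operatorname{PsExp}^\times(\mathcal{A},\mathcal{D})$ is a singleton if and only if there exists a unique maximal $\mathcal{D}$-disjoint ideal $\mathcal{I}$ of $\mathcal{A}$.
   Context: All $C^*$-algebras are unital. A $C^*$-inclusion $(\mathcal{A},\mathcal{D})$ is a pair of unital $C^*$-algebras with $\mathcal{D} \subseteq \mathcal{A}$ and having the same unit. ''ucp'' means unital completely positive. A $C^*$-algebra is injective if it is an injective object in the category of operator systems and ucp maps. $I(\mathcal{D})$ denotes a fixed injective envelope of $\mathcal{D}$: an injective unital $C^*$-algebra containing $\mathcal{D}$ as a unital $C^*$-subalgebra, such that for every injective operator system $\mathcal{S}$ and unital complete isometry $\tau:\mathcal{D}\to\mathcal{S}$ there is a unital complete isometry $\tau_1:I(\mathcal{D})\to\mathcal{S}$ with $\tau_1|_{\mathcal{D}}=\tau$. A pseudo-expectation for $(\mathcal{A},\mathcal{D})$ is a ucp map $\Phi:\mathcal{A}\to I(\mathcal{D})$ with $\Phi|_{\mathcal{D}}=\operatorname{id}$. $\operatorname{PsExp}^\times(\mathcal{A},\mathcal{D})$ denotes the set of multiplicative pseudo-expectations, i.e. unital $*$-homomorphisms $\Psi:\mathcal{A}\to I(\mathcal{D})$ with $\Psi|_{\mathcal{D}}=\operatorname{id}$.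 A closed two-sided ideal $\mathcal{J}$ of $\mathcal{A}$ is $\mathcal{D}$-disjoint if $\mathcal{D}\cap\mathcal{J}=0$; it is a maximal $\mathcal{D}$-disjoint ideal if it is maximal under inclusion among $\mathcal{D}$-disjoint ideals. *)

(* Defs.v *)
From HB Require Import structures.
From mathcomp Require Import all_boot all_order all_algebra.
From mathcomp Require Import complex.
From mathcomp Require Import all_classical all_reals all_analysis.

Set Implicit Arguments.
Unset Strict Implicit.
Unset Printing Implicit Defensive.

Import Order.TTheory GRing.Theory Num.Theory.
Import numFieldNormedType.Exports.

Local Open Scope classical_set_scope.
Local Open Scope ring_scope.

(* Multiplication is part of this mixin because Hierarchy Builder rejects a
   structure joining a ring and a normed module that is not below
   [Num.NumDomain]; the ring structure is derived just after.  It is only a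
   [PzRing], not an [NzRing]: the zero algebra is a unital C*-algebra.
   The norm of a normed module over [R[i]] takes its (real nonnegative) values
   in [R[i]], and [k^*] is complex conjugation. *)
HB.mixin Record isCStarAlgebra (R : realType) A
    of CompleteNormedModule R[i] A := {
  cstar_one : A;
  cstar_mul : A -> A -> A;
  cstar_mulA : associative cstar_mul;
  cstar_mul1 : left_id cstar_one cstar_mul;
  cstar_mulr1 : right_id cstar_one cstar_mul;
  cstar_mulDl : left_distributive cstar_mul +%R;
  cstar_mulDr : right_distributive cstar_mul +%R;
  cstar_mulZl : forall (k : R[i]) (x y : A),
    cstar_mul (k *: x) y = k *: cstar_mul x y;
  cstar_mulZr : forall (k : R[i]) (x y : A),
    cstar_mul x (k *: y) = k *: cstar_mul x y;
  star : A -> A;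
  starK : forall x : A, star (star x) = x;
  starD : forall x y : A, star (x + y) = star x + star y;
  starZ : forall (k : R[i]) (x : A), star (k *: x) = k^* *: star x;
  cstar_starM : forall x y : A,
    star (cstar_mul x y) = cstar_mul (star y) (star x);
  cstar_normM : forall x y : A, `|cstar_mul x y| <= `|x| * `|y|;
  cstar_norm_starM : forall x : A, `|cstar_mul (star x) x| = `|x| ^+ 2;
}.

#[short(type="cstarAlgType")]
HB.structure Definition CStarAlgebra (R : realType) :=
  {A of CompleteNormedModule R[i] A & isCStarAlgebra R A}.

HB.instance Definition _ (R : realType) (A : cstarAlgType R) :=
  GRing.Zmodule_isPzRing.Build (CStarAlgebra.sort A)
    (@cstar_mulA R A) (@cstar_mul1 R A) (@cstar_mulr1 R A)
    (@cstar_mulDl R A) (@cstar_mulDr R A).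

Section Maps.
Context {R : realType}.
Implicit Types A B C : cstarAlgType R.

Definition cstar_subalgebra A (D : set A) : Prop :=
  [/\ closed D, D 1,
      forall (k : R[i]) x y, D x -> D y -> D (k *: x + y),
      forall x y, D x -> D y -> D (x * y) &
      forall x, D x -> D (star x)].

Definition operator_system A (E : set A) : Prop :=
  [/\ E 1,
      forall (k : R[i]) x y, E x -> E y -> E (k *: x + y) &
      forall x, E x -> E (star x)].

Definition mxstar A m n (X : 'M[A]_(m, n)) : 'M[A]_(n, m) :=
  (map_mx (@star R A) X)^T.

(* [X] is positive in the C*-algebra ['M[A]_n]; for an operator system inside
   [A], the matrix order and the matrix norms are those of [A]. *)
Definition mxpos A n (X : 'M[A]_n) : Prop :=
  exists Y : 'M[A]_n, X = mxstar Y *m Y.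

(* Norm of the right Hilbert [A]-module of columns, and the operator norm of
   ['M[A]_n] acting on it, which is the C*-norm of ['M[A]_n]. *)
Definition colnorm A n (v : 'cV[A]_n) : R :=
  Num.sqrt (complex.Re `|(mxstar v *m v) 0 0|).

Definition mxcnorm A n (X : 'M[A]_n) : R :=
  sup [set colnorm (X *m v) | v in [set v : 'cV[A]_n | colnorm v <= 1]].

Definition mx_in A n (E : set A) (X : 'M[A]_n) : Prop := forall i j, E (X i j).

(* A map defined on a subset [E] of [A] is represented by a total function
   [f : A -> B], whose values outside [E] are irrelevant. *)
Definition unital_linear_on A B (E : set A) (F : set B) (f : A -> B) : Prop :=
  [/\ forall x, E x -> F (f x),
      f 1 = 1 &
      forall (k : R[i]) x y, E x -> E y -> f (k *: x + y) = k *: f x + f y].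

Definition ucp_on A B (E : set A) (F : set B) (f : A -> B) : Prop :=
  unital_linear_on E F f /\
  forall n (X : 'M[A]_n), mx_in E X -> mxpos X -> mxpos (map_mx f X).

Definition unital_complete_isometry_on A B (E : set A) (F : set B)
    (f : A -> B) : Prop :=
  unital_linear_on E F f /\
  forall n (X : 'M[A]_n), mx_in E X -> mxcnorm (map_mx f X) = mxcnorm X.

Definition unital_star_hom_on A B (D : set A) (f : A -> B) : Prop :=
  [/\ unital_linear_on D setT f,
      forall x y, D x -> D y -> f (x * y) = f x * f y &
      forall x, D x -> f (star x) = star (f x)].

Definition injective_opsys B (S : set B) : Prop :=
  operator_system S /\
  forall A (E F : set A) (f : A -> B),
    operator_system E -> operator_system F -> E `<=` F -> ucp_on E S f ->
    exists2 g : A -> B, ucp_on F S g & forall x, E x -> g x = f x.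

(* [B], with [D] embedded by [iota], is an injective envelope I(D) of [D]. *)
Definition injective_envelope A (D : set A) B (iota : A -> B) : Prop :=
  [/\ unital_star_hom_on D iota,
      forall x y, D x -> D y -> iota x = iota y -> x = y,
      injective_opsys [set: B] &
      forall C (S : set C) (tau : A -> C),
        injective_opsys S -> unital_complete_isometry_on D S tau ->
        exists2 tau1 : B -> C, unital_complete_isometry_on setT S tau1 &
          forall d, D d -> tau1 (iota d) = tau d].

Definition PsExp_mul A (D : set A) B (iota : A -> B) : set (A -> B) :=
  [set Psi | unital_star_hom_on setT Psi /\ forall d, D d -> Psi d = iota d].

Definition hom_kernel A B (f : A -> B) : set A := f @^-1` [set 0].

Definition closed_ideal A (J : set A) : Prop :=
  [/\ closed J, J 0,
      forall x y, J x -> J y -> J (x + y) &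
      forall a x, J x -> J (a * x) /\ J (x * a)].

Definition disjoint_ideal A (D J : set A) : Prop :=
  closed_ideal J /\ D `&` J = [set 0].

Definition maximal_disjoint_ideal A (D J : set A) : Prop :=
  disjoint_ideal D J /\
  forall K, disjoint_ideal D K -> J `<=` K -> K = J.

End Maps.

(* Main.v *)
Require Import Defs.
From HB Require Import structures.
From mathcomp Require Import all_boot all_order all_algebra.
From mathcomp Require Import complex.
From mathcomp Require Import all_classical all_reals all_analysis.
From mathcomp Require Import zify ring lra.

Set Implicit Arguments.
Unset Strict Implicit.
Unset Printing Implicit Defensive.

Import Order.TTheory GRing.Theory Num.Theory.
Import numFieldNormedType.Exports.
Local Open Scope classical_set_scope.
Local Open Scope ring_scope.

Local Notation "r %:C" := (real_complex _ r) : ring_scope.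

(** Write [Y_J] for the set of characters of [A] that vanish on an ideal [J]. The
    proof rests on three facts.

    First, [A] has enough characters: if [J] is a closed [D]-disjoint ideal, the
    characters in [Y_J] norm [D] ([quotient_norm]). This is obtained from Krivine's
    theorem on maximal preorderings of the real algebra of self-adjoint elements.
    It relies on the order structure of a C*-algebra, which is developed from a
    single iteration for square roots ([visser_sqrt], [cpos_sqrt], [cpos_starM]).

    Second, the envelope [ID] is rigid ([envelope_rigid_retract]). Let [C] be the
    algebra of bounded functions on the spectrum of [A]. Among the seminorms on [C]
    that are dominated by the norm and agree with it on [D], take a minimal one. By
    the Hahn-Banach theorem it is [x |-> rnorm (phi x)] for a linear map [phi] that
    fixes [D]; averaging its iterates shows that [phi] is idempotent, and that no
    contraction of its range [S] other than the identity fixes [D]. Since [C] is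
    injective, so is [S]. The universal property of [ID] applied to [S], followed by
    the injectivity of [ID], identifies [ID] isometrically with [S]. Consequently a
    linear contraction of [ID] that fixes [D] is the identity, and a linear
    contraction out of [ID] that preserves the norm on [D] is isometric
    ([envelope_isometric]).

    Third, the inclusion of [D] in [ID] extends to a ucp map from the bounded
    functions on [Y_J] to [ID] ([extend_from_transform]): a matrix over [D] that is
    positive at every character has a square root with entries in [D].

    For a multiplicative pseudo-expectation [Psi], norms of images are controlled by
    the kernel ([kernel_domination]). Rigidity then shows that the kernel is maximal
    ([psexp_kernel_maximal]) and that it determines [Psi] ([psexp_kernel_inj]).
    Conversely, if [J] is maximal, composing the restriction of [A] to [Y_J] with
    the ucp map of the third fact gives a ucp map [Phi] from [A] to [ID] that kills
    [J] and extends the inclusion of [D]. Maximality makes [Phi] isometric modulo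
    [J] ([maximal_ideal_bump], [extension_isometric]), so
    the characters in [Y_J] extend to states of [ID] that are jointly isometric;
    tested on them, the Kadison-Schwarz inequality for [Phi] is an equality, and
    [Phi] is multiplicative. Its kernel is a [D]-disjoint ideal containing [J], hence
    equal to [J] ([exists_psexp_of_maximal_ideal]). *)

(** * Complex moduli and real-valued norms *)

Definition cmod (R : realType) (k : R[i]) : R := complex.Re `|k|.

Definition rnorm (R : realType) (V : normedModType R[i]) (x : V) : R :=
  complex.Re `|x|.

Section ComplexModulus.
Context {R : realType}.
Implicit Types (r s : R) (k l : R[i]).

Lemma ge0_ReE k : 0 <= k -> k = (complex.Re k)%:C.
Proof. by move=> /ger0_real /RRe_real. Qed.

Lemma cmodE k : `|k| = (cmod k)%:C.
Proof. exact: ge0_ReE. Qed.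

Lemma cmod_ge0 k : 0 <= cmod k.
Proof. by rewrite -ler0c -cmodE. Qed.

Lemma cmodM k l : cmod (k * l) = cmod k * cmod l.
Proof. by apply: complexI; rewrite -cmodE normrM !cmodE rmorphM. Qed.

Lemma cmodD k l : cmod (k + l) <= cmod k + cmod l.
Proof. by rewrite -lecR rmorphD -!cmodE ler_normD. Qed.

Lemma cmod_real r : cmod r%:C = `|r|.
Proof. by rewrite /cmod normc_def /= expr0n /= addr0 sqrtr_sqr. Qed.

Lemma cmodN k : cmod (- k) = cmod k.
Proof. by rewrite /cmod normrN. Qed.

Lemma cmod0 : cmod (0 : R[i]) = 0.
Proof. by rewrite /cmod normr0. Qed.

Lemma cmod1 : cmod (1 : R[i]) = 1.
Proof. by rewrite /cmod normr1. Qed.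

Lemma cmod_eq0 k : cmod k = 0 -> k = 0.
Proof. by move=> h; apply/normr0_eq0; rewrite cmodE h. Qed.

Lemma cmodJ k : cmod k^* = cmod k.
Proof. by rewrite /cmod norm_conjC. Qed.

Lemma Re_le_cmod k : complex.Re k <= cmod k.
Proof.
rewrite -lecR -cmodE; apply: le_trans (normc_ge_Re k).
by rewrite lecR ler_norm.
Qed.

Lemma conjRC r : (r%:C)^* = r%:C.
Proof. exact: conjc_real. Qed.

Lemma cmod_sqr k : k^* * k = (cmod k ^+ 2)%:C.
Proof. by rewrite mulrC -normCK cmodE rmorphXn. Qed.

Lemma exists_phase k : exists l, cmod l = 1 /\ l * k = (cmod k)%:C.
Proof.
have [->|k0] := eqVneq k 0; first by exists 1; rewrite cmod1 mulr0 cmod0.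
have m0 : cmod k != 0 by apply: contra_neq k0; exact: cmod_eq0.
exists (k^* * (cmod k)^-1%:C); split.
  by rewrite cmodM cmodJ cmod_real ger0_norm ?invr_ge0 ?cmod_ge0 // divff.
by rewrite mulrAC cmod_sqr -rmorphM /= expr2 mulfK.
Qed.


End ComplexModulus.

Section RealNorm.
Context {R : realType}.
Implicit Types (V : normedModType R[i]) (r : R) (k : R[i]).

Lemma rnormE V (x : V) : `|x| = (rnorm x)%:C.
Proof. exact: ge0_ReE. Qed.

Lemma rnorm_ge0 V (x : V) : 0 <= rnorm x.
Proof. by rewrite -ler0c -rnormE. Qed.

Lemma rnorm0 V : rnorm (0 : V) = 0.
Proof. by rewrite /rnorm normr0. Qed.

Lemma rnorm_eq0 V (x : V) : rnorm x = 0 -> x = 0.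
Proof. by move=> h; apply/normr0_eq0; rewrite rnormE h. Qed.

Lemma rnormD V (x y : V) : rnorm (x + y) <= rnorm x + rnorm y.
Proof. by rewrite -lecR rmorphD /= -!rnormE ler_normD. Qed.

Lemma rnormN V (x : V) : rnorm (- x) = rnorm x.
Proof. by rewrite /rnorm normrN. Qed.

Lemma rnormB V (x y : V) : rnorm (x - y) <= rnorm x + rnorm y.
Proof. by rewrite -[in leRHS](rnormN y); exact: rnormD. Qed.

Lemma rnormBC V (x y : V) : rnorm (x - y) = rnorm (y - x).
Proof. by rewrite -rnormN opprB. Qed.

Lemma rnormZ V k (x : V) : rnorm (k *: x) = cmod k * rnorm x.
Proof. by apply: complexI; rewrite rmorphM /= -!rnormE -cmodE normrZ. Qed.

Lemma rnormZr V r (x : V) : 0 <= r -> rnorm (r%:C *: x) = r * rnorm x.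
Proof. by move=> r0; rewrite rnormZ cmod_real ger0_norm. Qed.

Lemma rnorm_sum V (I : Type) (s : seq I) (P : pred I) (F : I -> V) :
  rnorm (\sum_(i <- s | P i) F i) <= \sum_(i <- s | P i) rnorm (F i).
Proof.
elim/big_rec2 : _ => [|i b a _ h]; first by rewrite rnorm0.
by apply: le_trans (rnormD _ _) _; rewrite lerD2l.
Qed.

End RealNorm.

Section CStarBasics.
Context {R : realType} {A : cstarAlgType R}.
Implicit Types (x y : A) (k : R[i]) (r : R).

Lemma scalerMl k x y : (k *: x) * y = k *: (x * y).
Proof. exact: cstar_mulZl. Qed.

Lemma scalerMr k x y : x * (k *: y) = k *: (x * y).
Proof. exact: cstar_mulZr. Qed.

Lemma starM x y : star (x * y) = star y * star x.
Proof. exact: cstar_starM. Qed.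

Lemma star0 : star (0 : A) = 0.
Proof. by rewrite -[in LHS](scale0r (0 : A)) starZ conjC0 scale0r. Qed.

Lemma starN x : star (- x) = - star x.
Proof. by apply: (addIr (star x)); rewrite -starD !addNr star0. Qed.

Lemma starB x y : star (x - y) = star x - star y.
Proof. by rewrite starD starN. Qed.

Lemma starZr r x : star (r%:C *: x) = r%:C *: star x.
Proof. by rewrite starZ conjRC. Qed.

Lemma star1 : star (1 : A) = 1.
Proof. by rewrite -[LHS]mulr1 -[X in _ * X]starK -starM mulr1 starK. Qed.

Lemma star_sum (I : Type) (s : seq I) (P : pred I) (F : I -> A) :
  star (\sum_(i <- s | P i) F i) = \sum_(i <- s | P i) star (F i).
Proof. by apply: (big_morph _ starD star0). Qed.

Lemma starX x n : star (x ^+ n) = star x ^+ n.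
Proof. by elim: n => [|n IH]; rewrite ?expr0 ?star1 // exprS starM IH exprSr. Qed.

Lemma rnormM x y : rnorm (x * y) <= rnorm x * rnorm y.
Proof. by rewrite -lecR rmorphM /= -!rnormE; exact: cstar_normM. Qed.

Lemma rnorm_starM x : rnorm (star x * x) = rnorm x ^+ 2.
Proof. by apply: complexI; rewrite rmorphXn /= -!rnormE; exact: cstar_norm_starM. Qed.

Lemma rnorm_star x : rnorm (star x) = rnorm x.
Proof.
have le y : rnorm y <= rnorm (star y).
  have [->|y0] := eqVneq (rnorm y) 0; first exact: rnorm_ge0.
  have y1 : 0 < rnorm y by rewrite lt_def y0 rnorm_ge0.
  by rewrite -(ler_pM2r y1) -expr2 -rnorm_starM; exact: rnormM.
by apply/eqP; rewrite eq_le le -{2}(starK x) le.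
Qed.

Lemma rnorm_mulstar x : rnorm (x * star x) = rnorm x ^+ 2.
Proof. by rewrite -{1}(starK x) rnorm_starM rnorm_star. Qed.

Lemma rnorm_sqr x : star x = x -> rnorm (x ^+ 2) = rnorm x ^+ 2.
Proof. by move=> h; rewrite -rnorm_starM h expr2. Qed.

Lemma rnorm1_le1 : rnorm (1 : A) <= 1.
Proof.
have := rnorm_starM 1; rewrite star1 mulr1 => h.
have [->|y0] := eqVneq (rnorm (1 : A)) 0; first exact: ler01.
by rewrite -[leLHS](mulfK y0) -expr2 -h divff.
Qed.

Lemma rnorm_cst r : rnorm (r%:C *: (1 : A)) <= `|r|.
Proof. by rewrite rnormZ cmod_real ler_piMr ?rnorm1_le1. Qed.

Definition cstarRe x : A := (2^-1)%:C *: (x + star x).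
Definition cstarIm x : A := (2^-1)%:C *: ('i%C *: (star x - x)).

Lemma conj_i : ('i%C : R[i])^* = - 'i%C.
Proof. by rewrite /Num.conj /=; congr Complex; rewrite ?oppr0. Qed.

Lemma cstarRe_sa x : star (cstarRe x) = cstarRe x.
Proof. by rewrite starZr starD starK addrC. Qed.

Lemma cstarIm_sa x : star (cstarIm x) = cstarIm x.
Proof. by rewrite starZr starZ starB starK conj_i scaleNr -scalerN opprB. Qed.

Lemma halfDD x : (2^-1)%:C *: (x + x) = x :> A.
Proof.
rewrite scalerDr -scalerDl -rmorphD /= (_ : 2^-1 + 2^-1 = 1 :> R); last by lra.
by rewrite rmorph1 scale1r.
Qed.

Lemma cstarReIm x : x = cstarRe x + 'i%C *: cstarIm x.
Proof.
rewrite /cstarIm [_ *: (_ *: (_ *: _))]scalerA [_ * (2^-1)%:C]mulrC -scalerA.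
rewrite ['i%C *: (_ *: _)]scalerA -expr2 sqr_i scaleN1r opprB -scalerDr.
by rewrite addrACA subrr addr0 halfDD.
Qed.

Lemma rnorm_cstarRe x : rnorm (cstarRe x) <= rnorm x.
Proof.
rewrite rnormZr ?invr_ge0 //.
rewrite mulrC ler_pdivrMr // mulr_natr mulr2n.
by apply: le_trans (rnormD _ _) _; rewrite rnorm_star.
Qed.

End CStarBasics.

(** * Norm limits *)

Section Limits.
Context {R : realType} {A : cstarAlgType R}.
Implicit Types (u v : nat -> A) (w x y : A).

Definition tends u w : Prop := (fun n => rnorm (u n - w)) @ \oo --> (0 : R).

Lemma tends_squeeze u w (e : nat -> R) :
  (forall n, rnorm (u n - w) <= e n) -> e @ \oo --> 0 -> tends u w.
Proof.
move=> h e0; apply: (squeeze_cvgr _ (cvg_cst 0) e0).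
by apply: nearW => n; rewrite rnorm_ge0 h.
Qed.

Lemma tends_cst x : tends (fun=> x) x.
Proof. by apply: tends_squeeze (cvg_cst 0) => n; rewrite subrr rnorm0. Qed.

Lemma tendsD u v x y : tends u x -> tends v y ->
  tends (fun n => u n + v n) (x + y).
Proof.
move=> hu hv; apply: tends_squeeze (_ : _ --> _); last first.
  by rewrite -[X in _ --> X](addr0 0); apply: cvgD; [exact: hu|exact: hv].
by move=> n; rewrite opprD addrACA; exact: rnormD.
Qed.

Lemma tendsZ k u x : tends u x -> tends (fun n => k *: u n) (k *: x).
Proof.
move=> hu; apply: tends_squeeze (_ : _ --> _); last first.
  by rewrite -[X in _ --> X](mulr0 (cmod k)); apply: cvgMr; exact: hu.
by move=> n; rewrite -scalerBr rnormZ.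
Qed.

Lemma tendsM u v x y : tends u x -> tends v y ->
  tends (fun n => u n * v n) (x * y).
Proof.
move=> hu hv; apply: (@tends_squeeze _ _ (fun n => rnorm (u n - x) *
    (rnorm (v n - y) + rnorm y) + rnorm x * rnorm (v n - y))).
  move=> n; rewrite (_ : _ - _ = (u n - x) * v n + x * (v n - y)); last first.
    by rewrite mulrBl mulrBr addrA subrK.
  apply: le_trans (rnormD _ _) (lerD _ (rnormM _ _)).
  apply: le_trans (rnormM _ _) (ler_wpM2l (rnorm_ge0 _) _).
  by rewrite -{1}(subrK y (v n)); exact: rnormD.
rewrite [X in _ --> X](_ : _ = 0 * (0 + rnorm y) + rnorm x * 0); last first.
  by rewrite mul0r mulr0 addr0.
apply: cvgD; last by apply: cvgMr; exact: hv.
by apply: cvgM; [exact: hu|apply: cvgD; [exact: hv|exact: cvg_cst]].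
Qed.

Lemma tends_star u x : tends u x -> tends (star \o u) (star x).
Proof.
move=> hu; apply: tends_squeeze (hu : _ --> _) => n /=.
by rewrite -starB rnorm_star.
Qed.

Lemma tends_unique u x y : tends u x -> tends u y -> x = y.
Proof.
move=> hu hv; apply/eqP; rewrite -subr_eq0; apply/eqP/rnorm_eq0.
apply/eqP; rewrite eq_le rnorm_ge0 andbT.
have : (fun n => rnorm (u n - x) + rnorm (u n - y)) @ \oo --> (0 : R).
  by rewrite -[X in _ --> X](addr0 0); apply: cvgD; [exact: hu|exact: hv].
move=> h; rewrite -(cvg_lim _ h) //; apply: limr_ge; first by apply: cvgP h.
apply: nearW => n; rewrite (_ : x - y = (x - u n) + (u n - y)); last by rewrite addrA subrK.
by apply: le_trans (rnormD _ _) _; rewrite (rnormBC x).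
Qed.

Lemma tends_sum (I : Type) (s : seq I) (F : I -> nat -> A) (G : I -> A) :
  (forall i, tends (F i) (G i)) ->
  tends (fun n => \sum_(i <- s) F i n) (\sum_(i <- s) G i).
Proof.
move=> h; elim: s => [|i s IH].
  rewrite big_nil (_ : (fun n => _) = fun=> 0); first exact: tends_cst.
  by apply/funext => n; rewrite big_nil.
rewrite big_cons (_ : (fun n => _) = (fun n => F i n + \sum_(j <- s) F j n)).
  exact: tendsD.
by apply/funext => n; rewrite big_cons.
Qed.

Lemma tends_ext u v x : u =1 v -> tends u x -> tends v x.
Proof. by move=> /funext ->. Qed.

Lemma tends_shift u x : tends u x -> tends (fun n => u n.+1) x.
Proof. by move=> h; rewrite /tends (cvg_shiftS (fun n => rnorm (u n - x))). Qed.

Lemma tends_cvg u w : tends u w -> u @ \oo --> w.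
Proof.
move=> /cvgrPdist_lt h; apply/cvgrPdist_lt => e e0.
have er : e = (complex.Re e)%:C by apply: ge0_ReE; exact: ltW.
have {h} := h (complex.Re e); rewrite -ltcR -er => /(_ e0).
apply: filterS => n; rewrite sub0r normrN ger0_norm ?rnorm_ge0 //.
by rewrite rnormBC rnormE er ltcR.
Qed.

Lemma cvg_tends u w : u @ \oo --> w -> tends u w.
Proof.
move=> /cvgrPdist_lt h; apply/cvgrPdist_lt => e e0.
have {h} := h e%:C; rewrite ltcR => /(_ e0).
apply: filterS => n; rewrite sub0r normrN ger0_norm ?rnorm_ge0 //.
by rewrite rnormBC rnormE ltcR.
Qed.

Lemma tends_closed (D : set A) u w : closed D -> (forall n, D (u n)) ->
  tends u w -> D w.
Proof.
move=> cD Du /tends_cvg h.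
apply: (closed_cvg (V := A) D _ _ _ h) => //.
by apply: nearW.
Qed.

Lemma tends_rnorm_le u w c : (forall n, rnorm (u n) <= c) -> tends u w ->
  rnorm w <= c.
Proof.
move=> h hu; rewrite -[c]addr0.
have hc : (fun n => c + rnorm (u n - w)) @ \oo --> c + 0.
  by apply: cvgD; [exact: cvg_cst|exact: hu].
rewrite -(cvg_lim _ hc) //; apply: limr_ge; first by apply: cvgP hc.
apply: nearW => n; rewrite -{1}(subKr (u n) w).
by apply: le_trans (rnormB _ _) _; rewrite lerD2r.
Qed.

Lemma tends_cauchy u (t : nat -> R) :
  (forall m n, (m <= n)%N -> rnorm (u n - u m) <= t n - t m) ->
  cvgn t -> exists w, tends u w.
Proof.
move=> h /cvg_cauchy/cauchyP ct.
suff : cvg (u @ \oo) by move=> cu; exists (lim (u @ \oo)); apply/cvg_tends.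
apply/cauchy_cvgP/cauchy_exP => e e0.
have er : e = (complex.Re e)%:C by apply: ge0_ReE; exact: ltW.
have e1 : 0 < complex.Re e by rewrite -ltcR -er.
have [|a [N _ aN]] := ct (complex.Re e / 2); first by rewrite divr_gt0.
exists (u N); exists N => // n /= Nn.
rewrite -ball_normE /= rnormE er ltcR rnormBC.
apply: le_lt_trans (h _ _ Nn) _.
have := aN _ (leqnn N); have := aN _ Nn.
rewrite -!ball_normE /= => /ltr_normlP[h1 h2] /ltr_normlP[h3 h4]; lra.
Qed.

End Limits.

(** * Square roots by monotone iteration *)

Section SquareRootIteration.
Context {R : realType} {A : cstarAlgType R}.


(** The scalar sequence increases to [1]; it is the case [T = 1] of the iteration
    [visser] below. *)
Fixpoint visser_scalar (k : nat) : R :=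
  if k is k'.+1 then (1 + visser_scalar k' ^+ 2) / 2 else 0.

Lemma visser_scalar01 k : 0 <= visser_scalar k <= 1.
Proof.
elim: k => [|k /andP[t0 t1]] /=; first by rewrite lexx ler01.
have := sqr_ge0 (visser_scalar k); have : visser_scalar k ^+ 2 <= 1 by rewrite expr_le1.
by move=> *; apply/andP; split; lra.
Qed.

Lemma visser_scalar_step k : visser_scalar k <= visser_scalar k.+1.
Proof.
rewrite /=; set t := visser_scalar k.
by have := sqr_ge0 (t - 1); rewrite sqrrB expr1n mulr1; lra.
Qed.

Lemma visser_scalar_cvg : cvgn visser_scalar.
Proof.
apply: nondecreasing_is_cvgn; first exact/nondecreasing_seqP/visser_scalar_step.
by exists 1 => _ [k _ <-]; have /andP[] := visser_scalar01 k.
Qed.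

Section Matrices.
Context {n : nat} (T : 'M[A]_n).

Definition halfmx (X : 'M[A]_n) : 'M[A]_n := map_mx (fun x => (2^-1)%:C *: x) X.


Lemma halfmxB X Y : halfmx (X - Y) = halfmx X - halfmx Y.
Proof. by apply/matrixP => i j; rewrite !mxE scalerBr. Qed.

Lemma mulmx_halfr X Y : X * halfmx Y = halfmx (X * Y).
Proof.
apply/matrixP => i j; rewrite !mxE scaler_sumr; apply: eq_bigr => k _.
by rewrite mxE scalerMr.
Qed.

Lemma mulmx_halfl X Y : halfmx X * Y = halfmx (X * Y).
Proof.
apply/matrixP => i j; rewrite !mxE scaler_sumr; apply: eq_bigr => k _.
by rewrite mxE scalerMl.
Qed.

Lemma halfmx_double X : halfmx X + halfmx X = X.
Proof. by apply/matrixP => i j; rewrite !mxE -scalerDr halfDD. Qed.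

(** Visser's iteration for [1 - sqrt (1 - T)]. Its increments are polynomials in
    [T] with nonnegative coefficients, so for a power-bounded [T] they are
    dominated by those of the scalar sequence. *)
Fixpoint visser (k : nat) : 'M[A]_n :=
  if k is k'.+1 then halfmx (T + visser k' ^+ 2) else 0.

(** Since only the entries of powers of [T] are controlled, a norm of ['M_n] is
    replaced by the seminorm-like predicate [powbound], on which [T] acts
    contractively by construction; [opbound] is the induced operator bound, so
    that bounds of products need no computation with polynomials in [T]. *)
Definition powbound (Z : 'M[A]_n) (s : R) : Prop :=
  forall k i j, rnorm ((T ^+ k * Z) i j) <= s.

Definition opbound (X : 'M[A]_n) (r : R) : Prop :=
  forall Z s, powbound Z s -> powbound (X * Z) (r * s).

Lemma opboundD X Y r s : opbound X r -> opbound Y s -> opbound (X + Y) (r + s).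
Proof.
move=> hX hY Z u hZ k i j; rewrite mulrDl mulrDr mxE mulrDl.
by apply: le_trans (rnormD _ _) (lerD (hX _ _ hZ _ _ _) (hY _ _ hZ _ _ _)).
Qed.

Lemma opboundM X Y r s : opbound X r -> opbound Y s -> opbound (X * Y) (r * s).
Proof. by move=> hX hY Z u hZ; rewrite -!mulrA; apply/hX/hY. Qed.

Lemma opbound_half X r : opbound X r -> opbound (halfmx X) (r / 2).
Proof.
move=> hX Z u hZ k i j; rewrite mulmx_halfl mulmx_halfr mxE.
rewrite rnormZr ?invr_ge0 // mulrAC mulrC ler_pM2r ?invr_gt0 //; exact: hX.
Qed.

Lemma opboundT : opbound T 1.
Proof. by move=> Z s hZ k i j; rewrite mulrA -exprSr mul1r. Qed.

Lemma opbound0 : opbound 0 0.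
Proof. by move=> Z s hZ k i j; rewrite mul0r mulr0 mxE rnorm0 mul0r. Qed.

Lemma opbound_visser k :
  opbound (visser k) (visser_scalar k) /\
  opbound (visser k.+1 - visser k) (visser_scalar k.+1 - visser_scalar k).
Proof.
elim: k => [|k [IH1 IH2]].
  split; first exact: opbound0.
  rewrite /= !subr0 !expr0n /= !addr0.
  exact: opbound_half opboundT.
have h1 : opbound (visser k.+1) (visser_scalar k.+1).
  rewrite -(subrK (visser k) (visser k.+1)).
  rewrite -(subrK (visser_scalar k) (visser_scalar k.+1)); exact: opboundD.
split=> //.
set X := visser k.+1 in IH2 h1 *; set Y := visser k in IH1 IH2 *.
set x := visser_scalar k.+1 in IH2 h1 *; set y := visser_scalar k in IH1 IH2 *.
have -> : visser k.+2 - X = halfmx (X * (X - Y) + (X - Y) * Y).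
  rewrite {2}/X /= -/X -/Y -halfmxB; congr halfmx.
  by rewrite opprD addrACA subrr add0r mulrBr mulrBl addrA subrK !expr2.
have -> : visser_scalar k.+2 - x = (x * (x - y) + (x - y) * y) / 2.
  have -> : visser_scalar k.+2 = (1 + x ^+ 2) / 2 by [].
  have -> : (1 + x ^+ 2) / 2 - x = (1 + x ^+ 2) / 2 - (1 + y ^+ 2) / 2 by [].
  by clearbody x y; field.
by apply: opbound_half; apply: opboundD; apply: opboundM.
Qed.

Lemma opbound_visserB k l : (k <= l)%N ->
  opbound (visser l - visser k) (visser_scalar l - visser_scalar k).
Proof.
move=> kl; rewrite -(subnK kl); elim: (l - k)%N => [|m IH].
  by rewrite !subrr; exact: opbound0.
rewrite addSn -(subrKA (visser (m + k))) -(subrKA (visser_scalar (m + k))).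
by apply: opboundD => //; exact: (opbound_visser _).2.
Qed.

Lemma visser_sqrt : (forall k i j, rnorm ((T ^+ k) i j) <= 1) ->
  exists W : 'M[A]_n, [/\ (1 - W) ^+ 2 = 1 - T,
    forall i j, tends (fun k => visser k i j) (W i j) &
    forall i j, rnorm (W i j) <= 1].
Proof.
move=> hT.
have h1 : powbound 1 1 by move=> k i j; rewrite mulr1.
have cW i j : exists w, tends (fun k => visser k i j) w.
  apply: tends_cauchy visser_scalar_cvg => k l kl.
  have := opbound_visserB kl h1 0%N i j.
  by rewrite expr0 mul1r !mulr1 !mxE.
have [W hW] := choice (fun ij => cW ij.1 ij.2).
pose W' : 'M[A]_n := \matrix_(i, j) W (i, j).
have hW' i j : tends (fun k => visser k i j) (W' i j).
  by rewrite mxE; exact: (hW (i, j)).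
have bW i j : rnorm (W' i j) <= 1.
  apply: tends_rnorm_le (hW' i j) => k.
  have := (opbound_visser k).1 _ _ h1 0%N i j; rewrite expr0 mul1r !mulr1.
  by move=> /le_trans; apply; have /andP[] := visser_scalar01 k.
exists W'; split=> //.
have e : W' = halfmx (T + W' ^+ 2).
  apply/matrixP => i j; apply: tends_unique (tends_shift (hW' i j)) _.
  rewrite mxE [(T + _) i j]mxE expr2 [(W' * W') i j]mxE.
  apply: (tends_ext (u := fun k => (2^-1)%:C *: (T i j +
      \sum_l visser k i l * visser k l j))).
    by move=> k; rewrite /= mxE [(T + _) i j]mxE expr2 [(visser k * visser k) i j]mxE.
  apply/tendsZ/tendsD; first exact: tends_cst.
  by apply: tends_sum => l; exact: tendsM.
have e2 : W' + W' = T + W' ^+ 2 by rewrite {1 2}e halfmx_double.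
rewrite expr2 mulrBl mul1r mulrBr mulr1 opprB addrCA -addrA -opprD e2 opprD.
by rewrite addrCA (addrCA (W' ^+ 2)) subrr addr0.
Qed.

End Matrices.
End SquareRootIteration.

(** * The positive cone of a C*-algebra *)

Section Subalgebras.
Context {R : realType} {A : cstarAlgType R} {D : set A}.
Hypothesis hD : cstar_subalgebra D.
Implicit Types (x y : A) (k : R[i]).

Lemma subalg1 : D 1. Proof. by have [] := hD. Qed.

Lemma subalgM x y : D x -> D y -> D (x * y).
Proof. by have [_ _ _ h _] := hD; exact: h. Qed.

Lemma subalg_star x : D x -> D (star x).
Proof. by have [_ _ _ _ h] := hD; exact: h. Qed.

Lemma subalg0 : D 0.
Proof.
have [_ _ h _ _] := hD; rewrite -(addNr 1) -scaleN1r.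
by apply: h; exact: subalg1.
Qed.

Lemma subalgZ k x : D x -> D (k *: x).
Proof.
by have [_ _ h _ _] := hD; move=> Dx; rewrite -[_ *: _]addr0; apply: h Dx subalg0.
Qed.

Lemma subalgD x y : D x -> D y -> D (x + y).
Proof. by have [_ _ h _ _] := hD; move=> Dx; rewrite -[x]scale1r; exact: h. Qed.

Lemma subalgN x : D x -> D (- x).
Proof. by move=> Dx; rewrite -scaleN1r; exact: subalgZ. Qed.

Lemma subalgB x y : D x -> D y -> D (x - y).
Proof. by move=> Dx Dy; apply: subalgD => //; exact: subalgN. Qed.

Lemma subalgX x n : D x -> D (x ^+ n).
Proof.
move=> Dx; elim: n => [|n IH]; first by rewrite expr0; exact: subalg1.
by rewrite exprS; exact: subalgM.
Qed.

Lemma subalg_sum (I : Type) (s : seq I) (P : pred I) (F : I -> A) :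
  (forall i, P i -> D (F i)) -> D (\sum_(i <- s | P i) F i).
Proof. by move=> h; apply: big_ind => //; [exact: subalg0|exact: subalgD]. Qed.

Lemma subalg_limit u x : (forall n, D (u n)) -> tends u x -> D x.
Proof. by move=> h; apply: tends_closed => //; have [] := hD. Qed.

End Subalgebras.

Section Cone.
Context {R : realType} {A : cstarAlgType R}.
Implicit Types (a b c u x y : A) (r s t : R).

Definition rcst r : A := r%:C *: (1 : A).

Lemma rcstD r s : rcst (r + s) = rcst r + rcst s.
Proof. by rewrite /rcst rmorphD scalerDl. Qed.
Lemma rcstN r : rcst (- r) = - rcst r.
Proof. by rewrite /rcst rmorphN scaleNr. Qed.
Lemma rcst0 : rcst 0 = 0.
Proof. by rewrite /rcst scale0r. Qed.
Lemma rcst1 : rcst 1 = 1.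
Proof. by rewrite /rcst rmorph1 scale1r. Qed.
Lemma rcst_mull r x : rcst r * x = r%:C *: x.
Proof. by rewrite scalerMl mul1r. Qed.
Lemma rcst_mulr r x : x * rcst r = r%:C *: x.
Proof. by rewrite scalerMr mulr1. Qed.
Lemma star_rcst r : star (rcst r) = rcst r.
Proof. by rewrite starZr star1. Qed.
Lemma rnorm_rcst r : 0 <= r -> rnorm (rcst r) <= r.
Proof. by move=> r0; rewrite -{2}(ger0_norm r0); exact: rnorm_cst. Qed.
Lemma rcst_scale r s : r%:C *: rcst s = rcst (r * s).
Proof. by rewrite /rcst scalerA -rmorphM. Qed.

Lemma rnormX_le1 x n : rnorm x <= 1 -> rnorm (x ^+ n) <= 1.
Proof.
move=> h; elim: n => [|n IH]; first by rewrite expr0 rnorm1_le1.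
rewrite exprS; apply: le_trans (rnormM _ _) _.
by rewrite mulr_ile1 ?rnorm_ge0.
Qed.

(** Positivity is measured by the distance to a large multiple of [1], which
    makes the cone property immediate, with no spectral theory. *)
Definition cpos a : Prop :=
  star a = a /\ exists2 t, 0 <= t & rnorm (rcst t - a) <= t.

Lemma cpos_sa a : cpos a -> star a = a. Proof. by case. Qed.

Lemma cposD a b : cpos a -> cpos b -> cpos (a + b).
Proof.
move=> [sa [s s0 ha]] [sb [t t0 hb]]; split; first by rewrite starD sa sb.
exists (s + t); first exact: addr_ge0.
by rewrite rcstD opprD addrACA; apply: le_trans (rnormD _ _) (lerD ha hb).
Qed.

Lemma cpos0 : cpos 0.
Proof. by split; rewrite ?star0 //; exists 0; rewrite // subr0 rcst0 rnorm0. Qed.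

Lemma cposZ r a : 0 <= r -> cpos a -> cpos (r%:C *: a).
Proof.
move=> r0 [sa [t t0 h]]; split; first by rewrite starZr sa.
exists (r * t); first exact: mulr_ge0.
by rewrite -rcst_scale -scalerBr rnormZr // ler_wpM2l.
Qed.

Lemma cpos_rcst_sub c r : star c = c -> rnorm c <= r -> cpos (rcst r - c).
Proof.
move=> sc h; split; first by rewrite starB star_rcst sc.
by exists r; [exact: le_trans (rnorm_ge0 _) h|rewrite subKr].
Qed.

(** The limit [w] of the iteration satisfies [rnorm w <= 1], so the root [1 - w]
    is itself positive; commutation and membership pass to the limit. *)
Lemma sqrt_contraction (t : A) : star t = t -> rnorm t <= 1 ->
  exists b, [/\ b ^+ 2 = 1 - t, cpos b, forall x, x * t = t * x -> x * b = b * x &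
    forall D : set A, cstar_subalgebra D -> D t -> D b].
Proof.
move=> st t1.
pose T : 'M[A]_1 := t%:M.
have TX k i j : (T ^+ k) i j = t ^+ k.
  elim: k i j => [|k IH] i j; first by rewrite !expr0 mxE !ord1.
  by rewrite !exprS mxE big_ord1 IH mxE !ord1.
have [|W [W2 Wlim W1]] := @visser_sqrt _ _ _ T.
  by move=> k i j; rewrite TX; exact: rnormX_le1.
pose v k : A := visser T k 0 0.
have v0 : v 0%N = 0 by rewrite /v /= mxE.
have vS k : v k.+1 = (2^-1)%:C *: (t + v k * v k).
  by rewrite /v /= mxE [(T + _) _ _]mxE mxE expr2 [(visser _ _ * _) _ _]mxE big_ord1.
have vlim : tends v (W 0 0) := Wlim 0 0.
have vind (Q : A -> Prop) : Q 0 ->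
    (forall y, Q y -> Q ((2^-1)%:C *: (t + y * y))) -> forall k, Q (v k).
  by move=> Q0 QS; elim=> [|k IH]; rewrite ?v0 ?vS //; exact: QS.
have sW : star (W 0 0) = W 0 0.
  apply: tends_unique (tends_star vlim) _.
  apply: (tends_ext _ vlim) => k /=; move: k.
  apply: (vind (fun y => y = star y)); first by rewrite star0.
  by move=> y sy; rewrite starZr starD starM -sy st.
exists (1 - W 0 0); split.
- have := congr1 (fun X : 'M[A]_1 => X 0 0) W2.
  rewrite expr2 mxE big_ord1 !mxE /= -expr2 => e.
  by rewrite -e; congr ((1 - W _ _) ^+ 2); apply/val_inj.
- split; first by rewrite starB star1 sW.
  by exists 1; rewrite // rcst1 subKr.
- move=> x xt; rewrite mulrBr mulrBl mulr1 mul1r; congr (_ - _).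
  apply: tends_unique (tendsM (tends_cst x) vlim) _.
  apply: (tends_ext _ (tendsM vlim (tends_cst x))) => k /=; move: k.
  apply: (vind (fun y => y * x = x * y)); first by rewrite mul0r mulr0.
  by move=> y yx; rewrite scalerMr scalerMl mulrDr mulrDl xt -(mulrA y) yx !mulrA yx.
- move=> D hD Dt; apply: (subalgB hD); first exact: subalg1.
  apply: (subalg_limit hD) vlim; apply: (vind D); first exact: subalg0.
  by move=> y Dy; apply/(subalgZ hD)/(subalgD hD)=> //; exact: (subalgM hD).
Qed.

Lemma cpos_sqrt a : cpos a ->
  exists b, [/\ b ^+ 2 = a, cpos b, forall x, x * a = a * x -> x * b = b * x &
    forall D : set A, cstar_subalgebra D -> D a -> D b].
Proof.
move=> [sa [t t0 ha]].
have [t00|tn0] := eqVneq t 0.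
  have a0 : a = 0.
    apply: rnorm_eq0; apply/eqP; rewrite eq_le rnorm_ge0 andbT.
    by move: ha; rewrite t00 rcst0 sub0r rnormN.
  exists 0; rewrite a0 expr0n; split=> //; first exact: cpos0.
have tp : 0 < t by rewrite lt_def tn0.
have tS x : t%:C *: ((t^-1)%:C *: x) = x.
  by rewrite scalerA -rmorphM divff // rmorph1 scale1r.
have [||b [b2 bp bc bD]] := @sqrt_contraction (1 - (t^-1)%:C *: a).
- by rewrite starB star1 starZr sa.
- have -> : 1 - (t^-1)%:C *: a = (t^-1)%:C *: (rcst t - a).
    by rewrite scalerBr rcst_scale mulVf // rcst1.
  by rewrite rnormZr ?invr_ge0 // mulrC ler_pdivrMr // mul1r.
exists ((Num.sqrt t)%:C *: b); split.
- rewrite expr2 scalerMl scalerMr scalerA -rmorphM -!expr2 b2 subKr.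
  by rewrite sqr_sqrtr // tS.
- by apply: cposZ => //; exact: sqrtr_ge0.
- move=> x xa; rewrite scalerMl scalerMr bc //.
  by rewrite mulrBl mulrBr mul1r mulr1 scalerMl scalerMr xa.
- move=> D hD Da; apply: (subalgZ hD); apply: (bD _ hD); apply: (subalgB hD).
    exact: subalg1.
  exact: (subalgZ hD).
Qed.

Lemma starM_of_commuting x y : star x = x -> star y = y -> x * y = y * x ->
  star (x + 'i%C *: y) * (x + 'i%C *: y) = x ^+ 2 + y ^+ 2.
Proof.
move=> sx sy xy; rewrite starD starZ conj_i sx sy scaleNr.
rewrite mulrBl !mulrDr !scalerMl !scalerMr scalerA -!expr2 sqr_i.
by rewrite xy opprD addrA addrK scaleN1r opprK.
Qed.

(** The C*-identity for [x + 'i y]. *)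
Lemma rnorm_le_of_sum_sqr x y r : star x = x -> star y = y -> x * y = y * x ->
  0 <= r -> x ^+ 2 + y ^+ 2 = rcst (r ^+ 2) -> rnorm x <= r.
Proof.
move=> sx sy xy r0 h.
pose z := x + 'i%C *: y.
have -> : x = cstarRe z.
  rewrite /cstarRe starD starZ conj_i sx sy scaleNr addrACA subrr addr0.
  by rewrite halfDD.
apply: le_trans (rnorm_cstarRe _) _.
rewrite -(ler_pXn2r (n := 2)) ?nnegrE ?rnorm_ge0 // -rnorm_starM.
by rewrite starM_of_commuting // h; apply: rnorm_rcst; rewrite exprn_ge0.
Qed.

(** For [rnorm h <= 1] write [1 - h ^+ 2 = b ^+ 2]: then
    [h ^+ 2 + b ^+ 2 = 1] forces [rnorm b <= 1]. *)
Lemma cpos_sqr h : star h = h -> cpos (h ^+ 2).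
Proof.
move=> sh; have [h0|h0] := eqVneq (rnorm h) 0.
  by rewrite (rnorm_eq0 h0) expr0n; exact: cpos0.
have hp : 0 < rnorm h by rewrite lt_def h0 rnorm_ge0.
pose k := (rnorm h)^-1%:C *: h.
have sk : star k = k by rewrite starZr sh.
have k1 : rnorm k <= 1 by rewrite rnormZr ?invr_ge0 ?rnorm_ge0 // mulVf.
have -> : h ^+ 2 = (rnorm h ^+ 2)%:C *: k ^+ 2.
  have hk : h = (rnorm h)%:C *: k by rewrite scalerA -rmorphM divff // rmorph1 scale1r.
  by rewrite {1}hk expr2 scalerMl scalerMr scalerA -rmorphM -!expr2.
apply: cposZ; first by rewrite exprn_ge0 ?rnorm_ge0.
have [||b [b2 bp bc _]] := @sqrt_contraction (k ^+ 2).
- by rewrite starX sk.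
- by apply: rnormX_le1.
split; first by rewrite starX sk.
exists 1; rewrite // rcst1 -b2 rnorm_sqr ?(cpos_sa bp) // expr_le1 ?rnorm_ge0 //.
apply: (@rnorm_le_of_sum_sqr _ k) => //; first exact: cpos_sa.
  by rewrite bc // expr2 mulrA.
by rewrite expr1n rcst1 b2 subrK.
Qed.

Lemma cpos1 : cpos 1.
Proof. by rewrite -(expr1n A 2); apply: cpos_sqr; rewrite star1. Qed.

Lemma cpos_rcst r : 0 <= r -> cpos (rcst r).
Proof. by move=> r0; apply: cposZ => //; exact: cpos1. Qed.

Lemma cposM a b : cpos a -> cpos b -> a * b = b * a -> cpos (a * b).
Proof.
move=> /cpos_sqrt[x [<- xp xc _]] /cpos_sqrt[y [<- yp yc _]] ab.
have xy : x * y = y * x by apply: yc; rewrite [RHS]xc.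
rewrite (_ : _ * _ = (x * y) ^+ 2).
  by apply: cpos_sqr; rewrite starM !cpos_sa.
by rewrite !expr2 !mulrA -(mulrA x y x) -xy mulrA.
Qed.

Lemma cposX a n : cpos a -> cpos (a ^+ n).
Proof.
move=> ap; elim: n => [|n IH]; first by rewrite expr0; exact: cpos1.
by rewrite exprS; apply: cposM => //; rewrite -exprS exprSr.
Qed.

(** The roots of [a] and of [rcst r - a] commute and their squares add up to
    [rcst r]. *)
Lemma rnorm_le_of_cpos a r : 0 <= r -> cpos a -> cpos (rcst r - a) -> rnorm a <= r.
Proof.
move=> r0 ap rap.
have [x [x2 xp xc _]] := cpos_sqrt ap.
have [y [y2 yp yc _]] := cpos_sqrt rap.
have -> : rnorm a = rnorm x ^+ 2 by rewrite -x2 rnorm_sqr // cpos_sa.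
rewrite -(sqr_sqrtr r0) ler_pXn2r ?nnegrE ?rnorm_ge0 ?sqrtr_ge0 //.
apply: (@rnorm_le_of_sum_sqr _ y); rewrite ?cpos_sa ?sqrtr_ge0 //.
  apply: yc; rewrite mulrBr mulrBl rcst_mull rcst_mulr; congr (_ - _).
  by rewrite -x2 expr2 mulrA.
by rewrite x2 y2 addrC subrK sqr_sqrtr.
Qed.

Lemma cpos_anti a : cpos a -> cpos (- a) -> a = 0.
Proof.
move=> ap nap; apply: rnorm_eq0; apply/eqP; rewrite eq_le rnorm_ge0 andbT.
by apply: rnorm_le_of_cpos => //; rewrite rcst0 sub0r.
Qed.

Lemma cpos_le_rnorm a b : cpos a -> cpos (b - a) -> rnorm a <= rnorm b.
Proof.
move=> ap abp; apply: rnorm_le_of_cpos => //; first exact: rnorm_ge0.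
have bp : cpos b by rewrite -(subrK a b); exact: cposD.
rewrite -(subrK b (rcst _)) -addrA; apply: cposD => //.
by apply: cpos_rcst_sub => //; exact: cpos_sa.
Qed.

Lemma rnorm_rcst_sub a r : cpos a -> rnorm a <= r -> rnorm (rcst r - a) <= r.
Proof.
move=> ap ar; apply: rnorm_le_of_cpos; first exact: le_trans (rnorm_ge0 _) ar.
  by apply: cpos_rcst_sub => //; exact: cpos_sa.
by rewrite subKr.
Qed.

Lemma double_inj x y : x + x = y + y -> x = y.
Proof. by move=> h; rewrite -(halfDD x) h halfDD. Qed.

(** [p] is the absolute value of [u] and [g] its negative part. *)
Lemma negative_part u : star u = u ->
  exists p g, [/\ cpos p, star g = g, p ^+ 2 = u ^+ 2, p = u + (g + g) &
   [/\ g * u = - g ^+ 2, u * g = - g ^+ 2, p * g = g ^+ 2, g * p = g ^+ 2 &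
    forall D : set A, cstar_subalgebra D -> D u -> D p /\ D g]].
Proof.
move=> su; have [p [p2 pp pc pD]] := cpos_sqrt (cpos_sqr su).
have up : u * p = p * u by apply: pc; rewrite expr2 mulrA.
pose g := (2^-1)%:C *: (p - u).
have sg : star g = g by rewrite starZr starB su cpos_sa.
have gg : g + g = p - u by rewrite -scalerDr halfDD.
have gu : g * u = - g ^+ 2.
  have e : (g + g) * (u + u) = - ((g + g) * (g + g)).
    rewrite gg !(mulrDl, mulrDr, mulrN, mulNr) -!expr2 p2 up !opprD !opprK.
    by rewrite (addrC (- u ^+ 2) (p * u)) addrACA.
  apply/double_inj/double_inj; move: e.
  by rewrite !(mulrDl, mulrDr) -!expr2 !opprD.
have ug : u * g = - g ^+ 2.
  by rewrite -gu scalerMl scalerMr mulrBr mulrBl up.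
have pE : p = u + (g + g) by rewrite gg addrC subrK.
exists p, g; split=> //; split=> //.
- by rewrite pE mulrDl ug mulrDl -!expr2 addrA addNr add0r.
- by rewrite pE mulrDr gu mulrDr -!expr2 addrA addNr add0r.
- move=> D hD Du; have Dp : D p.
    by apply: (pD _ hD); rewrite expr2; exact: (subalgM hD).
  by split=> //; apply/(subalgZ hD)/(subalgB hD).
Qed.

End Cone.

(** * Positivity of [star b * b] *)

Section StarSquares.
Context {R : realType} {A : cstarAlgType R}.
Implicit Types (a b c g h k u x y : A).

Lemma cube_eq0 g : star g = g -> g ^+ 2 * g = 0 -> g = 0.
Proof.
move=> sg g3; apply: rnorm_eq0; apply/eqP.
have e : rnorm ((g ^+ 2) ^+ 2) = 0.
  by rewrite [X in rnorm X]expr2 {2}expr2 mulrA g3 mul0r rnorm0.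
by move: e; rewrite rnorm_sqr ?starX ?sg // rnorm_sqr // => /eqP; rewrite !expf_eq0.
Qed.

Lemma starM_add_mulstar c :
  star c * c + c * star c =
  (cstarRe c ^+ 2 + cstarRe c ^+ 2) + (cstarIm c ^+ 2 + cstarIm c ^+ 2).
Proof.
move: (cstarReIm c) (cstarRe_sa c) (cstarIm_sa c).
move: (cstarRe c) (cstarIm c) => x y -> sx sy.
rewrite starD starZ conj_i sx sy scaleNr.
rewrite !(mulrDl, mulrDr, mulrN, mulNr) !(scalerMl, scalerMr) !scalerA -!expr2.
rewrite sqr_i !scaleN1r !opprK.
rewrite addrACA [X in X + _]addrACA [X in _ + X]addrACA.
by rewrite subrr addNr addr0 add0r.
Qed.

Lemma bernoulli_cpos k n : cpos k -> cpos ((1 + k) ^+ n - 1 - n%:R%:C *: k).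
Proof.
move=> kp; elim: n => [|n IH].
  by rewrite expr0 subrr scale0r subrr; exact: cpos0.
have k1p : cpos (1 + k) by apply: cposD => //; exact: cpos1.
set B := _ - _ - _ in IH.
have -> : (1 + k) ^+ n.+1 - 1 - n.+1%:R%:C *: k =
    B * (1 + k) + n%:R%:C *: (k ^+ 2).
  rewrite /B !mulrBl -exprSr mul1r scalerMl mulrDr mulr1 -expr2 scalerDr.
  rewrite (opprD (_ *: k)) addrA addrNK -natr1 rmorphD scalerDl scale1r.
  by rewrite !opprD !addrA addrAC.
apply: cposD; last by apply: cposZ => //; exact: cposX.
apply: cposM => //; rewrite /B !mulrBl !mulrBr -exprSr -exprS !mul1r !mulr1.
by rewrite scalerMl scalerMr mulrDr mulrDl mul1r mulr1.
Qed.

(** If [star c * c = - k] with [k] positive, then [c * star c] is positive, and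
    [c] intertwines the powers of [1 + k], which grow at least linearly, with
    those of the contraction [1 - c * star c]. *)
Lemma neg_star_square c k : cpos k -> star c * c = - k -> rnorm c <= 1 -> k = 0.
Proof.
move=> kp ck c1.
have mp : cpos (c * star c).
  have -> : c * star c = (star c * c + c * star c) + k.
    by rewrite ck addrAC addNr add0r.
  rewrite starM_add_mulstar.
  by do ?[apply: cposD => //]; apply: cpos_sqr; rewrite ?cstarRe_sa ?cstarIm_sa.
have m1 : rnorm (c * star c) <= 1 by rewrite rnorm_mulstar expr_le1 ?rnorm_ge0.
pose e := 1 - c * star c.
have e1 : rnorm e <= 1 by rewrite /e -rcst1; apply: rnorm_rcst_sub.
have inter n : (1 + k) ^+ n * star c = star c * e ^+ n.
  elim: n => [|n IH]; first by rewrite !expr0 mulr1 mul1r.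
  rewrite exprSr -mulrA (_ : (1 + k) * star c = star c * e).
    by rewrite mulrA IH -mulrA -exprSr.
  by rewrite /e mulrBr mulr1 mulrA ck mulNr opprK mulrDl mul1r.
have kc n : (1 + k) ^+ n * k = k * (1 + k) ^+ n.
  by apply/esym/commrX/commrD; [exact: commr1|exact: commr_refl].
have bd n : rnorm (k * (1 + k) ^+ n) <= 1.
  rewrite -kc -rnormN -mulrN -ck mulrA inter.
  apply: le_trans (rnormM _ _) _; rewrite mulr_ile1 ?rnorm_ge0 //.
  apply: le_trans (rnormM _ _) _; rewrite mulr_ile1 ?rnorm_ge0 ?rnorm_star //.
  exact: rnormX_le1.
have grow n : n%:R * rnorm k ^+ 2 <= 1.
  rewrite -rnorm_sqr ?cpos_sa // -rnormZr //; apply: le_trans (bd n).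
  apply: cpos_le_rnorm; first by apply: cposZ => //; exact: cposX.
  have -> : k * (1 + k) ^+ n - n%:R%:C *: k ^+ 2 =
      k * ((1 + k) ^+ n - 1 - n%:R%:C *: k) + k.
    by rewrite !mulrBr mulr1 scalerMr -expr2 addrAC subrK.
  apply: cposD => //; apply: cposM => //; first exact: bernoulli_cpos.
  by rewrite !mulrBr !mulrBl kc mul1r mulr1 scalerMl scalerMr.
apply: rnorm_eq0; apply/eqP/negPn/negP => k0.
have kp2 : 0 < rnorm k ^+ 2 by rewrite exprn_gt0 // lt_def k0 rnorm_ge0.
have := grow (Num.bound (rnorm k ^+ 2)^-1); rewrite leNgt => /negP; apply.
rewrite -ltr_pdivrMr // div1r; apply: archi_boundP.
by rewrite invr_ge0 ltW.
Qed.

(** With [g] the negative part of [star b * b], the product [c = b * g] satisfies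
    [star c * c = - g ^+ 3], so [g] vanishes. *)
Lemma cpos_starM b : cpos (star b * b).
Proof.
set h := star b * b.
have sh : star h = h by rewrite starM starK.
have [p [g [pp sg p2 pE [gh hg pg gp _]]]] := negative_part sh.
have g3 : g ^+ 2 * g = p * g ^+ 2 by rewrite expr2 mulrA pg expr2.
have kp : cpos (p * g ^+ 2).
  apply: cposM => //; [exact: cpos_sqr|].
  by rewrite -g3 expr2 -!mulrA gp expr2.
have ck : star (b * g) * (b * g) = - (p * g ^+ 2).
  by rewrite starM sg !mulrA -(mulrA g) -/h gh mulNr g3 expr2 mulrA.
pose s := (1 + rnorm (b * g))^-1.
have s1 : 0 < 1 + rnorm (b * g) by rewrite ltr_pwDl ?rnorm_ge0.
have s0 : 0 < s by rewrite invr_gt0.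
have : (s ^+ 2)%:C *: (p * g ^+ 2) = 0.
  apply: (@neg_star_square (s%:C *: (b * g))).
  - by apply: cposZ => //; rewrite exprn_ge0 // ltW.
  - by rewrite starZr scalerMl scalerMr scalerA -rmorphM -expr2 ck scalerN.
  - by rewrite rnormZr ?(ltW s0) // mulrC ler_pdivrMr // mul1r lerDr ler01.
move/eqP; rewrite scaler_eq0 => /orP[/eqP s20|/eqP k0].
  by have := complexI s20; move/eqP; rewrite expf_eq0 /= gt_eqF.
have g0 : g = 0 by apply: cube_eq0; rewrite // g3.
by rewrite (_ : h = p) // pE g0 !addr0.
Qed.

Lemma cpos_starME a : cpos a <-> exists b, a = star b * b.
Proof.
split=> [/cpos_sqrt[b [<- bp _ _]]|[b ->]]; last exact: cpos_starM.
by exists b; rewrite cpos_sa.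
Qed.

End StarSquares.

(** * States *)

Section States.
Context {R : realType} {A : cstarAlgType R}.
Implicit Types (f : A -> R[i]) (a b h x y : A).

Definition linear_functional (V : lmodType R[i]) (f : V -> R[i]) : Prop :=
  forall k (x y : V), f (k *: x + y) = k * f x + f y.

Section Linear.
Context {V : lmodType R[i]} {f : V -> R[i]}.
Hypothesis hf : linear_functional f.
Lemma functionalD (x y : V) : f (x + y) = f x + f y.
Proof. by rewrite -[x in LHS]scale1r hf mul1r. Qed.
Lemma functional0 : f 0 = 0.
Proof. by apply: (addrI (f 0)); rewrite -functionalD !addr0. Qed.
Lemma functionalZ k (x : V) : f (k *: x) = k * f x.
Proof. by rewrite -[_ *: _]addr0 hf functional0 addr0. Qed.
Lemma functionalN (x : V) : f (- x) = - f x.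
Proof. by rewrite -scaleN1r functionalZ mulN1r. Qed.
Lemma functionalB (x y : V) : f (x - y) = f x - f y.
Proof. by rewrite functionalD functionalN. Qed.
End Linear.

Definition is_state f : Prop :=
  [/\ linear_functional f, f 1 = 1 & forall x, cmod (f x) <= rnorm x].

Lemma state_rcst f r : is_state f -> f (rcst r) = r%:C.
Proof. by move=> [lf f1 _]; rewrite functionalZ // f1 mulr1. Qed.

(** The norm of [h + 'i s] grows only quadratically in [s], with no linear
    term, which leaves no room for an imaginary part of [f h]. *)
Lemma state_sa f h : is_state f -> star h = h -> complex.Im (f h) = 0.
Proof.
move=> fs sh; have [lf f1 fb] := fs.
have key s : (complex.Im (f h) + s) ^+ 2 <= rnorm h ^+ 2 + s ^+ 2.
  pose z := h + 'i%C *: rcst s.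
  have fz : f z = f h + 'i%C * s%:C by rewrite functionalD // functionalZ // state_rcst.
  have -> : complex.Im (f h) + s = complex.Im (f z).
    by rewrite fz; case: (f h) => ? ?; simpc.
  have le1 : complex.Im (f z) ^+ 2 <= cmod (f z) ^+ 2.
    by rewrite -lecR [X in _ <= X]rmorphXn /= -cmodE -add_Re2_Im2 lecR lerDr sqr_ge0.
  apply: le_trans le1 _.
  apply: (@le_trans _ _ (rnorm z ^+ 2)).
    by rewrite ler_pXn2r ?nnegrE ?cmod_ge0 ?rnorm_ge0.
  rewrite -rnorm_starM starM_of_commuting ?star_rcst ?rcst_mull ?rcst_mulr //.
  apply: le_trans (rnormD _ _) (lerD _ _); first by rewrite rnorm_sqr.
  rewrite expr2 rcst_mull rcst_scale -expr2.
  by apply: rnorm_rcst; exact: sqr_ge0.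
apply/eqP/negPn/negP => b0; set b := complex.Im (f h) in key b0.
have := key ((rnorm h ^+ 2 + 1) / (2 * b)); rewrite sqrrD.
have -> : b * ((rnorm h ^+ 2 + 1) / (2 * b)) *+ 2 = rnorm h ^+ 2 + 1.
  by field.
by have := sqr_ge0 b; lra.
Qed.

Lemma state_cpos f a : is_state f -> cpos a -> 0 <= f a.
Proof.
move=> fs ap; have [lf f1 fb] := fs.
have im0 := state_sa fs (cpos_sa ap).
have [_ [t t0 ht]] := ap.
have := le_trans (fb _) ht; rewrite functionalB // state_rcst // => h.
have := le_trans (Re_le_cmod _) h.
move: im0; case: (f a) => x y /= ->; rewrite lecE /= eqxx /=; lra.
Qed.

Lemma state_star f x : is_state f -> f (star x) = (f x)^*.
Proof.
move=> fs; have [lf f1 fb] := fs.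
have r y : star y = y -> (f y)^* = f y.
  by move=> /(state_sa fs); case: (f y) => u v /= ->; exact: conjRC.
move: (cstarReIm x) (cstarRe_sa x) (cstarIm_sa x).
move: (cstarRe x) (cstarIm x) => a b -> sa sb.
rewrite starD starZ sa sb conj_i !(functionalD lf) !(functionalZ lf).
by rewrite rmorphD rmorphM /= conj_i !r.
Qed.

Lemma state_starM_ge0 f x : is_state f -> 0 <= f (star x * x).
Proof. by move=> fs; apply: state_cpos => //; exact: cpos_starM. Qed.

Lemma state_cauchy_schwarz f x : is_state f -> (f x)^* * f x <= f (star x * x).
Proof.
move=> fs; have [lf f1 fb] := fs.
rewrite -subr_ge0.
have := state_starM_ge0 (x - f x *: (1 : A)) fs.
rewrite starB starZ star1 mulrBl !mulrBr !scalerMl !scalerMr !mulr1 !mul1r.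
rewrite !(functionalB lf) !(functionalZ lf) state_star // f1 mulr1.
by rewrite subrr subr0 (mulrC (f x)).
Qed.

(** On a self-adjoint [x], compare with the positive element
    [rcst (rnorm x) - x]; in general rotate [f x] to the positive half-line and
    take a real part. *)
Lemma positive_on_opsys_contractive (E : set A) f : operator_system E ->
  f 1 = 1 ->
  (forall k x y, E x -> E y -> f (k *: x + y) = k * f x + f y) ->
  (forall x, E x -> cpos x -> 0 <= f x) ->
  forall x, E x -> cmod (f x) <= rnorm x.
Proof.
move=> [E1 EL ES] f1 fL fp.
have E0 : E 0 by rewrite -(addNr 1) -scaleN1r; exact: EL.
have f0 : f 0 = 0.
  have := fL 1 0 0 E0 E0; rewrite scaler0 addr0 mul1r => /(congr1 (fun z => z - f 0)).
  by rewrite subrr addrK.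
have EZ k x : E x -> E (k *: x) by move=> Ex; rewrite -[_ *: _]addr0; exact: EL.
have ED x y : E x -> E y -> E (x + y) by move=> Ex; rewrite -[x]scale1r; exact: EL.
have fZ k x : E x -> f (k *: x) = k * f x.
  by move=> Ex; rewrite -[_ *: _]addr0 fL // f0 addr0.
have fD x y : E x -> E y -> f (x + y) = f x + f y.
  by move=> Ex Ey; rewrite -[x in LHS]scale1r fL // mul1r.
have sa_le x : E x -> star x = x -> f x <= (rnorm x)%:C.
  move=> Ex sx; rewrite -subr_ge0.
  have -> : (rnorm x)%:C - f x = f (rcst (rnorm x) - x).
    rewrite -(scaleN1r x) fD; [|exact: EZ|exact: EZ].
    by rewrite !fZ // f1 mulr1 mulN1r.
  apply: fp; last exact: cpos_rcst_sub.
  by rewrite -(scaleN1r x); apply: ED; exact: EZ.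
have fRe x : E x -> E (cstarRe x) by move=> Ex; apply/EZ/ED => //; exact: ES.
have fIm x : E x -> E (cstarIm x).
  by move=> Ex; apply/EZ/EZ/ED; [exact: ES|rewrite -scaleN1r; exact: EZ].
have fsa x : E x -> star x = x -> f x = (complex.Re (f x))%:C.
  move=> Ex sx; have := sa_le x Ex sx; rewrite lecE => /andP[/eqP im _].
  by move: im; case: (f x) => a b /= <-.
move=> x Ex; have [l [l1 lE]] := exists_phase (f x).
have Elx := EZ l x Ex.
have e : f (l *: x) = f (cstarRe (l *: x)).
  have Rx := fRe _ Elx; have Ix := fIm _ Elx.
  have e1 : f (l *: x) = f (cstarRe (l *: x)) + 'i%C * f (cstarIm (l *: x)).
    rewrite {1}(cstarReIm (l *: x)) fD //; last exact: EZ.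
    by rewrite [f ('i%C *: _)]fZ.
  move: (fsa _ Rx (cstarRe_sa _)) (fsa _ Ix (cstarIm_sa _)) e1.
  rewrite (fZ l x) // lE; move: (f (cstarRe _)) (f (cstarIm _)) => [a a'] [b b'] /=.
  by case=> -> [->]; simpc => -[-> _].
rewrite -lecR -lE -(fZ l x Ex) e.
apply: le_trans (sa_le _ (fRe _ Elx) (cstarRe_sa _)) _; rewrite lecR.
by apply: le_trans (rnorm_cstarRe _) _; rewrite rnormZ l1 mul1r.
Qed.

Lemma positive_functional_state f : linear_functional f -> f 1 = 1 ->
  (forall x, cpos x -> 0 <= f x) -> is_state f.
Proof.
move=> lf f1 fp; split=> // x.
by apply: (@positive_on_opsys_contractive setT f _ f1) => // y _; exact: fp.
Qed.

End States.

(** * Kernels control norms of *-homomorphisms *)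

Section StarHom.
Context {R : realType} {A B : cstarAlgType R} {D : set A} {f : A -> B}.
Hypothesis (hD : cstar_subalgebra D) (hf : unital_star_hom_on D f).
Implicit Types (x y d : A) (r : R).

Lemma shomL k x y : D x -> D y -> f (k *: x + y) = k *: f x + f y.
Proof. by have [[_ _ h] _ _] := hf; exact: h. Qed.
Lemma shom1 : f 1 = 1. Proof. by have [[_ h _] _ _] := hf. Qed.
Lemma shomM x y : D x -> D y -> f (x * y) = f x * f y.
Proof. by have [_ h _] := hf; exact: h. Qed.
Lemma shom_star x : D x -> f (star x) = star (f x).
Proof. by have [_ _ h] := hf; exact: h. Qed.
Lemma shomD x y : D x -> D y -> f (x + y) = f x + f y.
Proof. by move=> Dx Dy; rewrite -[x in LHS]scale1r shomL // scale1r. Qed.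
Lemma shom0 : f 0 = 0.
Proof.
have D0 := subalg0 hD.
by apply: (addrI (f 0)); rewrite -shomD // !addr0.
Qed.
Lemma shomZ k x : D x -> f (k *: x) = k *: f x.
Proof.
by move=> Dx; rewrite -[_ *: _]addr0 shomL //; [rewrite shom0 addr0|exact: subalg0].
Qed.
Lemma shomN x : D x -> f (- x) = - f x.
Proof. by move=> Dx; rewrite -scaleN1r shomZ // scaleN1r. Qed.
Lemma shomB x y : D x -> D y -> f (x - y) = f x - f y.
Proof. by move=> Dx Dy; rewrite shomD ?shomN //; exact: subalgN. Qed.
Lemma shom_rcst r : f (rcst r) = rcst r.
Proof. by rewrite shomZ ?shom1 //; exact: subalg1. Qed.
Lemma shom_sqr x : D x -> f (x ^+ 2) = f x ^+ 2.
Proof. by move=> Dx; rewrite !expr2 shomM. Qed.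

Lemma subalg_rcst r : D (rcst r).
Proof. by apply: (subalgZ hD); exact: subalg1. Qed.

Lemma shom_cpos x : D x -> cpos x -> cpos (f x).
Proof.
move=> Dx xp; have [b [b2 bp _ bD]] := cpos_sqrt xp.
have Db := bD _ hD Dx.
by rewrite -b2 shom_sqr //; apply: cpos_sqr; rewrite -shom_star // cpos_sa.
Qed.

Lemma shom_contractive d : D d -> rnorm (f d) <= rnorm d.
Proof.
move=> Dd; rewrite -(ler_pXn2r (n := 2)) ?nnegrE ?rnorm_ge0 // -rnorm_starM.
have Ddd : D (star d * d) by apply: (subalgM hD) => //; exact: (subalg_star hD).
apply: rnorm_le_of_cpos; first by rewrite exprn_ge0 ?rnorm_ge0.
  exact: cpos_starM.
have -> : rcst (rnorm d ^+ 2) - star (f d) * f d =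
    f (rcst (rnorm d ^+ 2) - star d * d).
  by rewrite shomB ?shom_rcst ?shomM ?shom_star //;
    do ?[exact: subalg_rcst | exact: (subalg_star hD)].
apply: shom_cpos; first by apply: (subalgB hD) => //; exact: subalg_rcst.
by apply: cpos_rcst_sub; rewrite ?starM ?starK // rnorm_starM.
Qed.

(** The element [w ^+ 2] is the absolute value of
    [rnorm (f d) ^+ 2 - star d * d], an element whose image is positive: its
    negative part is therefore killed by [f]. *)
Lemma shom_norm_witness d : D d ->
  exists w, [/\ D w, star w = w &
    f (rcst (rnorm (f d) ^+ 2) - star d * d - w ^+ 2) = 0].
Proof.
move=> Dd; set m := rnorm (f d).
have Dsd := subalg_star hD Dd.
have Ddd : D (star d * d) by exact: (subalgM hD).
pose u := rcst (m ^+ 2) - star d * d.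
have Du : D u by apply: (subalgB hD) => //; exact: subalg_rcst.
have su : star u = u by rewrite starB star_rcst starM starK.
have [p [g [pp sg p2 pE [gu ug pg gp pgD]]]] := negative_part su.
have [Dp Dg] := pgD _ hD Du.
have [w [w2 wp _ wD]] := cpos_sqrt pp; have Dw := wD _ hD Dp.
exists w; split=> //; first exact: cpos_sa.
rewrite w2 -/u pE opprD addrA subrr add0r.
have Dgg : D (g + g) by exact: (subalgD hD).
rewrite shomN // shomD //; suff -> : f g = 0 by rewrite addr0 oppr0.
have sG : star (f g) = f g by rewrite -shom_star // sg.
have Up : cpos (f u).
  rewrite shomB ?shom_rcst ?shomM ?shom_star //; do ?[exact: subalg_rcst].
  by apply: cpos_rcst_sub; rewrite ?starM ?starK // rnorm_starM.
have Pp : cpos (f p) by exact: shom_cpos.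
have Dg2 : D (g ^+ 2) by exact: (subalgX hD).
have GU : f g * f u = - f g ^+ 2 by rewrite -shomM // gu shomN // shom_sqr.
have UG : f u * f g = - f g ^+ 2 by rewrite -shomM // ug shomN // shom_sqr.
have GP : f g * f p = f g ^+ 2 by rewrite -shomM // gp shom_sqr.
have PG : f p * f g = f g ^+ 2 by rewrite -shomM // pg shom_sqr.
have comm2 (x : B) : x * f g = f g * x -> x * f g ^+ 2 = f g ^+ 2 * x.
  by move=> h; rewrite expr2 mulrA h -mulrA h mulrA.
have G2 : cpos (f g ^+ 2) by exact: cpos_sqr.
apply: cube_eq0 => //; apply: cpos_anti.
  have -> : f g ^+ 2 * f g = f p * f g ^+ 2 by rewrite {2}expr2 mulrA PG.
  by apply: cposM => //; apply: comm2; rewrite PG.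
have -> : - (f g ^+ 2 * f g) = f u * f g ^+ 2 by rewrite {2}expr2 mulrA UG mulNr.
by apply: cposM => //; apply: comm2; rewrite UG.
Qed.

Lemma shom_isometric d : (forall x, D x -> f x = 0 -> x = 0) -> D d ->
  rnorm (f d) = rnorm d.
Proof.
move=> f_inj Dd; apply/eqP; rewrite eq_le shom_contractive //=.
have [w [Dw sw fw]] := shom_norm_witness Dd.
have Ddd : D (star d * d) by apply: (subalgM hD) => //; exact: (subalg_star hD).
have e : rcst (rnorm (f d) ^+ 2) - star d * d = w ^+ 2.
  apply/eqP; rewrite -subr_eq0; apply/eqP; apply: f_inj fw.
  apply: (subalgB hD); last exact: (subalgX hD).
  by apply: (subalgB hD) => //; exact: subalg_rcst.
rewrite -(ler_pXn2r (n := 2)) ?nnegrE ?rnorm_ge0 // -rnorm_starM.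
apply: rnorm_le_of_cpos; first by rewrite exprn_ge0 ?rnorm_ge0.
  exact: cpos_starM.
by rewrite e; exact: cpos_sqr.
Qed.

End StarHom.

Section KernelDomination.
Context {R : realType} {A B C : cstarAlgType R} {f : A -> B} {g : A -> C}.
Hypothesis (hf : unital_star_hom_on setT f) (hg : unital_star_hom_on setT g).

Lemma subalgT : cstar_subalgebra [set: A].
Proof. by split=> //; exact: closedT. Qed.

(** The witness of [shom_norm_witness] lies in both kernels, so
    [rnorm (f x) ^+ 2 - star (g x) * g x] is a square. *)
Lemma kernel_domination : (forall x, f x = 0 -> g x = 0) ->
  forall x, rnorm (g x) <= rnorm (f x).
Proof.
move=> fg x; have T := subalgT.
have [w [_ sw /fg e]] := shom_norm_witness T hf (I : [set: A] x).
have ge : rcst (rnorm (f x) ^+ 2) - star (g x) * g x = g w ^+ 2.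
  apply/eqP; rewrite -subr_eq0; move: e.
  by rewrite !(shomB T hg) // (shom_rcst T hg) (shomM hg) // (shom_star hg) //
    (shom_sqr hg) // => ->.
rewrite -(ler_pXn2r (n := 2)) ?nnegrE ?rnorm_ge0 // -rnorm_starM.
apply: rnorm_le_of_cpos; first by rewrite exprn_ge0 ?rnorm_ge0.
  exact: cpos_starM.
by rewrite ge; apply: cpos_sqr; rewrite -(shom_star hg) // sw.
Qed.

End KernelDomination.

(** * Minimal functions and the Hahn-Banach theorem *)

Section MinimalFunction.
Context {R : realType} {V : Type}.
Implicit Types (p q b : V -> R) (F : set (V -> R)).

Definition pointwise_inf F (x : V) : R := inf [set p x | p in F].

Definition pointwise_chain F : Prop :=
  forall p q, F p -> F q -> (forall x, p x <= q x) \/ (forall x, q x <= p x).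

Lemma pointwise_inf_le F b p x : (forall q x, F q -> b x <= q x) -> F p ->
  pointwise_inf F x <= p x.
Proof.
move=> hb Fp; apply: ge_inf; last by exists p.
by exists (b x) => _ [q Fq <-]; exact: hb.
Qed.

Lemma le_pointwise_inf F x c : F !=set0 -> (forall p, F p -> c <= p x) ->
  c <= pointwise_inf F x.
Proof.
move=> [p Fp] h; apply: lb_le_inf; first by exists (p x), p.
by move=> _ [q Fq <-]; exact: h.
Qed.

Lemma le_pointwise_infD F x y c : F !=set0 ->
  (forall p q, F p -> F q -> c <= p x + q y) ->
  c <= pointwise_inf F x + pointwise_inf F y.
Proof.
move=> F0 h; rewrite -lerBlDr; apply: le_pointwise_inf => // p Fp.
rewrite lerBlDl -lerBlDr; apply: le_pointwise_inf => // q Fq.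
by rewrite lerBlDl; apply: h.
Qed.

Lemma pointwise_inf_sub F b x y z : F !=set0 -> pointwise_chain F ->
  (forall q x, F q -> b x <= q x) ->
  (forall p, F p -> p z <= p x + p y) ->
  pointwise_inf F z <= pointwise_inf F x + pointwise_inf F y.
Proof.
move=> F0 Fc hb h; apply: le_pointwise_infD => // p q Fp Fq.
have [pq|qp] := Fc p q Fp Fq.
  apply: le_trans (pointwise_inf_le z hb Fp) _.
  by apply: le_trans (h _ Fp) _; rewrite lerD2l.
apply: le_trans (pointwise_inf_le z hb Fq) _.
by apply: le_trans (h _ Fq) _; rewrite lerD2r.
Qed.

Lemma pointwise_inf_scale F b x y (r : R) : F !=set0 -> 0 < r ->
  (forall q x, F q -> b x <= q x) ->
  (forall p, F p -> p y = r * p x) ->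
  pointwise_inf F y = r * pointwise_inf F x.
Proof.
move=> F0 r0 hb h; apply/eqP; rewrite eq_le; apply/andP; split.
  rewrite mulrC -ler_pdivrMr //; apply: le_pointwise_inf => // p Fp.
  by rewrite ler_pdivrMr // mulrC -h //; exact: pointwise_inf_le hb Fp.
apply: le_pointwise_inf => // p Fp; rewrite h // ler_pM2l //.
exact: pointwise_inf_le hb Fp.
Qed.

(** Zorn's lemma, the lower bound [b] making infima of chains meaningful. *)
Lemma exists_minimal_function (Q : (V -> R) -> Prop) b :
  (exists p, Q p) -> (forall p x, Q p -> b x <= p x) ->
  (forall F, F !=set0 -> F `<=` Q -> pointwise_chain F -> Q (pointwise_inf F)) ->
  exists2 p, Q p & forall q, Q q -> (forall x, q x <= p x) -> q = p.
Proof.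
move=> [p0 Qp0] hb hF.
pose T := {p : V -> R | Q p}.
pose rel (s t : T) := `[< forall x, sval t x <= sval s x >].
have [|||A totA|t tmax] := @Zorn T rel.
- by move=> t; apply/asboolP => x.
- move=> r s t /asboolP rs /asboolP st; apply/asboolP => x.
  exact: le_trans (st x) (rs x).
- move=> [s Qs] [t Qt] /asboolP /= st /asboolP /= ts.
  have e : s = t by apply/funext => x; apply/eqP; rewrite eq_le ts st.
  by subst t; congr exist; exact: Prop_irrelevance.
- have [[s0 As0]|A0] := pselect (A !=set0); last first.
    by exists (exist _ p0 Qp0) => s As; case: A0; exists s.
  pose F : set (V -> R) := [set sval s | s in A].
  have F0 : F !=set0 by exists (sval s0), s0.
  have FQ : F `<=` Q by move=> _ [s _ <-]; exact: svalP.
  have Fc : pointwise_chain F.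
    move=> _ _ [s As <-] [t At <-].
    by have [/asboolP h|/asboolP h] := totA s t As At; [right|left].
  exists (exist _ _ (hF F F0 FQ Fc)) => s As; apply/asboolP => x /=.
  apply: (@pointwise_inf_le F b); last by exists s.
  by move=> q y /FQ; exact: hb.
exists (sval t); first exact: svalP.
move=> q Qq qt; have := tmax (exist _ q Qq).
by move=> h; rewrite -h //; apply/asboolP.
Qed.

End MinimalFunction.

Section HahnBanach.
Context {R : realType} {V : lmodType R[i]}.
Implicit Types (p q m : V -> R) (x y e : V) (r s t : R).

Definition sublinear p : Prop :=
  (forall x y, p (x + y) <= p x + p y) /\
  (forall r x, 0 <= r -> p (r%:C *: x) = r * p x).

Definition complex_seminorm q : Prop :=
  (forall x y, q (x + y) <= q x + q y) /\
  (forall k x, q (k *: x) = cmod k * q x).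

Lemma sublinear0 p : sublinear p -> p 0 = 0.
Proof. by move=> [_ /(_ 0 0 (lexx 0))]; rewrite scaler0 mul0r. Qed.

Lemma sublinear_ge p x : sublinear p -> - p (- x) <= p x.
Proof.
move=> ps; rewrite -subr_ge0 opprK -(sublinear0 ps) -(subrr x); exact: ps.1.
Qed.

Lemma sublinear_of_pos p : (forall x y, p (x + y) <= p x + p y) ->
  p 0 = 0 -> (forall r x, 0 < r -> p (r%:C *: x) <= r * p x) -> sublinear p.
Proof.
move=> pD p0 pZ; split=> // r x; rewrite le_eqVlt => /orP[/eqP <-|r0].
  by rewrite scale0r mul0r.
apply/eqP; rewrite eq_le pZ //= mulrC -ler_pdivlMr // mulrC.
rewrite -{1}(scale1r x) -(rmorph1 (real_complex R)) -(mulVf (lt0r_neq0 r0)).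
by rewrite rmorphM -scalerA; apply: pZ; rewrite invr_gt0.
Qed.

(** Minimality of [m] is tested against
    [x |-> inf_(t >= 0) (m (x + t a) - t m a)]. *)
Lemma minimal_sublinear_additive (Q : (V -> R) -> Prop) m : sublinear m -> Q m ->
  (forall q, sublinear q -> (forall x, q x <= m x) -> Q q) ->
  (forall q, Q q -> (forall x, q x <= m x) -> q = m) ->
  forall x a, m (x + a) = m x + m a.
Proof.
move=> ms Qm hQ mmin x a; apply/eqP; rewrite eq_le ms.1 /=.
pose S y := [set m (y + t%:C *: a) - t * m a | t in [set t | 0 <= t]].
have Slb y : has_lbound (S y).
  exists (- m (- y)) => _ [t /= t0 <-].
  rewrite lerBrDr addrC -ms.2 // lerBlDr.
  have := ms.1 (y + t%:C *: a) (- y); rewrite addrAC addrN add0r; lra.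
have S0 y : S y !=set0 by exists (m (y + 0%:C *: a) - 0 * m a), 0 => /=.
pose q y := inf (S y).
have qle y t : 0 <= t -> q y <= m (y + t%:C *: a) - t * m a.
  by move=> t0; apply: ge_inf => //; exists t.
have le_q y c : (forall t, 0 <= t -> c <= m (y + t%:C *: a) - t * m a) -> c <= q y.
  by move=> h; apply: lb_le_inf => // _ [t /= t0 <-]; exact: h.
have qm y : q y <= m y.
  by have := qle y 0 (lexx 0); rewrite scale0r addr0 mul0r subr0.
have qs : sublinear q.
  apply: sublinear_of_pos.
  - move=> y z; rewrite -lerBlDr; apply/le_q => s s0.
    rewrite lerBlDl -lerBlDr; apply/le_q => t t0.
    rewrite lerBlDr; apply: le_trans (qle _ (s + t) (addr_ge0 s0 t0)) _.
    rewrite rmorphD scalerDl addrACA mulrDl.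
    by have := ms.1 (y + s%:C *: a) (z + t%:C *: a); lra.
  - apply/eqP; rewrite eq_le; apply/andP; split.
      by have := qm 0; rewrite (sublinear0 ms).
    by apply/le_q => t t0; rewrite add0r ms.2 // subrr.
  - move=> r y r0; rewrite mulrC -ler_pdivrMr //; apply/le_q => t t0.
    rewrite ler_pdivrMr //; apply: le_trans (qle _ (r * t) _) _.
      by rewrite mulr_ge0 // ltW.
    rewrite rmorphM -scalerA -scalerDr ms.2 ?(ltW r0) //.
    by rewrite -subr_ge0 [X in _ <= X](_ : _ = 0) //; ring.
have qE : q = m := mmin q (hQ q qs qm) qm.
have := qle x 1 ler01; rewrite rmorph1 scale1r mul1r qE; lra.
Qed.

(** A minimal element among the sublinear functions below [p], and below [u] on
    [E], is additive; such functions exist because of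
    [y |-> inf_(e in E) (p (y - e) + u e)]. *)
Lemma real_hahn_banach (E : set V) (u : V -> R) p : sublinear p ->
  E 0 -> (forall x y, E x -> E y -> E (x + y)) ->
  (forall r x, E x -> E (r%:C *: x)) ->
  (forall x y, E x -> E y -> u (x + y) = u x + u y) ->
  (forall r x, E x -> u (r%:C *: x) = r * u x) ->
  (forall x, E x -> u x <= p x) ->
  exists m, [/\ sublinear m, forall x y, m (x + y) = m x + m y,
    forall x, m x <= p x & forall x, E x -> m x = u x].
Proof.
move=> ps E0 ED EZ uD uZ up.
have EN x : E x -> E (- x).
  by move=> /(EZ (-1)); rewrite rmorphN rmorph1 scaleN1r.
have uN x : E x -> u (- x) = - u x.
  by move=> Ex; rewrite -scaleN1r -(rmorph1 (real_complex R)) -rmorphN uZ // mulN1r.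
pose Q m := [/\ sublinear m, forall x, m x <= p x & forall e, E e -> m e <= u e].
have hb m x : Q m -> - p (- x) <= m x.
  by move=> [ms mp _]; apply: le_trans (sublinear_ge x ms); rewrite lerN2.
have [||F F0 FQ Fc|m [ms mp mu] mmin] :=
  @exists_minimal_function R V Q (fun x => - p (- x)).
- pose S y := [set p (y - e) + u e | e in E].
  have Slb y : has_lbound (S y).
    exists (- p (- y)) => _ [e /= Ee <-].
    have := up _ (EN _ Ee); rewrite uN //.
    have := ps.1 (y - e) (- y); rewrite addrAC subrr add0r; lra.
  pose q y := inf (S y).
  have qle y e : E e -> q y <= p (y - e) + u e.
    by move=> Ee; apply: ge_inf => //; exists e.
  have le_q y c : (forall e, E e -> c <= p (y - e) + u e) -> c <= q y.
    move=> h; apply: lb_le_inf; first by exists (p (y - 0) + u 0), 0.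
    by move=> _ [t /= t0 <-]; exact: h.
  have u0 : u 0 = 0 by have := uZ 0 0 E0; rewrite scaler0 mul0r.
  have qp x : q x <= p x by have := qle x 0 E0; rewrite subr0 u0 addr0.
  exists q; split=> //; last first.
    by move=> e Ee; have := qle e e Ee; rewrite subrr (sublinear0 ps) add0r.
  apply: sublinear_of_pos.
  - move=> y z; rewrite -lerBlDr; apply/le_q => s s0.
    rewrite lerBlDl -lerBlDr; apply/le_q => t t0.
    rewrite lerBlDr; apply: le_trans (qle _ (s + t) (ED _ _ s0 t0)) _.
    rewrite opprD addrACA uD //.
    by have := ps.1 (y - s) (z - t); lra.
  - apply/eqP; rewrite eq_le; apply/andP; split.
      by have := qp 0; rewrite (sublinear0 ps).
    by apply/le_q => t t0; rewrite sub0r; have := up _ (EN _ t0); rewrite uN //; lra.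
  - move=> r y r0; rewrite mulrC -ler_pdivrMr //; apply/le_q => t t0.
    rewrite ler_pdivrMr //; apply: le_trans (qle _ (r%:C *: t) (EZ _ _ t0)) _.
    rewrite -scalerBr ps.2 ?(ltW r0) // uZ // -subr_ge0.
    by rewrite [X in _ <= X](_ : _ = 0) //; ring.
- exact: hb.
- have hbF q x : F q -> - p (- x) <= q x by move=> /FQ; exact: hb.
  have [q0 Fq0] := F0.
  have infle q x : F q -> pointwise_inf F x <= q x.
    by move=> Fq; exact: (pointwise_inf_le x hbF Fq).
  split.
  + apply: sublinear_of_pos.
    * move=> x y; apply: (pointwise_inf_sub F0 Fc hbF) => q /FQ[qs _ _]; exact: qs.1.
    * apply/eqP; rewrite eq_le; apply/andP; split.
        by apply: le_trans (infle _ 0 Fq0) _; have [/sublinear0 -> _ _] := FQ _ Fq0.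
      by apply: le_pointwise_inf => // q /FQ[/sublinear0 -> _ _].
    * move=> r x r0; rewrite (pointwise_inf_scale F0 r0 hbF (x := x)) //.
      by move=> q /FQ[qs _ _]; rewrite qs.2 // ltW.
  + by move=> x; apply: le_trans (infle _ x Fq0) _; have [_ h _] := FQ _ Fq0.
  + by move=> x Ex; apply: le_trans (infle _ x Fq0) _; have [_ _ h] := FQ _ Fq0; exact: h.
have mD : forall x y, m (x + y) = m x + m y.
  apply: (minimal_sublinear_additive ms (Q := Q)) => // q qs qm; split=> // [x|e Ee].
    exact: le_trans (qm x) (mp x).
  exact: le_trans (qm e) (mu e Ee).
exists m; split=> // x Ex; apply/eqP; rewrite eq_le mu //=.
have := mu _ (EN _ Ex); rewrite uN //.
by have := mD x (- x); rewrite subrr (sublinear0 ms); lra.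
Qed.

(** A complex functional is determined by its real part [m] as
    [m x - 'i m ('i x)], and a rotation of the argument carries the bound over
    from [m]. *)
Theorem complex_hahn_banach (E : set V) (f : V -> R[i]) q : complex_seminorm q ->
  E 0 -> (forall k x y, E x -> E y -> E (k *: x + y)) ->
  (forall k x y, E x -> E y -> f (k *: x + y) = k * f x + f y) ->
  (forall x, E x -> cmod (f x) <= q x) ->
  exists g, [/\ linear_functional g, forall x, cmod (g x) <= q x &
    forall x, E x -> g x = f x].
Proof.
move=> [qD qZ] E0 EL fL fq.
have ED x y : E x -> E y -> E (x + y) by move=> Ex; rewrite -[x]scale1r; exact: EL.
have EZ k x : E x -> E (k *: x) by move=> Ex; rewrite -[_ *: _]addr0; exact: EL.
have f0 : f 0 = 0.
  have := fL 1 0 0 E0 E0; rewrite scaler0 addr0 mul1r => /(congr1 (fun z => z - f 0)).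
  by rewrite subrr addrK.
have fZ k x : E x -> f (k *: x) = k * f x.
  by move=> Ex; rewrite -[_ *: _]addr0 fL // f0 addr0.
have fD x y : E x -> E y -> f (x + y) = f x + f y.
  by move=> Ex Ey; rewrite -[x in LHS]scale1r fL // mul1r.
have qs : sublinear q by split=> // r x r0; rewrite qZ cmod_real ger0_norm.
have [||||m [[_ mZ] mD mq mE]] :=
  @real_hahn_banach E (fun x => complex.Re (f x)) q qs E0 ED.
- by move=> r x; exact: EZ.
- by move=> x y Ex Ey; rewrite fD //; case: (f x) (f y) => ? ? [].
- by move=> r x Ex; rewrite fZ //; case: (f x) => a b; simpc.
- by move=> x Ex; apply: le_trans (Re_le_cmod _) (fq _ Ex).
have m0 : m 0 = 0 by have := mZ 0 0 (lexx 0); rewrite scale0r mul0r.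
have mN x : m (- x) = - m x.
  by apply/eqP; rewrite -addr_eq0 -mD addNr m0.
have mZr r x : m (r%:C *: x) = r * m x.
  have [r0|r0] := leP 0 r; first exact: mZ.
  have := mZ (- r) x; rewrite oppr_ge0 (ltW r0) rmorphN scaleNr mN mulNr.
  by move=> /(_ isT) /oppr_inj.
pose g x : R[i] := Complex (m x) (- m ('i%C *: x)).
have gD x y : g (x + y) = g x + g y.
  by rewrite /g scalerDr !mD opprD; simpc.
have gr r x : g (r%:C *: x) = r%:C * g x.
  by rewrite /g scalerA mulrC -scalerA !mZr; simpc.
have gi x : g ('i%C *: x) = 'i%C * g x.
  by rewrite /g scalerA -expr2 sqr_i scaleN1r mN opprK; simpc.
have gl : linear_functional g.
  move=> k x y; rewrite gD; congr (_ + _).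
  by rewrite [k in LHS]complexE scalerDl gD -scalerA gi !gr mulrA -mulrDl -complexE.
exists g; split=> // x.
  have [l [l1 lE]] := exists_phase (g x).
  rewrite -(functionalZ gl) in lE.
  have <- : m (l *: x) = cmod (g x).
    exact: (congr1 (@complex.Re R) lE).
  by apply: le_trans (mq _) _; rewrite qZ l1 mul1r.
move=> Ex; rewrite /g !mE //; last exact: EZ.
by rewrite fZ //; case: (f x) => a b; simpc.
Qed.

End HahnBanach.

(** * Characters of abelian C*-algebras *)

(** A copy of an abelian C*-algebra that carries a commutative ring structure,
    so that polynomial identities can be left to the decision procedure. *)
Definition abelian_copy (R : realType) (A : cstarAlgType R)
  (hA : forall x y : A, x * y = y * x) : Type := A.

Section AbelianCopy.
Context {R : realType} {A : cstarAlgType R} (hA : forall x y : A, x * y = y * x).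
HB.instance Definition _ := GRing.PzRing.copy (abelian_copy hA) A.
HB.instance Definition _ :=
  GRing.PzRing_hasCommutativeMul.Build (abelian_copy hA) hA.
End AbelianCopy.

Section Characters.
Context {R : realType} {A : cstarAlgType R}.
Hypothesis hA : forall x y : A, x * y = y * x.
Implicit Types (a b h j s t x y : A) (M N T : set A).


Lemma star_abelianM x y : star x = x -> star y = y -> star (x * y) = x * y.
Proof. by move=> sx sy; rewrite starM sx sy hA. Qed.

(** A preordering of the real algebra of self-adjoint elements. By Krivine's
    argument, maximal ones are exactly the sets [{a | 0 <= y a}] for a
    character [y]. *)
Definition preordering M : Prop :=
  [/\ forall a, M a -> star a = a,
      forall a b, M a -> M b -> M (a + b),
      forall a b, M a -> M b -> M (a * b),
      forall h, star h = h -> M (h ^+ 2) &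
      ~ M (- 1)].

Lemma exists_maximal_preordering T : preordering T ->
  exists M, [/\ preordering M, T `<=` M &
    forall N, preordering N -> M `<=` N -> N `<=` M].
Proof.
move=> Tp; have [Tsa TD TM Tsq T1] := Tp.
have [|M [Mp Mmax]] := @Zorn_bigcup A (fun X => preordering (X `|` T)).
  move=> F FP Ftot.
  have pair a b : (\bigcup_(X in F) X `|` T) a -> (\bigcup_(X in F) X `|` T) b ->
      (T a /\ T b) \/ exists2 X, F X & (X `|` T) a /\ (X `|` T) b.
    move=> [[X FX Xa]|Ta] [[Y FY Yb]|Tb].
    - right; have [XY|YX] := Ftot X Y FX FY.
        by exists Y => //; split; left => //; exact: XY.
      by exists X => //; split; left => //; exact: YX.
    - by right; exists X => //; split; [left|right].
    - by right; exists Y => //; split; [right|left].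
    - by left.
  have inj X a : F X -> (X `|` T) a -> (\bigcup_(X in F) X `|` T) a.
    by move=> FX [Xa|Ta]; [left; exists X|right].
  split.
  - by move=> a [[X /FP[h _ _ _ _] Xa]|]; [apply: h; left|exact: Tsa].
  - move=> a b ha hb; have [[Ta Tb]|[X FX [Xa Xb]]] := pair a b ha hb.
      by right; exact: TD.
    by apply: (inj X) => //; have [_ h _ _ _] := FP X FX; exact: h.
  - move=> a b ha hb; have [[Ta Tb]|[X FX [Xa Xb]]] := pair a b ha hb.
      by right; exact: TM.
    by apply: (inj X) => //; have [_ _ h _ _] := FP X FX; exact: h.
  - by move=> h sh; right; exact: Tsq.
  - move=> [[X FX X1]|//]; have [_ _ _ _ h] := FP X FX.
    by apply: h; left.
exists (M `|` T); split=> // N Np MN.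
have NE : N `|` T = N by apply/seteqP; split=> [a [//|Ta]|a]; [apply: MN; right|left].
apply: contrapT => NM; apply: (Mmax N); last by rewrite NE.
split; first by move=> a Ma; apply: MN; left.
by move=> NM'; apply: NM => a /NM'; left.
Qed.

Section MaximalPreordering.
Context {M : set A}.
Hypotheses (Mp : preordering M)
  (Mmax : forall N, preordering N -> M `<=` N -> N `<=` M).

Let Msa a : M a -> star a = a. Proof. by have [h _ _ _ _] := Mp; exact: h. Qed.
Let MD a b : M a -> M b -> M (a + b).
Proof. by have [_ h _ _ _] := Mp; exact: h. Qed.
Let MM a b : M a -> M b -> M (a * b).
Proof. by have [_ _ h _ _] := Mp; exact: h. Qed.
Let Msq h : star h = h -> M (h ^+ 2).
Proof. by have [_ _ _ h' _] := Mp; exact: h'. Qed.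
Let M1 : ~ M (- 1). Proof. by have [_ _ _ _ h] := Mp. Qed.

Lemma preordering_cpos a : cpos a -> M a.
Proof. by move=> /cpos_sqrt[b [<- bp _ _]]; apply: Msq; exact: cpos_sa. Qed.

Lemma preordering_rcst r : 0 <= r -> M (rcst r).
Proof. by move=> r0; apply: preordering_cpos; exact: cpos_rcst. Qed.

Lemma preorderingZ r a : 0 <= r -> M a -> M (r%:C *: a).
Proof. by move=> r0 Ma; rewrite -rcst_mull; apply: MM => //; exact: preordering_rcst. Qed.

Lemma preordering_rcst_ge0 r : M (rcst r) -> 0 <= r.
Proof.
move=> Mr; rewrite leNgt; apply/negP => r0; apply: M1.
have := @preorderingZ (- r^-1) _ _ Mr; rewrite rcst_scale mulNr mulVf ?lt_eqF //.
by rewrite rcstN rcst1; apply; rewrite oppr_ge0 invr_le0 ltW.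
Qed.

(** If neither [a] nor [- a] is in [M], adjoining either one yields [- 1]:
    [- 1 = s + a t = s' - a t']. Multiplying [a t = - 1 - s] by
    [- a t' = - 1 - s'] puts [- 1] in [M]. *)
Lemma preordering_total a : star a = a -> M a \/ M (- a).
Proof.
move=> sa.
have adj b : star b = b -> ~ M b -> exists s t, [/\ M s, M t & - 1 = s + b * t].
  move=> sb nMb; apply: contrapT => h; apply: nMb.
  pose N : set A := [set x | exists s t, [/\ M s, M t & x = s + b * t]].
  have M0 : M 0 by rewrite -rcst0; exact: preordering_rcst.
  have M1' : M 1 by rewrite -rcst1; exact: preordering_rcst.
  have MN : M `<=` N by move=> x Mx; exists x, 0; rewrite mulr0 addr0.
  apply: (Mmax _ MN); last by exists 0, 1; rewrite mulr1 add0r.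
  split.
  - by move=> _ [s [t [/Msa ss /Msa st ->]]]; rewrite starD ss star_abelianM.
  - move=> _ _ [s [t [Ms Mt ->]]] [s' [t' [Ms' Mt' ->]]].
    exists (s + s'), (t + t'); split; [exact: MD|exact: MD|].
    by rewrite mulrDr addrACA.
  - move=> _ _ [s [t [Ms Mt ->]]] [s' [t' [Ms' Mt' ->]]].
    exists (s * s' + b ^+ 2 * (t * t')), (s * t' + t * s'); split.
    + by apply: MD; [exact: MM|apply: MM; [exact: Msq|exact: MM]].
    + by apply: MD; exact: MM.
    + have e : forall b s t s' t' : abelian_copy hA, (s + b * t) * (s' + b * t') =
          s * s' + b ^+ 2 * (t * t') + b * (s * t' + t * s') by move=> *; ring.
      exact: e.
  - by move=> x sx; apply: MN; exact: Msq.
  - exact: h.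
have [Ma|nMa] := pselect (M a); first by left.
have [Ma|nMa'] := pselect (M (- a)); first by right.
exfalso; apply: M1.
have [s [t [Ms Mt e1]]] := adj a sa nMa.
have sna : star (- a) = - a by rewrite starN sa.
have [s' [t' [Ms' Mt' e2]]] := adj (- a) sna nMa'.
have -> : - 1 = s + s' + s * s' + a ^+ 2 * (t * t').
  have e : forall a s t s' t' : abelian_copy hA, - 1 = s + a * t ->
      - 1 = s' + (- a) * t' -> - 1 = s + s' + s * s' + a ^+ 2 * (t * t').
    move=> b u v u' v' h1 h2.
    have h : (- 1 - u) * (- 1 - u') = (b * v) * (- b * v').
      by rewrite {1}h1 {1}h2 addrC addKr addrC addKr.
    have -> : u * u' = (- 1 - u) * (- 1 - u') - 1 - u - u' by ring.
    by rewrite h; ring.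
  exact: (e a s t s' t').
by apply: MD; [apply: MD; [exact: MD|exact: MM]|apply: MM; [exact: Msq|exact: MM]].
Qed.

(** The kernel of the character attached to [M]: elements smaller, for the
    order of [M], than every positive constant. *)
Definition infinitesimal x : Prop :=
  star x = x /\ forall e, 0 < e -> M (rcst e + x) /\ M (rcst e - x).

Lemma infinitesimalD x y : infinitesimal x -> infinitesimal y ->
  infinitesimal (x + y).
Proof.
move=> [sx hx] [sy hy]; split; first by rewrite starD sx sy.
move=> e e0; have e2 : 0 < e / 2 by rewrite divr_gt0.
have [x1 x2] := hx _ e2; have [y1 y2] := hy _ e2.
rewrite [e]splitr rcstD opprD; split; rewrite addrACA; exact: MD.
Qed.

Lemma infinitesimalN x : infinitesimal x -> infinitesimal (- x).
Proof.
move=> [sx hx]; split; first by rewrite starN sx.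
by move=> e /hx[h1 h2]; rewrite opprK.
Qed.

Lemma infinitesimal_sqrM b x : star b = b -> infinitesimal x ->
  infinitesimal (b ^+ 2 * x).
Proof.
move=> sb [sx hx]; have sbb : star (b ^+ 2) = b ^+ 2 by rewrite starX sb.
split; first by rewrite star_abelianM.
move=> e e0; pose k := 1 + rnorm (b ^+ 2).
have k0 : 0 < k by rewrite ltr_pwDl ?rnorm_ge0.
have d0 : 0 < e / k by rewrite divr_gt0.
have Me : M (rcst e - (e / k)%:C *: b ^+ 2).
  apply: preordering_cpos; apply: cpos_rcst_sub; first by rewrite starZr sbb.
  by rewrite rnormZr ?(ltW d0) // mulrAC ler_pdivrMr // ler_pM2l // /k lerDr ler01.
have [x1 x2] := hx _ d0.
have main z : M (rcst (e / k) + z) -> M (rcst e + b ^+ 2 * z).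
  move=> Mz; rewrite -(subrK ((e / k)%:C *: b ^+ 2) (rcst e)) -addrA.
  apply: MD; first exact: Me.
  by rewrite -rcst_mulr -mulrDr; apply: MM; [exact: Msq|].
by rewrite -mulrN; split; exact: main.
Qed.

(** Every [a] is the difference of the squares of [(a + 1) / 2] and
    [(a - 1) / 2]. *)
Lemma infinitesimalMl a x : star a = a -> infinitesimal x -> infinitesimal (a * x).
Proof.
move=> sa Ix.
have qs : star (rcst (2^-1) : A) = rcst (2^-1) by exact: star_rcst.
have s1 : star (rcst (2^-1) * (a + 1)) = rcst (2^-1) * (a + 1).
  by rewrite star_abelianM // starD sa star1.
have s2 : star (rcst (2^-1) * (a - 1)) = rcst (2^-1) * (a - 1).
  by rewrite star_abelianM // starB sa star1.
have -> : a * x = (rcst (2^-1) * (a + 1)) ^+ 2 * x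
    - (rcst (2^-1) * (a - 1)) ^+ 2 * x.
  have e : forall h a x : abelian_copy hA, h + h = 1 ->
      a * x = (h * (a + 1)) ^+ 2 * x - (h * (a - 1)) ^+ 2 * x.
    move=> h b z h2.
    transitivity ((h + h) * (h + h) * (b * z)); first by rewrite h2 !mul1r.
    by ring.
  apply: e; have e2 : (2^-1 : R) + 2^-1 = 1 by lra.
  by have := @rcstD _ A (2^-1) (2^-1); rewrite e2 rcst1 => <-.
by apply: infinitesimalD; [|apply: infinitesimalN]; exact: infinitesimal_sqrM.
Qed.

Lemma infinitesimal_rcst r : infinitesimal (rcst r) -> r = 0.
Proof.
move=> [_ h]; apply/eqP; rewrite -normr_eq0 eq_le normr_ge0 andbT leNgt.
apply/negP => r0; have r2 : 0 < `|r| / 2 by rewrite divr_gt0.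
have [] := h _ r2; rewrite -rcstD -rcstN -rcstD.
move=> /preordering_rcst_ge0 h1 /preordering_rcst_ge0 h2.
by move: r0 h1 h2; have [rp|rn] := leP 0 r; [rewrite ger0_norm|rewrite ltr0_norm]; lra.
Qed.

Definition ord_value a : R := sup [set r | M (a - rcst r)].

Lemma ord_value_spec a : star a = a -> infinitesimal (a - rcst (ord_value a)).
Proof.
move=> sa; set S := [set r | M (a - rcst r)]; set v := ord_value a.
have S0 : S (- rnorm a).
  rewrite /S /= rcstN opprK -(opprK a) addrC rnormN; apply: preordering_cpos.
  by apply: cpos_rcst_sub; rewrite ?starN ?sa ?rnormN.
have Sub r : S r -> r <= rnorm a.
  move=> Sr; rewrite -subr_ge0; apply: preordering_rcst_ge0.
  rewrite rcstD rcstN -(subrK a (rcst (rnorm a))) -addrA; apply: MD => //.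
  by apply: preordering_cpos; exact: cpos_rcst_sub.
have hS : has_sup S by split; [exists (- rnorm a)|exists (rnorm a) => r /Sub].
split; first by rewrite starB star_rcst sa.
move=> e e0; split.
  have [r Sr vr] := sup_adherent e0 hS.
  have vr' : 0 <= e + (r - v) by have : v - e < r by []; lra.
  rewrite (_ : _ + _ = (a - rcst r) + rcst (e + (r - v))).
    by apply: MD => //; apply: preordering_rcst.
  rewrite rcstD (rcstD r) rcstN [RHS]addrCA; congr (_ + _).
  by rewrite addrA subrK.
have [|h|] := @preordering_total (a - rcst (v + e)).
- by rewrite starB star_rcst sa.
- have : v + e <= v by apply: ub_le_sup => //; exact: hS.2.
  by rewrite gerDl leNgt e0.
- by rewrite rcstD !opprB (addrC (rcst v)) addrA.
Qed.

Lemma ord_value_unique a r : star a = a -> infinitesimal (a - rcst r) ->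
  ord_value a = r.
Proof.
move=> sa Ir; apply/eqP; rewrite -subr_eq0; apply/eqP/infinitesimal_rcst.
have := infinitesimalD Ir (infinitesimalN (ord_value_spec sa)).
by rewrite opprB addrC addrA subrK rcstD rcstN.
Qed.

Lemma ord_valueD a b : star a = a -> star b = b ->
  ord_value (a + b) = ord_value a + ord_value b.
Proof.
move=> sa sb; apply: ord_value_unique; first by rewrite starD sa sb.
by rewrite rcstD opprD addrACA; apply: infinitesimalD; exact: ord_value_spec.
Qed.

Lemma ord_valueM a b : star a = a -> star b = b ->
  ord_value (a * b) = ord_value a * ord_value b.
Proof.
move=> sa sb; apply: ord_value_unique; first exact: star_abelianM.
have -> : a * b - rcst (ord_value a * ord_value b) =
    a * (b - rcst (ord_value b)) + rcst (ord_value b) * (a - rcst (ord_value a)).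
  rewrite !mulrBr hA (hA (rcst _) a) rcst_mull rcst_scale addrA.
  by rewrite (mulrC (ord_value b)) (hA b) addrNK.
apply: infinitesimalD; apply: infinitesimalMl; rewrite ?star_rcst //;
  exact: ord_value_spec.
Qed.

Lemma infinitesimal0 : infinitesimal 0.
Proof.
split; first exact: star0.
by move=> e e0; rewrite subr0 addr0; split; apply: preordering_rcst; exact: ltW.
Qed.

Lemma ord_value_rcst r : ord_value (rcst r) = r.
Proof.
apply: ord_value_unique; first exact: star_rcst.
by rewrite subrr; exact: infinitesimal0.
Qed.

Lemma ord_value_ge0 a : M a -> 0 <= ord_value a.
Proof.
move=> Ma; rewrite leNgt; apply/negP => v0.
have [_ /(_ (- ord_value a / 2))[|_]] := ord_value_spec (Msa Ma).
  by rewrite divr_gt0 // oppr_gt0.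
move=> h; have := MD Ma h.
rewrite opprB addrC addrA addrNK -rcstD => /preordering_rcst_ge0; lra.
Qed.

End MaximalPreordering.

Definition is_character (y : A -> R[i]) : Prop :=
  [/\ linear_functional y, y 1 = 1, forall a b, y (a * b) = y a * y b &
      forall a, y (star a) = (y a)^*].

Lemma character_of_preordering T : preordering T ->
  exists2 y : A -> R[i], is_character y & forall a, T a -> 0 <= y a.
Proof.
move=> /exists_maximal_preordering[M [Mp TM Mmax]].
pose v := @ord_value M.
pose y a : R[i] := Complex (v (cstarRe a)) (v (cstarIm a)).
have ReD a b : cstarRe (a + b) = cstarRe a + cstarRe b.
  by rewrite /cstarRe starD addrACA scalerDr.
have ImD a b : cstarIm (a + b) = cstarIm a + cstarIm b.
  by rewrite /cstarIm starD opprD addrACA !scalerDr.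
have Re_sa a : star a = a -> cstarRe a = a by move=> sa; rewrite /cstarRe sa halfDD.
have Im_sa a : star a = a -> cstarIm a = 0.
  by move=> sa; rewrite /cstarIm sa subrr !scaler0.
have vD a b : star a = a -> star b = b -> v (a + b) = v a + v b.
  exact: (ord_valueD Mp Mmax).
have v0 : v 0 = 0 by rewrite -rcst0 /v (ord_value_rcst Mp Mmax).
have vN a : star a = a -> v (- a) = - v a.
  move=> sa; apply/eqP; rewrite -addr_eq0 -vD ?starN ?sa //.
  by rewrite addNr v0.
have vZ r a : star a = a -> v (r%:C *: a) = r * v a.
  move=> sa; rewrite -rcst_mull /v (ord_valueM Mp Mmax) ?star_rcst //.
  by rewrite (ord_value_rcst Mp Mmax).
have ysa a : star a = a -> y a = (v a)%:C.
  by move=> sa; rewrite /y Re_sa // Im_sa // v0.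
have yD a b : y (a + b) = y a + y b.
  by rewrite /y ReD ImD !vD ?cstarRe_sa ?cstarIm_sa.
have yr r a : y (r%:C *: a) = r%:C * y a.
  have -> : y (r%:C *: a) = Complex (v (r%:C *: cstarRe a)) (v (r%:C *: cstarIm a)).
    rewrite /y; congr (Complex (v _) (v _)).
      by rewrite /cstarRe starZr -scalerDr !scalerA mulrC.
    rewrite /cstarIm starZr -scalerBr !scalerA; congr (_ *: _); ring.
  rewrite (vZ r (cstarRe a)) ?cstarRe_sa // (vZ r (cstarIm a)) ?cstarIm_sa //.
  by rewrite /y; simpc.
have yi a : y ('i%C *: a) = 'i%C * y a.
  have eRe : cstarRe ('i%C *: a) = - cstarIm a.
    by rewrite /cstarRe /cstarIm starZ conj_i scaleNr -scalerBr -!scalerN opprB.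
  have eIm : cstarIm ('i%C *: a) = cstarRe a.
    rewrite /cstarRe /cstarIm starZ conj_i scaleNr -opprD -scalerDr scalerN.
    by rewrite !scalerA -expr2 sqr_i scaleN1r opprK addrC.
  by rewrite /y eRe eIm (vN (cstarIm a)) ?cstarIm_sa //; simpc.
have yl : linear_functional y.
  move=> k a b; rewrite yD; congr (_ + _).
  by rewrite [k in LHS]complexE scalerDl yD -scalerA yi !yr mulrA -mulrDl -complexE.
exists y; last first.
  move=> a /TM Ma; have [Msa _ _ _ _] := Mp; rewrite ysa ?Msa // ler0c.
  exact: (ord_value_ge0 Mp Mmax).
split=> //.
- by rewrite ysa ?star1 // -rcst1 /v (ord_value_rcst Mp Mmax).
- have ysaM a b : star a = a -> star b = b -> y (a * b) = y a * y b.
    move=> sa sb; rewrite !ysa ?star_abelianM // /v (ord_valueM Mp Mmax) //.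
    by rewrite rmorphM.
  move=> a b.
  move: (cstarReIm a) (cstarRe_sa a) (cstarIm_sa a).
  move: (cstarRe a) (cstarIm a) => a1 a2 -> sa1 sa2.
  move: (cstarReIm b) (cstarRe_sa b) (cstarIm_sa b).
  move: (cstarRe b) (cstarIm b) => b1 b2 -> sb1 sb2.
  rewrite !(mulrDl, mulrDr) !scalerMl !scalerMr !yD !yi !ysaM //.
  by ring.
- move=> a; move: (cstarReIm a) (cstarRe_sa a) (cstarIm_sa a).
  move: (cstarRe a) (cstarIm a) => a1 a2 -> sa1 sa2.
  rewrite starD starZ sa1 sa2 conj_i scaleNr (functionalB yl) yD !yi.
  by rewrite !ysa //; simpc.
Qed.

Lemma character_state (y : A -> R[i]) : is_character y -> is_state y.
Proof.
move=> [yl y1 yM ys]; apply: positive_functional_state => //.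
move=> _ /cpos_starME[b ->]; rewrite yM ys mulrC; exact: mul_conjC_ge0.
Qed.

Section Extension.
Context {D J : set A}.
Hypotheses (hD : cstar_subalgebra D) (hJ : closed_ideal J)
  (hDJ : D `&` J = [set 0]).

Lemma idealMl a x : J x -> J (a * x).
Proof. by have [_ _ _ h] := hJ; move=> /(h a)[]. Qed.
Lemma idealMr a x : J x -> J (x * a).
Proof. by have [_ _ _ h] := hJ; move=> /(h a)[]. Qed.
Lemma idealD x y : J x -> J y -> J (x + y).
Proof. by have [_ _ h _] := hJ; exact: h. Qed.
Lemma idealZ k x : J x -> J (k *: x).
Proof. by move=> Jx; rewrite -(mul1r x) -scalerMl; exact: idealMl. Qed.
Lemma idealN x : J x -> J (- x).
Proof. by move=> Jx; rewrite -scaleN1r; exact: idealZ. Qed.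

(** An element [1 + q] with [q] positive is invertible; its inverse is avoided
    by summing the geometric series inside the closed ideal. *)
Lemma ideal_divides q x : cpos q -> J (x * (1 + q)) -> J x.
Proof.
move=> qp Jxm; pose t := rnorm q; pose s := 1 + t.
have t0 : 0 <= t by exact: rnorm_ge0.
have s0 : 0 < s by rewrite ltr_pwDl.
pose z := (s^-1)%:C *: (rcst t - q).
have zE : z = 1 - (s^-1)%:C *: (1 + q).
  have e1 : (s^-1)%:C *: rcst s = 1 :> A by rewrite rcst_scale mulVf ?gt_eqF // rcst1.
  rewrite -{1}e1 -scalerBr /s rcstD rcst1 opprD addrA.
  by rewrite (addrC (1 : A)) addrK.
have z1 : rnorm z <= t / s.
  rewrite rnormZr ?invr_ge0 ?(ltW s0) // mulrC ler_pM2r ?invr_gt0 //.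
  exact: rnorm_rcst_sub.
have Ju n : J (x - x * z ^+ n).
  elim: n => [|n IH]; first by rewrite expr0 mulr1 subrr; have [] := hJ.
  have -> : x - x * z ^+ n.+1 = (x - x * z ^+ n) * z + (s^-1)%:C *: (x * (1 + q)).
    rewrite mulrBl -mulrA -exprSr {2}zE mulrBr mulr1 scalerMr.
    by rewrite [RHS]addrAC addrNK.
  by apply: idealD; [exact: idealMr|exact: idealZ].
have [cJ _ _ _] := hJ; apply: tends_closed cJ Ju _.
apply: (@tends_squeeze _ _ _ _ (fun n => rnorm x * (t / s) ^+ n)).
  move=> n; rewrite addrAC subrr sub0r rnormN.
  apply: le_trans (rnormM _ _) (ler_wpM2l (rnorm_ge0 _) _).
  elim: n => [|n IH]; first by rewrite !expr0 rnorm1_le1.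
  rewrite !exprS; apply: le_trans (rnormM _ _) _.
  by apply: ler_pM; rewrite ?rnorm_ge0.
rewrite -[X in _ --> X](mulr0 (rnorm x)); apply: cvgMr; apply: cvg_expr.
by rewrite ger0_norm ?divr_ge0 ?(ltW s0) // ltr_pdivrMr // mul1r ltrDr ltr01.
Qed.

(** The preordering generated by the squares, [u = d - l] and the self-adjoint
    part of [J] is proper: from [- 1 = p + u q + j], multiplication by the square
    of the positive part [g] of [u] gives [g ^+ 2 (1 + positive)] in [J], so
    [g ^+ 2] is in [D] and in [J], hence zero, and then [d <= l]. *)
Lemma exists_character_ge d (l : R) : D d -> cpos d -> 0 <= l -> l < rnorm d ->
  exists y : A -> R[i], [/\ is_character y, forall j, J j -> y j = 0 & l%:C <= y d].
Proof.
move=> Dd dp l0 ld; pose u := d - rcst l.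
have su : star u = u by rewrite starB star_rcst cpos_sa.
have Du : D u by apply: (subalgB hD) => //; apply: (subalgZ hD); exact: subalg1.
pose T : set A := [set x | exists p q j,
  [/\ cpos p, cpos q, J j, star j = j & x = p + u * q + j]].
have J0 : J 0 by have [] := hJ.
have Tpos p : cpos p -> T p.
  move=> pp; exists p, 0, 0; rewrite mulr0 !addr0.
  by split; rewrite ?star0 //; exact: cpos0.
have Tp : preordering T.
  split.
  - move=> _ [p [q [j [pp qp Jj sj ->]]]].
    by rewrite !starD (star_abelianM su (cpos_sa qp)) (cpos_sa pp) sj.
  - move=> _ _ [p [q [j [pp qp Jj sj ->]]]] [p' [q' [j' [pp' qp' Jj' sj' ->]]]].
    exists (p + p'), (q + q'), (j + j'); split; try exact: cposD.
    + exact: idealD.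
    + by rewrite starD sj sj'.
    + by rewrite mulrDr addrACA; congr (_ + _); exact: addrACA.
  - move=> _ _ [p [q [j [pp qp Jj sj ->]]]] [p' [q' [j' [pp' qp' Jj' sj' ->]]]].
    have Mp a b : cpos a -> cpos b -> cpos (a * b).
      by move=> ap bp; exact: cposM ap bp (hA a b).
    exists (p * p' + u ^+ 2 * (q * q')), (p * q' + q * p'),
      (j * (p' + u * q' + j') + j' * (p + u * q)); split.
    + by apply/cposD/Mp; [exact: Mp|exact: cpos_sqr|exact: Mp].
    + by apply: cposD; exact: Mp.
    + by apply: idealD; exact: idealMr.
    + have sx : star (p + u * q) = p + u * q.
        by rewrite starD (star_abelianM su (cpos_sa qp)) (cpos_sa pp).
      have sx' : star (p' + u * q') = p' + u * q'.
        by rewrite starD (star_abelianM su (cpos_sa qp')) (cpos_sa pp').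
      by rewrite starD !star_abelianM // starD sx' sj'.
    + have e : forall u p q j p' q' j' : abelian_copy hA,
          (p + u * q + j) * (p' + u * q' + j') =
          p * p' + u ^+ 2 * (q * q') + u * (p * q' + q * p')
            + (j * (p' + u * q' + j') + j' * (p + u * q)) by move=> *; ring.
      exact: e.
  - by move=> h sh; apply: Tpos; exact: cpos_sqr.
  - move=> [p [q [j [pp qp Jj sj e1]]]].
    have snu : star (- u) = - u by rewrite starN su.
    have [w [g [wp sg w2 wE [gu ug wg gw wgD]]]] := negative_part snu.
    have [Dw Dg] := wgD _ hD (subalgN hD Du).
    have guE : g * u = g ^+ 2 by apply: oppr_inj; rewrite -gu mulrN.
    have m : J (g ^+ 2 * (1 + (p + w * q))).
      have -> : g ^+ 2 * (1 + (p + w * q)) = - (g ^+ 2 * j).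
        have e : forall g u w p q j : abelian_copy hA, g * u = g ^+ 2 ->
            w * g = g ^+ 2 -> - 1 = p + u * q + j ->
            g ^+ 2 * (1 + (p + w * q)) = - (g ^+ 2 * j).
          move=> g' u' w' p' q' j' h1 h2 h3.
          have -> : j' = - 1 - p' - u' * q' by rewrite h3; ring.
          have -> : g' ^+ 2 * (1 + (p' + w' * q')) =
             g' ^+ 2 * (1 + p') + g' * (w' * g') * q' by ring.
          have -> : - (g' ^+ 2 * (-1 - p' - u' * q')) =
             g' ^+ 2 * (1 + p') + g' * (g' * u') * q' by ring.
          by rewrite h1 h2.
        exact: (e g u w p q j).
      by apply: idealN; exact: idealMl.
    have Jg : J (g ^+ 2).
      by apply: ideal_divides m; apply: cposD => //; exact: cposM.
    have g2 : g ^+ 2 = 0.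
      have : (D `&` J) (g ^+ 2) by split=> //; exact: (subalgX hD).
      by rewrite hDJ.
    have g0 : g = 0 by apply: cube_eq0; rewrite // g2 mul0r.
    move: ld; rewrite ltNge => /negP; apply; apply: rnorm_le_of_cpos => //.
    have -> : rcst l - d = w by rewrite wE g0 !addr0 opprB.
    exact: wp.
have [y yc yT] := character_of_preordering Tp.
have [yl y1 yM ys] := yc.
exists y; split=> // [j Jj|].
  have Jjj : J (star j * j) by exact: idealMl.
  have sjj : star (star j * j) = star j * j by rewrite starM starK.
  have TJ k : J k -> star k = k -> T k.
    move=> Jk sk; exists 0, 0, k; rewrite mulr0 !add0r; split=> //; exact: cpos0.
  have h1 := yT _ (TJ _ Jjj sjj).
  have : 0 <= y (- (star j * j)).
    by apply/yT/TJ; [exact: idealN|rewrite starN sjj].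
  rewrite (functionalN yl) oppr_ge0 => h2.
  have : y (star j * j) = 0 by apply/eqP; rewrite eq_le h1 h2.
  by rewrite yM ys => /eqP; rewrite mulf_eq0 conjC_eq0 orbb => /eqP.
have : 0 <= y u.
  by apply: yT; exists 0, 1, 0; rewrite mulr1 addr0 add0r; split; rewrite ?star0 //;
    [exact: cpos0|exact: cpos1].
by rewrite (functionalB yl) state_rcst ?subr_ge0 //; exact: character_state.
Qed.

Lemma exists_character_norm d (l : R) : D d -> 0 <= l -> l < rnorm d ->
  exists y : A -> R[i], [/\ is_character y, forall j, J j -> y j = 0 & l <= cmod (y d)].
Proof.
move=> Dd l0 ld.
have [||||y [yc yJ yd]] := @exists_character_ge (star d * d) (l ^+ 2).
- by apply: (subalgM hD) => //; exact: (subalg_star hD).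
- exact: cpos_starM.
- exact: exprn_ge0.
- by rewrite rnorm_starM ltrXn2r.
exists y; split=> //; have [yl y1 yM ys] := yc.
move: yd; rewrite yM ys cmod_sqr lecR ler_pXn2r ?nnegrE ?cmod_ge0 //.
Qed.

End Extension.
End Characters.

(** * The C*-algebra of bounded complex functions *)

Section BoundedFunctions.
Context {R : realType} {Y : Type}.

Definition is_bounded (f : Y -> R[i]^o) : Prop :=
  exists M : R, forall y, cmod (f y : R[i]) <= M.

Definition is_bounded_pred : {pred (Y -> R[i]^o)} := fun f => `[< is_bounded f >].

Record linf := Linf { linf_fun : Y -> R[i]^o; _ : linf_fun \in is_bounded_pred }.

HB.instance Definition _ := [isSub of linf for linf_fun].
HB.instance Definition _ := [Choice of linf by <:].

Lemma is_bounded_submod : submod_closed is_bounded_pred.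
Proof.
split; first by apply/asboolP; exists 0 => y; rewrite cmod0.
move=> k f g /asboolP[M hM] /asboolP[N hN]; apply/asboolP.
exists (cmod k * M + N) => y.
apply: le_trans (cmodD _ _) (lerD _ (hN y)).
by rewrite cmodM ler_wpM2l ?cmod_ge0.
Qed.

HB.instance Definition _ := GRing.isSubmodClosed.Build _ _ is_bounded_pred
  is_bounded_submod.
HB.instance Definition _ := [SubChoice_isSubLmodule of linf by <:].

Definition linf_at (f : linf) (y : Y) : R[i] := linf_fun f y.

Lemma linf_eqP (f g : linf) : (forall y, linf_at f y = linf_at g y) -> f = g.
Proof. by move=> h; apply/val_inj/funext => y; exact: h. Qed.

Lemma linf_bounded (f : linf) : is_bounded (linf_at f).
Proof. by case: f => f fb; exact/asboolP. Qed.

Definition to_linf (f : Y -> R[i]) : linf :=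
  match pselect (is_bounded f) with
  | left h => Linf (introT (asboolP _) h)
  | right _ => 0
  end.

Lemma to_linfE (f : Y -> R[i]) : is_bounded f -> linf_at (to_linf f) = f.
Proof. by rewrite /to_linf; case: pselect. Qed.

Lemma linf_at0 y : linf_at 0 y = 0. Proof. by []. Qed.
Lemma linf_atD f g y : linf_at (f + g) y = linf_at f y + linf_at g y.
Proof. by []. Qed.
Lemma linf_atB f g y : linf_at (f - g) y = linf_at f y - linf_at g y.
Proof. by []. Qed.
Lemma linf_atZ k f y : linf_at (k *: f) y = k * linf_at f y.
Proof. by []. Qed.

Definition linf_sup (f : linf) : R := sup [set cmod (linf_at f y) | y in setT].

Lemma linf_sup_ge f y : cmod (linf_at f y) <= linf_sup f.
Proof.
apply: ub_le_sup; last by exists y.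
by have [M hM] := linf_bounded f; exists M => _ [z _ <-].
Qed.

Lemma linf_sup_le f c : 0 <= c -> (forall y, cmod (linf_at f y) <= c) ->
  linf_sup f <= c.
Proof.
move=> c0 h; rewrite /linf_sup.
have [[y _]|Y0] := pselect ([set: Y] !=set0).
  by apply: ge_sup; [exists (cmod (linf_at f y)), y|move=> _ [z _ <-]].
rewrite (_ : [set _ | _ in _] = set0) ?sup0 //.
by apply/seteqP; split=> // t [z _ _]; case: Y0; exists z.
Qed.

Lemma linf_sup_ge0 f : 0 <= linf_sup f.
Proof.
have [[y _]|Y0] := pselect ([set: Y] !=set0).
  exact: le_trans (cmod_ge0 _) (linf_sup_ge f y).
rewrite /linf_sup (_ : [set _ | _ in _] = set0) ?sup0 //.
by apply/seteqP; split=> // t [z _ _]; case: Y0; exists z.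
Qed.

Definition linf_norm (f : linf) : R[i] := (linf_sup f)%:C.

Lemma linf_normD f g : linf_norm (f + g) <= linf_norm f + linf_norm g.
Proof.
rewrite /linf_norm -rmorphD lecR; apply: linf_sup_le => [|y].
  by rewrite addr_ge0 ?linf_sup_ge0.
by rewrite linf_atD; apply: le_trans (cmodD _ _) (lerD _ _); exact: linf_sup_ge.
Qed.

Lemma linf_normZ (k : R[i]) f : linf_norm (k *: f) = `|k| * linf_norm f.
Proof.
rewrite /linf_norm cmodE -rmorphM; congr (_%:C).
apply/eqP; rewrite eq_le; apply/andP; split.
  apply: linf_sup_le => [|y]; first by rewrite mulr_ge0 ?cmod_ge0 ?linf_sup_ge0.
  by rewrite linf_atZ cmodM ler_wpM2l ?cmod_ge0 // linf_sup_ge.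
have [k0|k0] := eqVneq (cmod k) 0; first by rewrite k0 mul0r linf_sup_ge0.
have kp : 0 < cmod k by rewrite lt_def k0 cmod_ge0.
rewrite mulrC -ler_pdivlMr //; apply: linf_sup_le => [|y].
  by rewrite divr_ge0 ?linf_sup_ge0 ?cmod_ge0.
by rewrite ler_pdivlMr // mulrC -cmodM -linf_atZ linf_sup_ge.
Qed.

Lemma linf_norm_eq0 f : linf_norm f = 0 -> f = 0.
Proof.
move=> h; have f0 : linf_sup f = 0 by apply: complexI; rewrite rmorph0.
apply: linf_eqP => y; apply: cmod_eq0.
by apply/eqP; rewrite eq_le cmod_ge0 andbT -f0 linf_sup_ge.
Qed.

HB.instance Definition _ := Lmodule_isNormed.Build R[i] linf
  linf_normD linf_normZ linf_norm_eq0.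

Lemma rnorm_linfE (f : linf) : rnorm f = linf_sup f. Proof. by []. Qed.

Lemma linf_cauchy_cvg (F : set_system linf) :
  ProperFilter F -> cauchy F -> cvg F.
Proof.
move=> FF /cauchyP Fc.
have Fex (e : R) : 0 < e -> exists f, F [set g | rnorm (f - g) < e].
  move=> e0; have [|f Ff] := Fc (e%:C); first by rewrite ltcR.
  exists f; apply: filterS Ff => g.
  by rewrite -ball_normE /= rnormE ltcR.
(* A real coordinate [c] of the values at [y] converges along [F]. *)
have coord (c : R[i] -> R) : (forall k l, c (k - l) = c k - c l) ->
    (forall k, `|c k| <= cmod k) -> forall y,
    exists l, forall f e, F [set g | rnorm (f - g) < e] ->
      `|c (linf_at f y) - l| <= e.
  move=> cB cle y.
  have cdist f g e : rnorm (f - g) < e -> `|c (linf_at f y) - c (linf_at g y)| < e.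
    move=> h; rewrite -cB -linf_atB; apply: le_lt_trans (cle _) _.
    exact: le_lt_trans (linf_sup_ge _ y) h.
  have /cauchy_cvg Gc : cauchy (c (linf_at f y) @[f --> F]).
    apply/cauchy_exP => e e0; have [f Ff] := Fex e e0.
    exists (c (linf_at f y)).
    have : F (fun g => ball (c (linf_at f y)) e (c (linf_at g y))).
      apply: filterS Ff => g /= h.
      by rewrite -ball_normE /=; exact: cdist.
    by [].
  exists (lim (c (linf_at f y) @[f --> F])) => f e Ff.
  have nc : `|c (linf_at f y) - c (linf_at g y)| @[g --> F] -->
      `|c (linf_at f y) - lim (c (linf_at g y) @[g --> F])|.
    by apply: cvg_norm; apply: cvgB Gc; exact: cvg_cst.
  rewrite -(cvg_lim _ nc) //; apply: limr_le; first exact: cvgP nc.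
  by apply: filterS Ff => g /= /cdist/ltW.
have ReB (k l : R[i]) : complex.Re (k - l) = complex.Re k - complex.Re l.
  by case: k l => ? ? [].
have ImB (k l : R[i]) : complex.Im (k - l) = complex.Im k - complex.Im l.
  by case: k l => ? ? [].
have Re_le (k : R[i]) : `|complex.Re k| <= cmod k.
  by rewrite -lecR -cmodE; exact: normc_ge_Re.
have Im_le (k : R[i]) : `|complex.Im k| <= cmod k.
  rewrite -(@ler_pXn2r _ 2) ?nnegrE ?cmod_ge0 // real_normK ?num_real //.
  by rewrite -lecR [X in _ <= X]rmorphXn /= -cmodE -add_Re2_Im2 lecR lerDr sqr_ge0.
have [a aP] := choice (coord _ ReB Re_le).
have [b bP] := choice (coord _ ImB Im_le).
pose h y : R[i] := Complex (a y) (b y).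
have near f e : F [set g | rnorm (f - g) < e] ->
    forall y, cmod (linf_at f y - h y) <= e + e.
  move=> Ff y; rewrite (complexE (_ - _)); apply: le_trans (cmodD _ _) _.
  rewrite cmodM !cmod_real (_ : cmod 'i%C = 1) ?mul1r.
    by rewrite ReB ImB; apply: lerD; [exact: aP|exact: bP].
  by rewrite /cmod normc_def /= expr0n expr1n /= add0r sqrtr1.
have hb : is_bounded h.
  have [f Ff] := Fex 1 ltr01; exists (linf_sup f + (1 + 1)) => y.
  rewrite -(subKr (linf_at f y) (h y)); apply: le_trans (cmodD _ _) _.
  by rewrite cmodN lerD ?linf_sup_ge ?near.
apply/cvg_ex; exists (to_linf h); apply/cvgrPdist_le => e e0.
have er : e = (complex.Re e)%:C by apply: ge0_ReE; exact: ltW.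
have e1 : 0 < complex.Re e / 3 by rewrite divr_gt0 // -ltcR -er.
have [f Ff] := Fex _ e1.
apply: filterS (Ff) => g /= fg; rewrite rnormE er lecR rnorm_linfE.
apply: linf_sup_le => [|y]; first by rewrite -lecR -er ltW.
rewrite linf_atB to_linfE //.
have := linf_sup_ge (f - g) y; rewrite linf_atB => /le_lt_trans/(_ fg) h1.
have h2 := near f _ Ff y.
rewrite (_ : h y - linf_at g y = - (linf_at f y - h y) + (linf_at f y - linf_at g y)).
  by apply: le_trans (cmodD _ _) _; rewrite cmodN; lra.
by rewrite opprB addrA subrK.
Qed.

HB.instance Definition _ := Uniform_isComplete.Build linf linf_cauchy_cvg.

Definition linf_mul (f g : linf) : linf :=
  to_linf (fun y => linf_at f y * linf_at g y).
Definition linf_one : linf := to_linf (fun=> 1).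
Definition linf_star (f : linf) : linf := to_linf (fun y => (linf_at f y)^*).

Lemma linf_at_mul f g y : linf_at (linf_mul f g) y = linf_at f y * linf_at g y.
Proof.
rewrite to_linfE //; exists (linf_sup f * linf_sup g) => z.
by rewrite cmodM ler_pM ?cmod_ge0 ?linf_sup_ge.
Qed.

Lemma linf_at_one y : linf_at linf_one y = 1.
Proof. by rewrite to_linfE //; exists 1 => z; rewrite cmod1. Qed.

Lemma linf_at_star f y : linf_at (linf_star f) y = (linf_at f y)^*.
Proof. by rewrite to_linfE //; exists (linf_sup f) => z; rewrite cmodJ linf_sup_ge. Qed.

Let linfE := (linf_at_mul, linf_at_one, linf_at_star, linf_atD, linf_atZ).

Lemma linf_mulA : associative linf_mul.
Proof. by move=> f g h; apply: linf_eqP => y; rewrite !linfE mulrA. Qed.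
Lemma linf_mul1 : left_id linf_one linf_mul.
Proof. by move=> f; apply: linf_eqP => y; rewrite !linfE mul1r. Qed.
Lemma linf_mulr1 : right_id linf_one linf_mul.
Proof. by move=> f; apply: linf_eqP => y; rewrite !linfE mulr1. Qed.
Lemma linf_mulDl : left_distributive linf_mul +%R.
Proof. by move=> f g h; apply: linf_eqP => y; rewrite !linfE mulrDl. Qed.
Lemma linf_mulDr : right_distributive linf_mul +%R.
Proof. by move=> f g h; apply: linf_eqP => y; rewrite !linfE mulrDr. Qed.
Lemma linf_mulZl (k : R[i]) f g : linf_mul (k *: f) g = k *: linf_mul f g.
Proof. by apply: linf_eqP => y; rewrite !linfE mulrA. Qed.
Lemma linf_mulZr (k : R[i]) f g : linf_mul f (k *: g) = k *: linf_mul f g.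
Proof. by apply: linf_eqP => y; rewrite !linfE mulrCA. Qed.
Lemma linf_starK f : linf_star (linf_star f) = f.
Proof. by apply: linf_eqP => y; rewrite !linfE conjCK. Qed.
Lemma linf_starD f g : linf_star (f + g) = linf_star f + linf_star g.
Proof. by apply: linf_eqP => y; rewrite !linfE rmorphD. Qed.
Lemma linf_starZ (k : R[i]) f : linf_star (k *: f) = k^* *: linf_star f.
Proof. by apply: linf_eqP => y; rewrite !linfE rmorphM. Qed.
Lemma linf_starM f g : linf_star (linf_mul f g) = linf_mul (linf_star g) (linf_star f).
Proof. by apply: linf_eqP => y; rewrite !linfE rmorphM mulrC. Qed.
Lemma linf_normM f g : `|linf_mul f g| <= `|f| * `|g|.
Proof.
rewrite !rnormE -rmorphM lecR !rnorm_linfE.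
apply: linf_sup_le => [|y]; first by rewrite mulr_ge0 ?linf_sup_ge0.
by rewrite linf_at_mul cmodM ler_pM ?cmod_ge0 ?linf_sup_ge.
Qed.
Lemma linf_norm_starM f : `|linf_mul (linf_star f) f| = `|f| ^+ 2.
Proof.
rewrite !rnormE -rmorphXn; congr (_%:C); rewrite !rnorm_linfE.
apply/eqP; rewrite eq_le; apply/andP; split.
  apply: linf_sup_le => [|y]; first by rewrite exprn_ge0 ?linf_sup_ge0.
  by rewrite linf_at_mul linf_at_star cmodM cmodJ -expr2 ler_pXn2r
    ?nnegrE ?cmod_ge0 ?linf_sup_ge0 ?linf_sup_ge.
rewrite -(@ler_sqrt _ _ (linf_sup _)) ?linf_sup_ge0 // sqrtr_sqr.
rewrite ger0_norm ?linf_sup_ge0 //.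
apply: linf_sup_le => [|y]; first exact: sqrtr_ge0.
rewrite -(ger0_norm (cmod_ge0 _)) -sqrtr_sqr ler_sqrt ?linf_sup_ge0 //.
have := linf_sup_ge (linf_mul (linf_star f) f) y.
by rewrite linf_at_mul linf_at_star cmodM cmodJ -expr2.
Qed.

HB.instance Definition _ := isCStarAlgebra.Build R linf
  linf_mulA linf_mul1 linf_mulr1 linf_mulDl linf_mulDr linf_mulZl linf_mulZr
  linf_starK linf_starD linf_starZ linf_starM linf_normM linf_norm_starM.

End BoundedFunctions.
Arguments linf R Y : clear implicits.

(** The same type as an object of the hierarchy, so that the ring operations
    derived for an arbitrary C*-algebra are found on it. *)
Definition linfA (R : realType) (Y : Type) : cstarAlgType R := linf R Y.

Section BoundedFunctionsTheory.
Context {R : realType} {Y : Type}.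
Local Notation C := (linfA R Y).
Implicit Types (f g : C) (y : Y).

Lemma linf_atM f g y : linf_at (f * g) y = linf_at f y * linf_at g y.
Proof. exact: linf_at_mul. Qed.
Lemma linf_at1 y : linf_at (1 : C) y = 1.
Proof. exact: linf_at_one. Qed.
Lemma linf_at_starE f y : linf_at (star f) y = (linf_at f y)^*.
Proof. exact: linf_at_star. Qed.
Lemma linf_rnorm_ge f y : cmod (linf_at f y) <= rnorm f.
Proof. exact: linf_sup_ge. Qed.
Lemma linf_rnorm_le f c : 0 <= c -> (forall y, cmod (linf_at f y) <= c) ->
  rnorm f <= c.
Proof. exact: linf_sup_le. Qed.
Lemma linf_at_linear y : linear_functional (fun f : C => linf_at f y).
Proof. by move=> k f g. Qed.

Lemma linf_at_state y : is_state (fun f : C => linf_at f y).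
Proof.
by split=> [||f]; [exact: linf_at_linear|exact: linf_at1|exact: linf_rnorm_ge].
Qed.

Lemma linf_at_sum (I : Type) (s : seq I) (P : pred I) (F : I -> C) y :
  linf_at (\sum_(i <- s | P i) F i) y = \sum_(i <- s | P i) linf_at (F i) y.
Proof. exact: (big_morph (fun f : C => linf_at f y)). Qed.

End BoundedFunctionsTheory.

(** * Positive matrices *)

Section ComplexMatrices.
Context {R : realType}.
Local Notation C := R[i].

Definition cadj m n (X : 'M[C]_(m, n)) : 'M[C]_(n, m) :=
  \matrix_(i, j) (X j i)^*.

Lemma cadjM m n p (X : 'M[C]_(m, n)) (Z : 'M[C]_(n, p)) :
  cadj (X *m Z) = cadj Z *m cadj X.
Proof.
apply/matrixP => i j; rewrite !mxE rmorph_sum; apply: eq_bigr => k _.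
by rewrite !mxE rmorphM mulrC.
Qed.

Section Psd.
Context {n : nat}.
Implicit Types (H G X : 'M[C]_n) (v : 'cV[C]_n).

Definition psd H : Prop := forall v, 0 <= (cadj v *m H *m v) 0 0.

Lemma psdD H G : psd H -> psd G -> psd (H + G).
Proof. by move=> hH hG v; rewrite mulmxDr mulmxDl mxE addr_ge0. Qed.

Lemma psd_conj H X : psd H -> psd (cadj X * H * X).
Proof. by move=> hH v; have := hH (X *m v); rewrite cadjM !mulmxA. Qed.


Lemma cadjX H k : cadj H = H -> cadj (H ^+ k) = H ^+ k.
Proof.
move=> hH; elim: k => [|k IH].
  apply/matrixP => i j; rewrite !expr0 !mxE eq_sym.
  by case: (i == j); rewrite /= ?conjC1 ?conjC0.
by rewrite [in LHS]exprS cadjM IH hH mulmxE -exprSr.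
Qed.

(** [H - H ^+ 2 = H (1 - H) H + (1 - H) H (1 - H)]. *)
Lemma psd_contraction_sqr H : cadj H = H -> psd H -> psd (1 - H) -> psd (H - H ^+ 2).
Proof.
move=> hH pH p1H.
have -> : H - H ^+ 2 = cadj H * (1 - H) * H + cadj (1 - H) * H * (1 - H).
  have -> : cadj (1 - H) = 1 - H.
    apply/matrixP => i j; rewrite !mxE rmorphB /=.
    have := congr1 (fun X : 'M[C]_n => X i j) hH; rewrite mxE => ->.
    by rewrite eq_sym; case: (i == j); rewrite /= ?conjC1 ?conjC0.
  rewrite hH !(mulrBl, mulrBr, mul1r, mulr1) expr2 opprB addrCA.
  rewrite [X in _ = _ + X]addrA subrK subrr.
  by rewrite addr0.
by apply: psdD; exact: psd_conj.
Qed.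

Lemma psd_contractionX H k : cadj H = H -> psd H -> psd (1 - H) -> psd (1 - H ^+ k).
Proof.
move=> hH pH p1H; elim: k => [|k IH].
  by rewrite expr0 subrr => v; rewrite mulmx0 mul0mx mxE.
rewrite -(subrK (H ^+ k) 1) -addrA; apply: psdD => //.
have [m [b ->]] : exists m (b : bool), k = (b + m.*2)%N.
  by exists k./2, (odd k); rewrite odd_double_half.
have e (G : 'M[C]_n) : cadj (H ^+ m) * G * H ^+ m = H ^+ m * G * H ^+ m.
  by rewrite cadjX.
case: b; rewrite ?add1n ?add0n -addnn.
  have -> : H ^+ (m + m).+1 - H ^+ (m + m).+2 = cadj (H ^+ m) * (H - H ^+ 2) * H ^+ m.
    rewrite e mulrBr mulrBl -exprSr -!exprD; congr (_ ^+ _ - _ ^+ _); lia.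
  exact/psd_conj/psd_contraction_sqr.
have -> : H ^+ (m + m) - H ^+ (m + m).+1 = cadj (H ^+ m) * (1 - H) * H ^+ m.
  rewrite e mulrBr mulrBl mulr1 -exprSr -!exprD; congr (_ - _ ^+ _); lia.
exact: psd_conj.
Qed.

Lemma psd_diag H j : psd H -> 0 <= H j j.
Proof.
move=> /(_ (delta_mx j 0)); rewrite -mulmxA -colE mxE (bigD1 j) //= big1.
  by rewrite !mxE !eqxx /= conjC1 mul1r addr0.
by move=> i ij; rewrite !mxE (negPf ij) /= conjC0 mul0r.
Qed.

(** The [j]-th diagonal entry of [H ^+ (2 k)] is the square norm of the [j]-th
    column of [H ^+ k]. *)
Lemma psd_contraction_entry H i j k : cadj H = H -> psd H -> psd (1 - H) ->
  cmod ((H ^+ k) i j) <= 1.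
Proof.
move=> hH pH p1H.
have := psd_diag j (psd_contractionX (k + k) hH pH p1H).
rewrite exprD !mxE eqxx subr_ge0 (bigD1 i) //=.
have -> : (H ^+ k) j i = ((H ^+ k) i j)^*.
  by rewrite -{1}(cadjX k hH) mxE.
rewrite cmod_sqr => h.
rewrite -(expr_le1 (n := 2)) ?cmod_ge0 // -lecR; apply: le_trans h.
rewrite lerDl sumr_ge0 // => l _.
have -> : (H ^+ k) j l = ((H ^+ k) l j)^* by rewrite -{1}(cadjX k hH) mxE.
by rewrite mulrC mul_conjC_ge0.
Qed.

End Psd.
End ComplexMatrices.

Section MatrixStar.
Context {R : realType} {A : cstarAlgType R}.

Lemma mxstarE m n (X : 'M[A]_(m, n)) i j : mxstar X i j = star (X j i).
Proof. by rewrite !mxE. Qed.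

Lemma mxstarM m n p (X : 'M[A]_(m, n)) (Z : 'M[A]_(n, p)) :
  mxstar (X *m Z) = mxstar Z *m mxstar X.
Proof.
apply/matrixP => i j; rewrite mxstarE !mxE star_sum; apply: eq_bigr => k _.
by rewrite starM !mxstarE.
Qed.

Lemma cpos_sum (I : Type) (s : seq I) (P : pred I) (F : I -> A) :
  (forall i, P i -> cpos (F i)) -> cpos (\sum_(i <- s | P i) F i).
Proof. by move=> h; apply: big_ind => //; [exact: cpos0|exact: cposD]. Qed.

Lemma cpos_column n (v : 'cV[A]_n) : cpos ((mxstar v *m v) 0 0).
Proof.
by rewrite mxE; apply: cpos_sum => i _; rewrite mxstarE; exact: cpos_starM.
Qed.

Lemma mxpos_column n (X : 'M[A]_n) (v : 'cV[A]_n) :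
  mxpos X -> cpos ((mxstar v *m X *m v) 0 0).
Proof.
move=> [Y ->]; rewrite (_ : _ *m v = mxstar (Y *m v) *m (Y *m v)).
  exact: cpos_column.
by rewrite mxstarM !mulmxA.
Qed.

Lemma mxpos_sa n (X : 'M[A]_n) : mxpos X -> mxstar X = X.
Proof.
move=> [Y ->]; rewrite mxstarM; congr (_ *m _).
by apply/matrixP => i j; rewrite !mxstarE starK.
Qed.

Lemma mxpos11 (x : A) : cpos x -> mxpos (const_mx x : 'M[A]_1).
Proof.
move=> /cpos_starME[b ->]; exists (const_mx b).
by apply/matrixP => i j; rewrite !mxE big_ord1 !mxE.
Qed.

Definition scalar_col n (v : 'cV[R[i]]_n) : 'cV[A]_n := map_mx (fun k => k *: (1 : A)) v.

Lemma scalar_col_form n (X : 'M[A]_n) (v : 'cV[R[i]]_n) (f : A -> R[i]) :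
  linear_functional f ->
  f ((mxstar (scalar_col v) *m X *m scalar_col v) 0 0) =
  (cadj v *m map_mx f X *m v) 0 0.
Proof.
move=> lf.
have fsum (I : Type) (s : seq I) (F : I -> A) :
    f (\sum_(i <- s) F i) = \sum_(i <- s) f (F i).
  by apply: (big_morph f (functionalD lf) (functional0 lf)).
rewrite !mxE fsum; apply: eq_bigr => j _; rewrite !mxE scalerMr mulr1.
rewrite (functionalZ lf) mulrC fsum; congr (_ * _); apply: eq_bigr => i _.
by rewrite !mxE starZ star1 scalerMl mul1r (functionalZ lf).
Qed.

Lemma psd_of_state n (X : 'M[A]_n) f : is_state f -> mxpos X -> psd (map_mx f X).
Proof.
move=> fs Xp v; have [lf _ _] := fs.
by rewrite -scalar_col_form //; apply: state_cpos => //; exact: mxpos_column.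
Qed.

End MatrixStar.

Section PsdRoot.
Context {R : realType} {A : cstarAlgType R} {Y : Type} {D : set A}.
Context {chi : Y -> A -> R[i]}.
Hypotheses (hD : cstar_subalgebra D) (chiC : forall y, is_character (chi y)).
Hypothesis chi_norm : forall d c, D d -> 0 <= c ->
  (forall y, cmod (chi y d) <= c) -> rnorm d <= c.

Lemma map_character_mulmx y m n p (X : 'M[A]_(m, n)) (Z : 'M[A]_(n, p)) :
  map_mx (chi y) (X *m Z) = map_mx (chi y) X *m map_mx (chi y) Z.
Proof.
have [yl y1 yM ys] := chiC y.
apply/matrixP => i j; rewrite !mxE.
rewrite (big_morph (chi y) (functionalD yl) (functional0 yl)).
by apply: eq_bigr => k _; rewrite !mxE yM.
Qed.

Lemma map_characterX y n (X : 'M[A]_n) k :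
  map_mx (chi y) (X ^+ k) = map_mx (chi y) X ^+ k.
Proof.
have [yl y1 yM ys] := chiC y.
elim: k => [|k IH]; last by rewrite !exprS map_character_mulmx IH.
apply/matrixP => i j; rewrite !expr0 !mxE; case: (i == j) => //=.
by rewrite (functional0 yl).
Qed.

Lemma mx_inX n (X : 'M[A]_n) k : mx_in D X -> mx_in D (X ^+ k).
Proof.
move=> DX; elim: k => [|k IH] i j.
  by rewrite expr0 mxE; case: (i == j); [exact: subalg1|exact: subalg0].
by rewrite exprS mxE; apply: (subalg_sum hD) => l _; exact: (subalgM hD).
Qed.

(** Cauchy-Schwarz in the crude form needed to bound a quadratic form. *)
Lemma quadratic_form_le n (H : 'M[R[i]]_n) (v : 'cV[R[i]]_n) (c : R) :
  \sum_i \sum_j cmod (H i j) <= c ->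
  cmod ((cadj v *m H *m v) 0 0) <= c * \sum_i cmod (v i 0) ^+ 2.
Proof.
move=> Hc.
have cmod_sum (I : Type) (s : seq I) (F : I -> R[i]) :
    cmod (\sum_(i <- s) F i) <= \sum_(i <- s) cmod (F i).
  elim/big_rec2 : _ => [|i b a _ h]; first by rewrite cmod0.
  by apply: le_trans (cmodD _ _) _; rewrite lerD2l.
set N := \sum_i cmod (v i 0) ^+ 2.
have vN i : cmod (v i 0) ^+ 2 <= N.
  by rewrite /N (bigD1 i) //= lerDl sumr_ge0 // => j _; exact: exprn_ge0 (cmod_ge0 _).
have vvN i j : cmod (v i 0) * cmod (v j 0) <= N.
  have := vN i; have := vN j; have := sqr_ge0 (cmod (v i 0) - cmod (v j 0)).
  by rewrite sqrrB; lra.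
have N0 : 0 <= N by apply: sumr_ge0 => i _; rewrite exprn_ge0 ?cmod_ge0.
apply: le_trans (ler_wpM2r N0 Hc).
rewrite mxE; apply: le_trans (cmod_sum _ _ _) _.
rewrite exchange_big mulr_suml; apply: ler_sum => j _.
rewrite mxE cmodM; apply: le_trans (ler_wpM2r (cmod_ge0 _) (cmod_sum _ _ _)) _.
rewrite !mulr_suml; apply: ler_sum => i _.
rewrite mxE cmodM cmodJ mulrAC mulrC.
by rewrite ler_wpM2l ?cmod_ge0.
Qed.

(** Rescaled, [X] is [1 - T] with [T] a pointwise contraction; the characters
    norm [D], so the powers of [T] have bounded entries and the iteration
    [visser] applies, without leaving [D]. *)
Lemma psd_root n (X : 'M[A]_n) : mx_in D X -> mxstar X = X ->
  (forall y, psd (map_mx (chi y) X)) ->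
  exists2 W : 'M[A]_n, mx_in D W & X = mxstar W *m W.
Proof.
move=> DX sX pX.
pose s := 1 + \sum_i \sum_j rnorm (X i j).
have s0 : 0 < s.
  by rewrite ltr_pwDl // sumr_ge0 // => i _; rewrite sumr_ge0 // => j _; exact: rnorm_ge0.
pose T : 'M[A]_n := 1 - map_mx (fun x => (s^-1)%:C *: x) X.
have DT : mx_in D T.
  move=> i j; rewrite !mxE; apply: (subalgB hD); last exact: (subalgZ hD).
  by case: (i == j); [exact: subalg1|exact: subalg0].
have TE y : map_mx (chi y) T = 1 - (s^-1)%:C *: map_mx (chi y) X.
  have [yl y1 yM ys] := chiC y.
  apply/matrixP => i j; rewrite !mxE (functionalB yl) (functionalZ yl).
  by case: (i == j); rewrite /= ?y1 ?(functional0 yl).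
have sT : mxstar T = T.
  apply/matrixP => i j; rewrite mxstarE !mxE starB starZr -mxstarE sX eq_sym.
  by case: (i == j); rewrite /= ?star1 ?star0.
have cT y : cadj (map_mx (chi y) T) = map_mx (chi y) T.
  have [yl y1 yM ys] := chiC y.
  by apply/matrixP => i j; rewrite mxE !(mxE map_mx_key) -ys -mxstarE sT.
have pXs y : psd ((s^-1)%:C *: map_mx (chi y) X).
  move=> v; rewrite -scalemxAr -scalemxAl mxE mulr_ge0 //; last exact: pX.
  by rewrite ler0c invr_ge0 ltW.
have p1T y : psd (1 - map_mx (chi y) T) by rewrite TE subKr.
have pT y : psd (map_mx (chi y) T).
  move=> v; rewrite TE mulmxBr mulmxBl [X in 0 <= X]mxE [X in _ + X]mxE subr_ge0.
  rewrite -scalemxAr -scalemxAl [leLHS]mxE mulmx1 [leRHS]mxE.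
  under [leRHS]eq_bigr => i _ do rewrite mxE cmod_sqr.
  have q0 := pX y v; rewrite -(ger0_norm q0) cmodE.
  rewrite -rmorphM -rmorph_sum lecR mulrC ler_pdivrMr // mulrC.
  apply: quadratic_form_le; rewrite /s -[leLHS]add0r; apply: lerD => //.
  apply: ler_sum => i _; apply: ler_sum => j _; rewrite mxE.
  by have [_ _ h] := character_state (chiC y).
have hT k i j : rnorm ((T ^+ k) i j) <= 1.
  apply: chi_norm => // [|y]; first exact: (mx_inX k DT i j).
  have := psd_contraction_entry i j k (cT y) (pT y) (p1T y).
  by rewrite -map_characterX mxE.
have [W [W2 Wlim _]] := visser_sqrt hT.
have vs k : mxstar (visser T k) = visser T k /\ mx_in D (visser T k).
  elim: k => [|k [IH1 IH2]] /=.
    split=> [|i j]; last by rewrite mxE; exact: subalg0.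
    by apply/matrixP => i j; rewrite mxstarE !mxE star0.
  split.
    have sv2 : mxstar (visser T k ^+ 2) = visser T k ^+ 2.
      by rewrite expr2 mxstarM IH1.
    apply/matrixP => i j; rewrite mxstarE [LHS](congr1 star (mxE _ _ _ _)) starZr.
    rewrite [(T + _) j i]mxE starD -!mxstarE sT sv2.
    by rewrite [RHS]mxE [(T + _) i j]mxE.
  move=> i j; rewrite mxE [(T + _) i j]mxE; apply/(subalgZ hD)/(subalgD hD) => //.
  exact: (mx_inX 2 IH2 i j).
have DW : mx_in D W.
  by move=> i j; apply: (subalg_limit hD _ (Wlim i j)) => k; exact: (vs k).2.
have sW : mxstar W = W.
  apply/matrixP => i j; rewrite mxstarE.
  apply: tends_unique (tends_star (Wlim j i)) _.
  apply: (tends_ext _ (Wlim i j)) => k /=.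
  by rewrite -[in LHS](vs k).1 mxstarE.
have sV : mxstar (1 - W) = 1 - W.
  apply/matrixP => i j; rewrite mxstarE !mxE starB -mxstarE sW eq_sym.
  by case: (i == j); rewrite /= ?star1 ?star0.
have DV : mx_in D (1 - W).
  move=> i j; rewrite !mxE; apply: (subalgB hD) => //.
  by case: (i == j); [exact: subalg1|exact: subalg0].
have V2 i j : \sum_k (1 - W) i k * (1 - W) k j = (s^-1)%:C *: X i j.
  have := congr1 (fun Z : 'M[A]_n => Z i j) W2.
  by rewrite /T subKr expr2 mxE [RHS]mxE => <-.
move: (1 - W) sV DV V2 => V sV DV V2.
exists (map_mx (fun x => (Num.sqrt s)%:C *: x) V).
  by move=> i j; rewrite mxE; exact: (subalgZ hD).
apply/matrixP => i j; rewrite [RHS]mxE.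
rewrite (eq_bigr (fun k => s%:C *: (V i k * V k j))) => [|k _].
  by rewrite -scaler_sumr V2 scalerA -rmorphM divff ?gt_eqF // rmorph1 scale1r.
rewrite mxstarE [map_mx _ _ k i]mxE [map_mx _ _ k j]mxE starZr -mxstarE sV.
by rewrite scalerMl scalerMr scalerA -rmorphM /= -expr2 sqr_sqrtr // ltW.
Qed.

End PsdRoot.

(** * Complete positivity and abelian algebras *)

Section PointwiseStates.
Context {R : realType} {B : cstarAlgType R} {Y : Type}.

Lemma linf_at_character y : is_character (fun f : linfA R Y => linf_at f y).
Proof.
split.
- exact: linf_at_linear.
- exact: linf_at1.
- by move=> f g; exact: linf_atM.
- by move=> f; exact: linf_at_starE.
Qed.

(** A positive map into an abelian C*-algebra is completely positive, because
    it is a pointwise family of states. *)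
Lemma pointwise_states_mxpos (g : B -> linfA R Y) :
  (forall y, is_state (fun b => linf_at (g b) y)) ->
  forall n (X : 'M[B]_n), mxpos X -> mxpos (map_mx g X).
Proof.
move=> gs n X Xp.
have [||||W _ ->] := @psd_root R (linfA R Y) Y setT (fun y f => linf_at f y)
  subalgT linf_at_character _ n (map_mx g X).
- by move=> d c _; exact: linf_rnorm_le.
- by [].
- apply/matrixP => i j; rewrite mxstarE !mxE; apply: linf_eqP => y.
  by rewrite linf_at_starE -(state_star _ (gs y)) -mxstarE mxpos_sa.
- by move=> y; rewrite -map_mx_comp; exact: (psd_of_state (gs y) Xp).
by exists W.
Qed.

End PointwiseStates.

Section CharacterTransform.
Context {R : realType} {A : cstarAlgType R} {Y : Type} {chi : Y -> A -> R[i]}.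
Hypothesis chiC : forall y, is_character (chi y).

Definition char_transform (a : A) : linfA R Y := to_linf (fun y => chi y a).

Lemma char_transformE a y : linf_at (char_transform a) y = chi y a.
Proof.
rewrite to_linfE //; exists (rnorm a) => z.
by have [_ _ h] := character_state (chiC z).
Qed.

Lemma char_transform_hom : unital_star_hom_on setT char_transform.
Proof.
split; first split=> //.
- apply: linf_eqP => y; rewrite char_transformE linf_at1.
  by have [] := chiC y.
- move=> k a b _ _; apply: linf_eqP => y.
  by rewrite linf_atD linf_atZ !char_transformE; have [h _ _ _] := chiC y; exact: h.
- move=> a b _ _; apply: linf_eqP => y.
  by rewrite linf_atM !char_transformE; have [_ _ h _] := chiC y; exact: h.
- move=> a _; apply: linf_eqP => y.
  by rewrite linf_at_starE !char_transformE; have [_ _ _ h] := chiC y; exact: h.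
Qed.

Context {D : set A} {B : cstarAlgType R} {iota : A -> B}.
Hypotheses (hD : cstar_subalgebra D) (hi : unital_star_hom_on D iota).
Hypothesis chi_norm : forall d c, D d -> 0 <= c ->
  (forall y, cmod (chi y d) <= c) -> rnorm d <= c.

Lemma char_transform_inj d e : D d -> D e ->
  char_transform d = char_transform e -> d = e.
Proof.
move=> Dd De h; apply/eqP; rewrite -subr_eq0; apply/eqP/rnorm_eq0.
apply/eqP; rewrite eq_le rnorm_ge0 andbT; apply: chi_norm => // [|y].
  exact: (subalgB hD).
have [yl _ _ _] := chiC y.
by rewrite (functionalB yl) -!char_transformE h subrr cmod0.
Qed.

Lemma char_transform_opsys : operator_system (char_transform @` D).
Proof.
have [[_ t1 tL] tM ts] := char_transform_hom.
split.
- by exists 1; [exact: subalg1|].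
- move=> k _ _ [d Dd <-] [e De <-]; exists (k *: d + e); last exact: tL.
  by apply: (subalgD hD) => //; exact: (subalgZ hD).
- by move=> _ [d Dd <-]; exists (star d); [exact: (subalg_star hD)|exact: ts].
Qed.

(** The inverse of the transform on [D], followed by a *-homomorphism, is
    completely positive: a matrix over [D] that is pointwise positive has a
    square root over [D]. *)
Lemma extend_from_transform : injective_opsys [set: B] ->
  exists2 psi : linfA R Y -> B, ucp_on setT setT psi &
    forall d, D d -> psi (char_transform d) = iota d.
Proof.
move=> [_ hB].
pose inv (f : linfA R Y) : A := get [set d | D d /\ char_transform d = f].
have invE d : D d -> inv (char_transform d) = d.
  move=> Dd; have [Di e] : [set d' | D d' /\ char_transform d' = char_transform d]
      (inv (char_transform d)) by apply: (@getI _ _ d).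
  exact: char_transform_inj.
have invP f : (char_transform @` D) f -> D (inv f) /\ char_transform (inv f) = f.
  by move=> [d Dd <-]; rewrite invE.
have [[_ t1 tL] tM ts] := char_transform_hom.
have [||||psi psiU psiE] := hB _ (char_transform @` D) setT (iota \o inv).
- exact: char_transform_opsys.
- by split.
- by [].
- split; first split.
  + by [].
  + by rewrite /= -t1 invE ?(shom1 hi) //; exact: subalg1.
  + move=> k _ _ [d Dd <-] [e De <-]; rewrite /= -tL // !invE //.
      exact: (shomL hi).
    by apply: (subalgD hD) => //; exact: (subalgZ hD).
  + move=> n X EX Xp; pose Z := map_mx inv X.
    have DZ : mx_in D Z by move=> i j; rewrite mxE; exact: (invP _ (EX i j)).1.
    have ZX : map_mx char_transform Z = X.
      by apply/matrixP => i j; rewrite !mxE; exact: (invP _ (EX i j)).2.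
    have [||W DW ZW] := psd_root hD chiC chi_norm DZ.
    * apply/matrixP => i j; rewrite mxstarE; apply: char_transform_inj => //.
        exact: (subalg_star hD).
      have := congr1 (fun V : 'M[linfA R Y]_n => V i j) (mxpos_sa Xp).
      by rewrite -ZX mxstarE !mxE ts.
    * move=> y; rewrite (_ : map_mx _ _ = map_mx (fun f => linf_at f y) X).
        by apply: psd_of_state => //; exact: linf_at_state.
      by rewrite -ZX -map_mx_comp; apply/matrixP => i j; rewrite !mxE /= char_transformE.
    exists (map_mx iota W); rewrite map_mx_comp -/Z ZW.
    apply/matrixP => i j; rewrite !mxE.
    have Dsum (s : seq 'I_n) (F : 'I_n -> A) : (forall k, D (F k)) ->
        iota (\sum_(k <- s) F k) = \sum_(k <- s) iota (F k).
      move=> DF; elim: s => [|k s IH]; first by rewrite !big_nil (shom0 hD hi).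
      by rewrite !big_cons (shomD hi) ?IH //; exact: (subalg_sum hD).
    rewrite Dsum => [|k]; last first.
      by apply: (subalgM hD) => //; rewrite mxstarE; exact: (subalg_star hD).
    apply: eq_bigr => k _; rewrite !mxstarE !mxE (shomM hi) ?(shom_star hi) //.
    exact: (subalg_star hD).
exists psi => // d Dd; rewrite psiE /= ?invE //.
by exists d.
Qed.

End CharacterTransform.

Section Ucp.
Context {R : realType} {A B : cstarAlgType R} {psi : A -> B}.
Hypothesis hp : ucp_on setT setT psi.

Lemma ucpL k x y : psi (k *: x + y) = k *: psi x + psi y.
Proof. by have [[_ _ h] _] := hp; exact: h. Qed.
Lemma ucp1 : psi 1 = 1. Proof. by have [[_ h _] _] := hp. Qed.
Lemma ucpD x y : psi (x + y) = psi x + psi y.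
Proof. by rewrite -[x in LHS]scale1r ucpL scale1r. Qed.
Lemma ucp0 : psi 0 = 0.
Proof. by apply: (addrI (psi 0)); rewrite -ucpD !addr0. Qed.
Lemma ucpZ k x : psi (k *: x) = k *: psi x.
Proof. by rewrite -[_ *: _]addr0 ucpL ucp0 addr0. Qed.
Lemma ucpB x y : psi (x - y) = psi x - psi y.
Proof. by rewrite -scaleN1r addrC ucpL scaleN1r addrC. Qed.

Lemma ucp_cpos x : cpos x -> cpos (psi x).
Proof.
move=> /mxpos11 xp; have [_ /(_ 1%N (const_mx x))] := hp.
case=> // Y /(congr1 (fun Z : 'M[B]_1 => Z 0 0)); rewrite !mxE => ->.
by apply: cpos_sum => i _; rewrite mxstarE; exact: cpos_starM.
Qed.

Lemma ucp_rcst r : psi (rcst r) = rcst r.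
Proof. by rewrite ucpZ ucp1. Qed.

Lemma ucp_sa x : star x = x -> star (psi x) = psi x.
Proof.
move=> sx; have := ucp_cpos (cpos_rcst_sub sx (lexx _)) => /cpos_sa.
rewrite ucpB ucp_rcst starB star_rcst => /(congr1 (fun z => rcst (rnorm x) - z)).
by rewrite !subKr.
Qed.

Lemma ucp_star x : psi (star x) = star (psi x).
Proof.
move: (cstarReIm x) (cstarRe_sa x) (cstarIm_sa x).
move: (cstarRe x) (cstarIm x) => a b -> sa sb.
rewrite starD starZ sa sb addrC ucpL ucpD ucpZ starD starZ !ucp_sa //.
by rewrite addrC.
Qed.

(** The Kadison-Schwarz inequality: the matrix with entries
    [star (r i) * r j], where [r = (1, x)], is tested on [(- psi x, 1)]. *)
Lemma ucp_schwarz x : cpos (psi (star x * x) - star (psi x) * psi x).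
Proof.
pose r (i : 'I_2) : A := if i == 0 then 1 else x.
pose X : 'M[A]_2 := \matrix_(i, j) (star (r i) * r j).
have Xp : mxpos X.
  exists (\matrix_(i, j) if i == 0 then r j else 0).
  apply/matrixP => i j; rewrite !mxE big_ord_recl big_ord1 !mxstarE !mxE /=.
  by rewrite mulr0 addr0.
have [_ /(_ _ X) hX] := hp.
have {}hX := hX (fun _ _ => I) Xp.
pose v : 'cV[B]_2 := \col_i if i == 0 then - psi x else 1.
have := mxpos_column v hX.
rewrite !mxE big_ord_recl big_ord1 !mxE !big_ord_recl !big_ord0 !mxE /r /=.
rewrite starN !star1 !mul1r !mulr1 !addr0 ucp1 mulr1 ucp_star.
by rewrite addNr mul0r add0r mulNr addrC.
Qed.

End Ucp.

(** * Minimal seminorms *)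

Section MinimalSeminorm.
Context {R : realType} {V : lmodType R[i]}.
Implicit Types (q p : V -> R) (x y : V).

Lemma seminorm0 q : complex_seminorm q -> q 0 = 0.
Proof. by move=> [_ /(_ 0 0)]; rewrite scaler0 cmod0 mul0r. Qed.

Lemma seminormN q x : complex_seminorm q -> q (- x) = q x.
Proof. by move=> [_ qZ]; rewrite -scaleN1r qZ cmodN cmod1 mul1r. Qed.

Lemma seminorm_ge0 q x : complex_seminorm q -> 0 <= q x.
Proof.
move=> hq; have := hq.1 x (- x); rewrite subrr seminorm0 // seminormN //.
by move=> h; lra.
Qed.

Definition linear_map (W : lmodType R[i]) (T : V -> W) : Prop :=
  forall k x y, T (k *: x + y) = k *: T x + T y.

Section LinearMap.
Context {W : lmodType R[i]} {T : V -> W}.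
Hypothesis hT : linear_map T.
Lemma linear_mapD x y : T (x + y) = T x + T y.
Proof. by rewrite -[x in LHS]scale1r hT scale1r. Qed.
Lemma linear_map0 : T 0 = 0.
Proof. by apply: (addrI (T 0)); rewrite -linear_mapD !addr0. Qed.
Lemma linear_mapZ k x : T (k *: x) = k *: T x.
Proof. by rewrite -[_ *: _]addr0 hT linear_map0 addr0. Qed.
Lemma linear_mapB x y : T (x - y) = T x - T y.
Proof. by rewrite -(scaleN1r y) linear_mapD linear_mapZ scaleN1r. Qed.
End LinearMap.

Lemma seminorm_comp (W : lmodType R[i]) (T : V -> W) (p : W -> R) :
  linear_map T -> complex_seminorm p -> complex_seminorm (p \o T).
Proof.
move=> hT [pD pZ]; split=> [x y|k x] /=; first by rewrite (linear_mapD hT).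
by rewrite (linear_mapZ hT).
Qed.

Variables (N : V -> R) (E : set V).

(** Minimal elements of this class play the role of the norm of the injective
    envelope of [E]. *)
Definition subseminorm q : Prop :=
  [/\ complex_seminorm q, forall x, q x <= N x & forall e, E e -> q e = N e].

Definition minimal_subseminorm q : Prop :=
  subseminorm q /\ forall p, subseminorm p -> (forall x, p x <= q x) -> p = q.

Lemma exists_minimal_subseminorm : complex_seminorm N ->
  exists q, minimal_subseminorm q.
Proof.
move=> hN.
have [||F F0 FQ Fc|q hq qmin] := @exists_minimal_function R V subseminorm (fun=> 0).
- by exists N; split.
- by move=> p x [hp _ _]; exact: seminorm_ge0.
- have hb p x : F p -> 0 <= p x by move=> /FQ[hp _ _]; exact: seminorm_ge0.
  have [p0 Fp0] := F0.
  have le p x : F p -> pointwise_inf F x <= p x.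
    exact: (@pointwise_inf_le _ _ F (fun=> 0) p x hb).
  split; first split.
  + move=> x y; apply: (@pointwise_inf_sub _ _ F (fun=> 0)) => //.
    by move=> p /FQ[[pD _] _ _]; exact: pD.
  + move=> k x; have [k0|k0] := eqVneq (cmod k) 0.
      rewrite k0 mul0r (cmod_eq0 k0) scale0r.
      apply/eqP; rewrite eq_le; apply/andP; split.
        by apply: le_trans (le _ 0 Fp0) _; have [/seminorm0 -> _ _] := FQ _ Fp0.
      by apply: le_pointwise_inf => // p /hb.
    have kp : 0 < cmod k by rewrite lt_def k0 cmod_ge0.
    apply: (@pointwise_inf_scale _ _ F (fun=> 0)) => //.
    by move=> p /FQ[[_ pZ] _ _]; exact: pZ.
  + by move=> x; apply: le_trans (le _ x Fp0) _; have [_ h _] := FQ _ Fp0.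
  + move=> e Ee; apply/eqP; rewrite eq_le; apply/andP; split.
      by apply: le_trans (le _ e Fp0) _; have [_ _ ->] := FQ _ Fp0.
    by apply: le_pointwise_inf => // p /FQ[_ _ ->].
by exists q.
Qed.

(** Averaging the iterates of [T] yields again a subseminorm, which by
    minimality equals [q]; on [T x - x] the averages tend to zero. *)
Lemma minimal_subseminorm_rigid q (T : V -> V) : minimal_subseminorm q ->
  linear_map T -> (forall x, q (T x) <= q x) -> (forall e, E e -> T e = e) ->
  forall x, q (T x - x) = 0.
Proof.
move=> [hQ qmin] hT Tq TE x; have [hq qN qE] := hQ; have [qD qZ] := hq.
pose S n (z : V) := \sum_(i < n) iter i T z.
have iter_lin i : linear_map (iter i T).
  by elim: i => [|i IH] k z w //=; rewrite IH hT.
have iter_q i z : q (iter i T z) <= q z.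
  by elim: i => //= i IH; exact: le_trans (Tq _) IH.
have S_lin n : linear_map (S n).
  move=> k z w; rewrite /S scaler_sumr -big_split; apply: eq_bigr => i _.
  exact: iter_lin.
have S_q n z : q (S n z) <= n%:R * q z.
  rewrite /S; elim: n => [|n IH]; first by rewrite big_ord0 seminorm0 // mul0r.
  rewrite big_ord_recr /= -natr1 mulrDl mul1r.
  exact: le_trans (qD _ _) (lerD IH (iter_q _ _)).
have S_E n e : E e -> S n e = n%:R%:C *: e.
  move=> Ee; rewrite /S; elim: n => [|n IH]; first by rewrite big_ord0 scale0r.
  rewrite big_ord_recr /= IH -natr1 rmorphD scalerDl scale1r; congr (_ + _).
  by elim: n {IH} => //= n ->; exact: TE.
have S_tele n : S n (T x - x) = iter n T x - x.
  elim: n => [|n IH]; first by rewrite /S big_ord0 subrr.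
  rewrite /S big_ord_recr -/(S n _) IH (linear_mapB (iter_lin n)) -iterSr /=.
  by rewrite addrC addrA subrK.
have avg n z : q (S n.+1 z) = n.+1%:R * q z.
  pose p z := n.+1%:R^-1 * q (S n.+1 z).
  have n0 : 0 < n.+1%:R :> R by rewrite ltr0n.
  have pq w : p w <= q w by rewrite /p mulrC ler_pdivrMr // mulrC.
  have pE : p = q.
    apply: (qmin p _ pq); split.
    - split=> [u w|k w]; rewrite /p.
        by rewrite (linear_mapD (S_lin _)) -mulrDr ler_wpM2l ?invr_ge0 ?ler0n.
      by rewrite (linear_mapZ (S_lin _)) qZ mulrCA.
    - by move=> w; exact: le_trans (pq w) (qN w).
    - move=> e Ee; rewrite /p S_E // qZ cmod_real ger0_norm ?ler0n //.
      by rewrite mulrA mulVf ?gt_eqF // mul1r qE.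
  by rewrite -{2}pE /p mulrA divff ?gt_eqF // mul1r.
have bd n : n.+1%:R * q (T x - x) <= q x + q x.
  rewrite -avg S_tele; apply: le_trans (qD _ _) _.
  by rewrite seminormN // lerD2r.
apply/eqP/negPn/negP => c0.
have c1 : 0 < q (T x - x) by rewrite lt_def c0 seminorm_ge0.
have := bd (Num.bound ((q x + q x) / q (T x - x))); rewrite leNgt => /negP; apply.
rewrite -ltr_pdivrMr //; apply: lt_le_trans (archi_boundP _) _.
  by rewrite divr_ge0 ?addr_ge0 ?seminorm_ge0.
by rewrite ler_nat.
Qed.

End MinimalSeminorm.

(** * Complete isometries *)

Section ColumnNorm.
Context {R : realType} {A : cstarAlgType R}.

Lemma colnormE n (v : 'cV[A]_n) : colnorm v = Num.sqrt (rnorm ((mxstar v *m v) 0 0)).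
Proof. by []. Qed.

Lemma colnorm_ge0 n (v : 'cV[A]_n) : 0 <= colnorm v.
Proof. exact: sqrtr_ge0. Qed.

Lemma colnorm_sqr n (v : 'cV[A]_n) : colnorm v ^+ 2 = rnorm ((mxstar v *m v) 0 0).
Proof. by rewrite sqr_sqrtr // rnorm_ge0. Qed.

Lemma colnorm_le n (v : 'cV[A]_n) c : 0 <= c ->
  (colnorm v <= c) = (rnorm ((mxstar v *m v) 0 0) <= c ^+ 2).
Proof. by move=> c0; rewrite -colnorm_sqr ler_pXn2r ?nnegrE ?colnorm_ge0. Qed.

Lemma colnorm1 (v : 'cV[A]_1) : colnorm v = rnorm (v 0 0).
Proof.
rewrite colnormE mxE big_ord1 mxstarE rnorm_starM sqrtr_sqr ger0_norm //.
exact: rnorm_ge0.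
Qed.

Lemma mxcnorm11 (x : A) : mxcnorm (const_mx x : 'M[A]_1) = rnorm x.
Proof.
have e (v : 'cV[A]_1) : colnorm ((const_mx x : 'M[A]_1) *m v) = rnorm (x * v 0 0).
  by rewrite colnorm1 mxE big_ord1 mxE.
rewrite /mxcnorm; set S := (X in sup X).
have ub : ubound S (rnorm x).
  move=> _ [v /= v1 <-]; rewrite e; apply: le_trans (rnormM _ _) _.
  by rewrite ler_piMr ?rnorm_ge0 // -colnorm1.
have Sx : S (rnorm x).
  exists (const_mx 1); first by rewrite /= colnorm1 mxE rnorm1_le1.
  by rewrite e mxE mulr1.
apply/eqP; rewrite eq_le; apply/andP; split.
  by apply: ge_sup => //; exists (rnorm x).
by apply: ub_le_sup => //; exists (rnorm x).
Qed.

End ColumnNorm.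

Lemma complete_isometry_isometric (R : realType) (A B : cstarAlgType R)
  (E : set A) (F : set B) (f : A -> B) x :
  unital_complete_isometry_on E F f -> E x -> rnorm (f x) = rnorm x.
Proof.
move=> [_ /(_ 1%N (const_mx x))] h Ex.
rewrite -(mxcnorm11 x) -h => [|i j]; last by rewrite mxE.
by rewrite -mxcnorm11; congr mxcnorm; apply/matrixP => i j; rewrite !mxE.
Qed.

Section TransformIsometry.
Context {R : realType} {A : cstarAlgType R} {Y : Type} {chi : Y -> A -> R[i]}.
Hypothesis chiC : forall y, is_character (chi y).
Hypothesis chi_norm : forall d c, 0 <= c ->
  (forall y, cmod (chi y d) <= c) -> rnorm d <= c.
Local Notation tau := (char_transform (chi := chi)).

Lemma transform_rnorm a : rnorm (tau a) = rnorm a.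
Proof.
apply/eqP; rewrite eq_le; apply/andP; split.
  apply: linf_rnorm_le => [|y]; first exact: rnorm_ge0.
  by rewrite char_transformE //; have [_ _ h] := character_state (chiC y).
apply: chi_norm => [|y]; first exact: rnorm_ge0.
by rewrite -char_transformE //; exact: linf_rnorm_ge.
Qed.

Lemma map_transform_mulmx m n p (X : 'M[A]_(m, n)) (Z : 'M[A]_(n, p)) :
  map_mx tau (X *m Z) = map_mx tau X *m map_mx tau Z.
Proof.
apply/matrixP => i j; rewrite !mxE; apply: linf_eqP => y.
have [yl _ yM _] := chiC y.
rewrite char_transformE // linf_at_sum.
rewrite (big_morph (chi y) (functionalD yl) (functional0 yl)).
by apply: eq_bigr => k _; rewrite linf_atM !mxE !char_transformE // yM.
Qed.

Lemma map_transform_star m n (X : 'M[A]_(m, n)) :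
  map_mx tau (mxstar X) = mxstar (map_mx tau X).
Proof.
have [_ _ ts] := char_transform_hom chiC.
by apply/matrixP => i j; rewrite mxstarE !mxE ts.
Qed.

Lemma colnorm_transform n (v : 'cV[A]_n) : colnorm (map_mx tau v) = colnorm v.
Proof.
rewrite !colnormE -map_transform_star -map_transform_mulmx.
by rewrite [(map_mx _ _) 0 0]mxE transform_rnorm.
Qed.

Lemma linf_column_at n (w : 'cV[linfA R Y]_n) y :
  linf_at ((mxstar w *m w) 0 0) y = (\sum_i cmod (linf_at (w i 0) y) ^+ 2)%:C.
Proof.
rewrite mxE linf_at_sum rmorph_sum; apply: eq_bigr => i _.
by rewrite mxstarE linf_atM linf_at_starE cmod_sqr.
Qed.

Lemma linf_colnorm_le n (w : 'cV[linfA R Y]_n) c : 0 <= c ->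
  (forall y, \sum_i cmod (linf_at (w i 0) y) ^+ 2 <= c ^+ 2) -> colnorm w <= c.
Proof.
move=> c0 h; rewrite colnorm_le //; apply: linf_rnorm_le => [|y].
  exact: exprn_ge0.
rewrite linf_column_at cmod_real ger0_norm //.
by apply: sumr_ge0 => i _; rewrite exprn_ge0 ?cmod_ge0.
Qed.

Lemma linf_colnorm_ge n (w : 'cV[linfA R Y]_n) y :
  \sum_i cmod (linf_at (w i 0) y) ^+ 2 <= colnorm w ^+ 2.
Proof.
rewrite colnorm_sqr; apply: le_trans (linf_rnorm_ge _ y).
by rewrite linf_column_at cmod_real ler_norm.
Qed.

(** Over bounded functions the norm of a matrix is the supremum of the norms of
    its values, and these are already computed on constant columns, which
    belong to [A]. *)
Lemma transform_mxcnorm n (X : 'M[A]_n) : mxcnorm (map_mx tau X) = mxcnorm X.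
Proof.
rewrite /mxcnorm; set S1 := (X in sup X = _); set S2 := (X in _ = sup X).
have S21 : S2 `<=` S1.
  move=> _ [v /= v1 <-]; exists (map_mx tau v); first by rewrite /= colnorm_transform.
  by rewrite -map_transform_mulmx colnorm_transform.
have S20 : S2 (colnorm (X *m 0)).
  exists 0 => //=; rewrite colnorm_le // mulmx0 mxE rnorm0.
  exact: exprn_ge0.
have [K hK] : has_ubound S1.
  pose k i := \sum_j rnorm (X i j).
  have k0 i : 0 <= k i by apply: sumr_ge0 => j _; exact: rnorm_ge0.
  pose N := \sum_i k i ^+ 2.
  have N0 : 0 <= N by apply: sumr_ge0 => i _; exact: exprn_ge0.
  exists (Num.sqrt N) => _ [w /= w1 <-].
  apply: linf_colnorm_le => [|y]; first exact: sqrtr_ge0.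
  rewrite sqr_sqrtr //; apply: ler_sum => i _.
  rewrite ler_pXn2r ?nnegrE ?cmod_ge0 // mxE linf_at_sum.
  have cmod_sum (s : seq 'I_n) (F : 'I_n -> R[i]) :
      cmod (\sum_(j <- s) F j) <= \sum_(j <- s) cmod (F j).
    elim/big_rec2 : _ => [|j b a _ h]; first by rewrite cmod0.
    by apply: le_trans (cmodD _ _) _; rewrite lerD2l.
  apply: le_trans (cmod_sum _ _) _; apply: ler_sum => j _.
  rewrite linf_atM cmodM mxE -[leRHS]mulr1 ler_pM ?cmod_ge0 //.
    by apply: le_trans (linf_rnorm_ge _ _) _; rewrite transform_rnorm.
  have : cmod (linf_at (w j 0) y) ^+ 2 <= 1.
    apply: le_trans (le_trans (linf_colnorm_ge w y) _); last first.
      by rewrite expr_le1 ?colnorm_ge0.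
    rewrite (bigD1 j) //= lerDl sumr_ge0 // => l _.
    by rewrite exprn_ge0 ?cmod_ge0.
  by rewrite expr_le1 ?cmod_ge0.
have ub2 : has_ubound S2 by exists K => z /S21; exact: hK.
apply/eqP; rewrite eq_le; apply/andP; split; last first.
  apply: ge_sup; first by exists (colnorm (X *m 0)).
  by move=> z /S21 S1z; apply: ub_le_sup S1z; exists K.
have s0 : 0 <= sup S2 by apply: le_trans (colnorm_ge0 _) (ub_le_sup ub2 S20).
apply: ge_sup; first by exists (colnorm (X *m 0)); exact: S21.
move=> _ [w /= w1 <-]; apply: linf_colnorm_le => // y.
pose u : 'cV[A]_n := scalar_col (map_mx (fun f => linf_at f y) w).
have uE i : u i 0 = linf_at (w i 0) y *: (1 : A) by rewrite !mxE.
have u1 : colnorm u <= 1.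
  rewrite colnorm_le // expr1n mxE; apply: le_trans (rnorm_sum _ _ _) _.
  have : \sum_i cmod (linf_at (w i 0) y) ^+ 2 <= 1.
    by apply: le_trans (linf_colnorm_ge w y) _; rewrite expr_le1 ?colnorm_ge0.
  apply: le_trans; apply: ler_sum => i _.
  rewrite mxstarE rnorm_starM uE rnormZ.
  rewrite ler_pXn2r ?nnegrE ?mulr_ge0 ?cmod_ge0 ?rnorm_ge0 //.
  by rewrite ler_piMr ?cmod_ge0 ?rnorm1_le1.
have Su : S2 (colnorm (X *m u)) by exists u.
have e i : linf_at ((map_mx tau X *m w) i 0) y = linf_at (map_mx tau (X *m u) i 0) y.
  rewrite map_transform_mulmx !mxE !linf_at_sum; apply: eq_bigr => j _.
  rewrite !linf_atM !mxE !char_transformE //; have [yl y1 _ _] := chiC y.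
  by rewrite (functionalZ yl) y1 mulr1.
under eq_bigr => i _ do rewrite e.
apply: le_trans (linf_colnorm_ge _ y) _.
rewrite colnorm_transform ler_pXn2r ?nnegrE ?colnorm_ge0 //.
exact: ub_le_sup Su.
Qed.

End TransformIsometry.

(** * Rigidity of the injective envelope *)

Section StateExtension.
Context {R : realType} {A : cstarAlgType R} {Y : Type}.

Lemma rnorm_seminorm : complex_seminorm (fun x : A => rnorm x).
Proof. by split=> [x y|k x]; [exact: rnormD|exact: rnormZ]. Qed.

Lemma linear_functional_at (g : A -> linfA R Y) : linear_map g ->
  forall y, linear_functional (fun x => linf_at (g x) y).
Proof. by move=> gl y k a b; rewrite gl. Qed.

(** Hahn-Banach at each point: a family of functionals dominated by a seminorm
    extends to a linear map into bounded functions. *)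
Lemma linf_hahn_banach (E : set A) (f : A -> linfA R Y) (q : A -> R) :
  complex_seminorm q -> E 0 ->
  (forall k x y, E x -> E y -> E (k *: x + y)) ->
  (forall k x y, E x -> E y -> f (k *: x + y) = k *: f x + f y) ->
  (forall x y, E x -> cmod (linf_at (f x) y) <= q x) ->
  exists g : A -> linfA R Y, [/\ linear_map g,
    forall x y, cmod (linf_at (g x) y) <= q x & forall x, E x -> g x = f x].
Proof.
move=> qs E0 EL fL fq.
have hb y : exists h : A -> R[i], [/\ linear_functional h,
    forall x, cmod (h x) <= q x & forall x, E x -> h x = linf_at (f x) y].
  apply: complex_hahn_banach => // [k a b Ea Eb|x Ex].
    by rewrite fL // linf_atD linf_atZ.
  exact: fq.
have [h hP] := choice hb.
have hE x : linf_at (to_linf (fun y => h y x)) = fun y => h y x.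
  by apply: to_linfE; exists (q x) => y; have [_ h1 _] := hP y.
exists (fun x => to_linf (fun y => h y x)); split.
- move=> k a b; apply: linf_eqP => y; rewrite linf_atD linf_atZ !hE.
  by have [l _ _] := hP y; exact: l.
- by move=> x y; rewrite hE; have [_ l _] := hP y.
- by move=> x Ex; apply: linf_eqP => y; rewrite hE; have [_ _ ->] := hP y.
Qed.

(** Each coordinate of [f] is a positive functional on [E], hence contractive,
    and its contractive extension is a state. *)
Lemma linf_ucp_extension (E : set A) (S : set (linfA R Y)) (f : A -> linfA R Y) :
  operator_system E -> ucp_on E S f ->
  exists g : A -> linfA R Y, [/\ linear_map g,
    forall y, is_state (fun x => linf_at (g x) y) & forall x, E x -> g x = f x].
Proof.
move=> hE [[fS f1 fL] fp]; have [E1 EL Es] := hE.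
have E0 : E 0 by rewrite -(addNr 1) -scaleN1r; exact: EL.
have fpos x : E x -> cpos x -> cpos (f x).
  move=> Ex /mxpos11 xp; have := fp 1%N (const_mx x).
  case=> // [i j|Z /(congr1 (fun X : 'M[linfA R Y]_1 => X 0 0))]; first by rewrite mxE.
  by rewrite !mxE => ->; apply: cpos_sum => i _; rewrite mxstarE; exact: cpos_starM.
have [|//|//|//||g [gl gb gE]] := @linf_hahn_banach E f (fun x => rnorm x).
- exact: rnorm_seminorm.
- move=> x y.
  apply: (@positive_on_opsys_contractive _ _ E (fun x => linf_at (f x) y)) => //.
  + by rewrite f1 linf_at1.
  + by move=> k a b Ea Eb; rewrite fL // linf_atD linf_atZ.
  + by move=> z Ez zp; exact: (state_cpos (linf_at_state y) (fpos z Ez zp)).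
exists g; split=> // y; split=> //; first exact: linear_functional_at.
by rewrite gE // f1 linf_at1.
Qed.

End StateExtension.

Section SeminormKernel.
Context {R : realType} {A : cstarAlgType R}.

Lemma closed_of_approx (K : set A) :
  (forall x, (forall e : R, 0 < e -> exists2 k, K k & rnorm (x - k) < e) -> K x) ->
  closed K.
Proof.
move=> h x cx; apply: h => e e0.
have [|k [Kk xk]] := cx (ball x e%:C); first by apply: nbhsx_ballx; rewrite ltcR.
by exists k => //; move: xk; rewrite -ball_normE /= rnormE ltcR.
Qed.

Lemma closed_kernel (p : A -> R) : complex_seminorm p ->
  (forall x, p x <= rnorm x) -> closed [set x | p x = 0].
Proof.
move=> ps pN; apply: closed_of_approx => x h /=.
apply/eqP; rewrite eq_le (seminorm_ge0 _ ps) andbT leNgt; apply/negP => x0.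
have [k /= k0 xk] := h _ x0; move: xk; rewrite ltNge => /negP; apply.
apply: le_trans (pN _); rewrite -{1}(subrK k x).
by apply: le_trans (ps.1 _ _) _; rewrite k0 addr0.
Qed.

End SeminormKernel.

Section Envelope.
Context {R : realType} {A : cstarAlgType R} {D : set A}.
Hypotheses (hD : cstar_subalgebra D) (hA : forall x y : A, x * y = y * x).
Context {ID : cstarAlgType R} {iota : A -> ID}.
Hypothesis hID : injective_envelope D iota.

Definition spectrum : Type := {y : A -> R[i] | is_character y}.
Definition spectrum_eval (y : spectrum) : A -> R[i] := sval y.

Lemma spectrum_evalC y : is_character (spectrum_eval y).
Proof. exact: svalP. Qed.

Lemma spectrum_norm d c : 0 <= c ->
  (forall y, cmod (spectrum_eval y d) <= c) -> rnorm d <= c.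
Proof.
move=> c0 h; rewrite leNgt; apply/negP => cd.
have J0 : closed_ideal [set (0 : A)].
  split=> //.
  - rewrite (_ : [set 0] = [set x : A | rnorm x = 0]).
      by apply: closed_kernel => //; exact: rnorm_seminorm.
    by apply/seteqP; split=> x /= => [->|]; [exact: rnorm0|exact: rnorm_eq0].
  - by move=> x y -> ->; rewrite /= addr0.
  - by move=> a x ->; rewrite /= mulr0 mul0r.
have [||||y [yc _ yd]] := @exists_character_norm R A hA setT [set 0] subalgT J0 _
  d ((c + rnorm d) / 2).
- by rewrite setTI.
- by [].
- by rewrite divr_ge0 // addr_ge0 ?rnorm_ge0.
- by rewrite ltr_pdivrMr //; lra.
have := le_trans yd (h (exist _ y yc)); rewrite ler_pdivrMr //; lra.
Qed.

Local Notation C := (linfA R spectrum).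
Local Notation tau := (char_transform (chi := spectrum_eval)).


Lemma envelope_hom : unital_star_hom_on D iota. Proof. by have [] := hID. Qed.

Lemma envelope_rnorm d : D d -> rnorm (iota d) = rnorm d.
Proof.
have [hi inj _ _] := hID; apply: (shom_isometric hD hi) => x Dx ix.
by apply: inj => //; [exact: (subalg0 hD)|rewrite ix (shom0 hD hi)].
Qed.

Lemma isometric_state (B : cstarAlgType R) (Y : Type) (t : B -> linfA R Y) y :
  linear_map t -> t 1 = 1 -> (forall x, rnorm (t x) <= rnorm x) ->
  is_state (fun x => linf_at (t x) y).
Proof.
move=> tl t1 tc; split; [exact: linear_functional_at|by rewrite t1 linf_at1|].
by move=> x; apply: le_trans (linf_rnorm_ge _ _) (tc x).
Qed.

(** The image [S] of the idempotent attached to a minimal seminorm on [C] is an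
    injective operator system that contains [D] and admits no contraction
    fixing [D] other than the identity. The universal property embeds [ID]
    isometrically into [S], injectivity of [ID] gives a map back, and rigidity
    of [S] makes them inverse to each other. *)
Lemma envelope_rigid_retract : exists (t : ID -> C) (kappa : C -> ID),
  [/\ linear_map t, linear_map kappa, t 1 = 1,
      forall x, rnorm (t x) = rnorm x &
  [/\ forall x, rnorm (kappa x) <= rnorm x, forall x, kappa (t x) = x,
      forall d, D d -> t (iota d) = tau d &
      minimal_subseminorm (fun x : ID => rnorm x) (iota @` D) (fun x : ID => rnorm x)]].
Proof.
have [hi iinj hinj huniv] := hID.
have T := @subalgT R A.
have [[_ tau1 tauL'] _ taus] := char_transform_hom spectrum_evalC.
have tauL : linear_map (tau : A -> C) by move=> k a b; exact: tauL'.
pose E : set C := tau @` D.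
have hE : operator_system E by exact: (char_transform_opsys spectrum_evalC hD).
have [E1 EL Es] := hE.
have E0 : E 0 by exists 0; [exact: (subalg0 hD)|exact: (linear_map0 tauL)].
have [q qmin] := exists_minimal_subseminorm E (@rnorm_seminorm R C).
have [[qs qN qE] qle] := qmin.
have [|||phi [phil phiq phiE]] := @linf_hahn_banach R C spectrum E id q qs E0.
- exact: EL.
- by [].
- by move=> x y Ex /=; rewrite qE //; exact: linf_rnorm_ge.
have phib x : rnorm (phi x) <= q x.
  by apply: linf_rnorm_le => //; exact: seminorm_ge0.
have phiN x : rnorm (phi x) = q x.
  have : (fun x => rnorm (phi x)) = q.
    apply: (qle _ _ phib); split.
    - exact: (seminorm_comp phil (@rnorm_seminorm R C)).
    - by move=> z; exact: le_trans (phib z) (qN z).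
    - by move=> e Ee; rewrite phiE.
  by move=> /(congr1 (@^~ x)).
have phi_absorb (th : C -> C) : linear_map th ->
    (forall x, rnorm (th x) <= q x) -> (forall e, E e -> th e = e) ->
    forall x, phi (th x) = phi x.
  move=> thl thb thE x; apply/eqP; rewrite -subr_eq0 -(linear_mapB phil).
  apply/eqP/rnorm_eq0; rewrite phiN.
  apply: (minimal_subseminorm_rigid qmin) => // z.
  exact: le_trans (qN _) (thb z).
have phi_idem x : phi (phi x) = phi x by apply: phi_absorb.
have phi1 : phi 1 = 1 by exact: phiE.
have phi_state y : is_state (fun x => linf_at (phi x) y).
  apply: isometric_state => // x; exact: le_trans (phib x) (qN x).
pose S : set C := [set x | phi x = x].
have hS : operator_system S.
  split=> //.
  - by move=> k x y /= xS yS; rewrite /S /= phil xS yS.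
  - move=> x /= xS; rewrite /S /=; apply: linf_eqP => y.
    by rewrite (state_star _ (phi_state y)) xS linf_at_starE.
have injS : injective_opsys S.
  split=> // B E' F f hE' hF EF fucp.
  have [g [gl gs gE]] := linf_ucp_extension hE' fucp.
  have [[fS _ _] _] := fucp.
  have ps y : is_state (fun x => linf_at (phi (g x)) y).
    split.
    - by move=> k a b; rewrite gl phil.
    - have -> : g 1 = 1.
        by apply: linf_eqP => z; have [_ -> _] := gs z; rewrite linf_at1.
      by rewrite phi1 linf_at1.
    - move=> x; apply: le_trans (linf_rnorm_ge _ _) _.
      apply: le_trans (le_trans (phib _) (qN _)) _.
      by apply: linf_rnorm_le => [|z]; [exact: rnorm_ge0|have [_ _ h] := gs z].
  exists (phi \o g); last by move=> x Ex /=; rewrite gE //; exact: fS.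
  split; first split.
  - by move=> x _ /=; exact: phi_idem.
  - by apply: linf_eqP => y /=; have [_ -> _] := ps y; rewrite linf_at1.
  - by move=> k a b _ _ /=; rewrite gl phil.
  - by move=> n X _; exact: (pointwise_states_mxpos ps).
have [|t [[tS t1 tL'] tiso'] tiota] := huniv C S tau injS.
  split; first split=> //.
  - by move=> d Dd; apply: phiE; exists d.
  - by move=> n X _; exact: (transform_mxcnorm spectrum_evalC spectrum_norm).
have tl : linear_map t by move=> k a b; exact: tL'.
have tiso x : rnorm (t x) = rnorm x.
  exact: (@complete_isometry_isometric _ _ _ setT S).
have ts y : is_state (fun x => linf_at (t x) y).
  by apply: isometric_state => // x; rewrite tiso.
have [psi psiU psiE] : exists2 psi : C -> ID, ucp_on setT setT psi &
    forall d, D d -> psi (tau d) = iota d.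
  apply: (extend_from_transform spectrum_evalC hD hi) hinj.
  by move=> d c _; exact: spectrum_norm.
have psil : linear_map psi by move=> k a b; exact: (ucpL psiU).
have tpsi x : rnorm (t (psi x)) <= rnorm x.
  apply: linf_rnorm_le => [|y]; first exact: rnorm_ge0.
  have [|||_ _] := @positive_functional_state R C (fun x => linf_at (t (psi x)) y).
  - by move=> k a b; rewrite psil tl.
  - by rewrite (ucp1 psiU) t1 linf_at1.
  - by move=> z zp; apply: (state_cpos (ts y)); exact: (ucp_cpos psiU).
  by move=> h; exact: h.
pose kappa x := psi (phi x).
have tkappa x : t (kappa x) = phi x.
  have tS' z : phi (t z) = t z by exact: tS.
  rewrite -[LHS]tS'; apply: (phi_absorb (fun x => t (kappa x))) => [k a b|z|e Ee].
  - by rewrite /kappa phil psil tl.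
  - by apply: le_trans (tpsi _) (phib z).
  - by have [d Dd <-] := Ee; rewrite /kappa phiE ?psiE ?tiota //; exists d.
have t_inj x y : t x = t y -> x = y.
  move=> e; apply/eqP; rewrite -subr_eq0; apply/eqP/rnorm_eq0.
  by rewrite -tiso (linear_mapB tl) e subrr rnorm0.
have kappat x : kappa (t x) = x by apply: t_inj; rewrite tkappa; exact: tS.
have kappaN x : rnorm (kappa x) = q x by rewrite -tiso tkappa phiN.
exists t, kappa; split=> //.
  by move=> k a b; rewrite /kappa phil psil.
split=> // [x|]; first by rewrite kappaN.
split; first by split=> //; exact: rnorm_seminorm.
move=> p [ps pN pE] _; apply/funext => z.
have e : (fun x => p (kappa x)) = q.
  apply: qle => [|x]; last by rewrite -kappaN.
  split.
  - apply: (seminorm_comp (T := kappa) _ ps) => k a b.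
    by rewrite /kappa phil psil.
  - by move=> x; apply: le_trans (pN _) _; rewrite kappaN.
  - move=> _ [d Dd <-]; rewrite -[in LHS](tiota d Dd) kappat pE; last by exists d.
    by rewrite -tiso tiota.
by rewrite -[in LHS](kappat z) -/((fun x => p (kappa x)) (t z)) e -kappaN kappat.
Qed.

End Envelope.

(** * Multiplicative pseudo-expectations and maximal disjoint ideals *)

Section QuotientSpectrum.
Context {R : realType} {A : cstarAlgType R} {D J : set A}.
Hypotheses (hD : cstar_subalgebra D) (hA : forall x y : A, x * y = y * x).
Hypotheses (hJ : closed_ideal J) (hDJ : D `&` J = [set 0]).

(** The spectrum of the quotient of [A] by [J]. *)
Definition quotient_spectrum : Type :=
  {y : A -> R[i] | is_character y /\ forall j, J j -> y j = 0}.
Definition quotient_eval (y : quotient_spectrum) : A -> R[i] := sval y.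

Lemma quotient_evalC y : is_character (quotient_eval y).
Proof. by case: y => y []. Qed.

Local Notation tau := (char_transform (chi := quotient_eval)).

Lemma quotient_transform0 j : J j -> tau j = 0.
Proof.
move=> Jj; apply: linf_eqP => y; rewrite char_transformE; last exact: quotient_evalC.
by case: y => y [yc yJ]; exact: yJ.
Qed.

Lemma quotient_norm d c : D d -> 0 <= c ->
  (forall y, cmod (quotient_eval y d) <= c) -> rnorm d <= c.
Proof.
move=> Dd c0 h; rewrite leNgt; apply/negP => cd.
have [||y [yc yJ yd]] := @exists_character_norm R A hA D J hD hJ hDJ
  d ((c + rnorm d) / 2) Dd.
- by rewrite divr_ge0 // addr_ge0 ?rnorm_ge0.
- by rewrite ltr_pdivrMr //; lra.
have := le_trans yd (h (exist _ y (conj yc yJ))); rewrite ler_pdivrMr //; lra.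
Qed.

Lemma quotient_rnorm d : D d -> rnorm (tau d) = rnorm d.
Proof.
move=> Dd; apply/eqP; rewrite eq_le; apply/andP; split.
  apply: linf_rnorm_le => [|y]; first exact: rnorm_ge0.
  rewrite char_transformE; last exact: quotient_evalC.
  by have [_ _ h] := character_state (quotient_evalC y).
apply: quotient_norm => // [|y]; first exact: rnorm_ge0.
rewrite -char_transformE; last exact: quotient_evalC.
exact: linf_rnorm_ge.
Qed.

Lemma quotient_transform_linear : linear_map (tau : A -> linfA R quotient_spectrum).
Proof.
have [[_ _ h] _ _] := char_transform_hom quotient_evalC.
by move=> k a b; exact: h.
Qed.

End QuotientSpectrum.

Section Factorization.
Context {R : realType} {A ID : cstarAlgType R} {Y : Type}.

(** The inequality makes [Phi a |-> sigma a] well defined and contractive on the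
    range of [Phi], from which it extends pointwise. *)
Lemma contraction_factor (Phi : A -> ID) (sigma : A -> linfA R Y) :
  linear_map Phi -> linear_map sigma ->
  (forall a, rnorm (sigma a) <= rnorm (Phi a)) ->
  exists eta : ID -> linfA R Y, [/\ linear_map eta,
    forall x, rnorm (eta x) <= rnorm x & forall a, eta (Phi a) = sigma a].
Proof.
move=> Pl sl sP.
pose inv x := get [set a | Phi a = x].
have invE a : sigma (inv (Phi a)) = sigma a.
  have e : Phi (inv (Phi a)) = Phi a by apply: (@getI _ [set b | Phi b = Phi a] a).
  apply/eqP; rewrite -subr_eq0 -(linear_mapB sl); apply/eqP/rnorm_eq0.
  apply/eqP; rewrite eq_le rnorm_ge0 andbT; apply: le_trans (sP _) _.
  by rewrite (linear_mapB Pl) e subrr rnorm0.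
pose E : set ID := range Phi.
have [||||eta [el eb eE]] := @linf_hahn_banach R ID Y E (sigma \o inv) _
  (@rnorm_seminorm R ID).
- by exists 0; rewrite // (linear_map0 Pl).
- by move=> k _ _ [a _ <-] [b _ <-]; exists (k *: a + b).
- by move=> k _ _ [a _ <-] [b _ <-] /=; rewrite -Pl !invE sl.
- move=> _ y [a _ <-] /=; rewrite invE; apply: le_trans (sP a).
  exact: linf_rnorm_ge.
exists eta; split=> // [x|a].
  by apply: linf_rnorm_le => //; exact: rnorm_ge0.
by rewrite eE /= ?invE //; exists a.
Qed.

End Factorization.

Section Main.
Context {R : realType} {A : cstarAlgType R} {D : set A}.
Hypotheses (hD : cstar_subalgebra D) (hA : forall x y : A, x * y = y * x).
Context {ID : cstarAlgType R} {iota : A -> ID}.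
Hypothesis hID : injective_envelope D iota.

Lemma shom_linear (B C : cstarAlgType R) (f : B -> C) :
  unital_star_hom_on setT f -> linear_map f.
Proof. by move=> [[_ _ h] _ _] k x y; exact: h. Qed.

Lemma kernel_closed_ideal (B C : cstarAlgType R) (f : B -> C) :
  unital_star_hom_on setT f -> closed_ideal (hom_kernel f).
Proof.
move=> hf; have fl := shom_linear hf; have [_ fM _] := hf.
split.
- rewrite (_ : hom_kernel f = [set x | rnorm (f x) = 0]).
    apply: closed_kernel; first exact: (seminorm_comp fl rnorm_seminorm).
    by move=> x; exact: (shom_contractive subalgT hf).
  by apply/seteqP; split=> x /= => [->|]; [exact: rnorm0|exact: rnorm_eq0].
- exact: (linear_map0 fl).
- by move=> x y /= fx fy; rewrite /hom_kernel /= (linear_mapD fl) fx fy addr0.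
- by move=> a x /= fx; split; rewrite /hom_kernel /= fM // fx ?mulr0 ?mul0r.
Qed.

Lemma psexp_kernel_disjoint Psi : PsExp_mul D iota Psi ->
  disjoint_ideal D (hom_kernel Psi).
Proof.
move=> [hP PD]; split; first exact: kernel_closed_ideal.
have [hi inj _ _] := hID.
apply/seteqP; split=> [x [Dx /= Px]|_ ->].
  apply: inj => //; first exact: (subalg0 hD).
  by rewrite -PD // Px (shom0 hD hi).
split; first exact: (subalg0 hD).
exact: (linear_map0 (shom_linear hP)).
Qed.

(** Minimality of the norm of the envelope: a contraction out of [ID] that
    preserves the norm on [D] is isometric. *)
Lemma envelope_isometric (Y : Type) (eta : ID -> linfA R Y) : linear_map eta ->
  (forall x, rnorm (eta x) <= rnorm x) ->
  (forall d, D d -> rnorm (eta (iota d)) = rnorm d) ->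
  forall x, rnorm (eta x) = rnorm x.
Proof.
move=> el eN eD x.
have [t [kappa [_ _ _ _ [_ _ _ [_ qmin]]]]] := envelope_rigid_retract hD hA hID.
have := qmin (fun x => rnorm (eta x)).
move=> /(_ _ eN)/(congr1 (@^~ x)); apply; split=> //.
  exact: (seminorm_comp el rnorm_seminorm).
by move=> _ [d Dd <-]; rewrite eD // (envelope_rnorm hD hID).
Qed.

(** Let [K] be a larger disjoint ideal. The characters killing [K] also kill the
    kernel of [Psi], so they factor through [Psi] and extend to contractive
    functionals on [ID]. Together they preserve the norm on [D], hence on [ID],
    and they vanish on [Psi a] for [a] in [K]. *)
Lemma psexp_kernel_maximal Psi : PsExp_mul D iota Psi ->
  maximal_disjoint_ideal D (hom_kernel Psi).
Proof.
move=> hPsi; split; first exact: psexp_kernel_disjoint.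
move=> K [hK DK] PK; apply/seteqP; split=> //= a Ka.
have [hP PD] := hPsi.
have tauH := char_transform_hom (@quotient_evalC R A K).
have [eta [el eN eE]] := contraction_factor (shom_linear hP)
  (@quotient_transform_linear R A K)
  (kernel_domination hP tauH (fun x (Px : Psi x = 0) => quotient_transform0 (PK x Px))).
apply: rnorm_eq0; rewrite -(envelope_isometric el eN).
  by rewrite eE quotient_transform0 // rnorm0.
by move=> d Dd; rewrite -PD // eE (quotient_rnorm hD hA hK DK).
Qed.

(** The isometry [Psi1 a |-> Psi2 a] extends to a contraction of [ID] that fixes
    [D], and such a contraction is the identity. *)
Lemma psexp_kernel_inj Psi1 Psi2 : PsExp_mul D iota Psi1 -> PsExp_mul D iota Psi2 ->
  hom_kernel Psi1 = hom_kernel Psi2 -> Psi1 = Psi2.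
Proof.
move=> [h1 D1] [h2 D2] e12; apply/funext => a.
have [t [kappa [tl kl _ tN [kN kt _ qmin]]]] := envelope_rigid_retract hD hA hID.
have l2 := shom_linear h2.
have sl : linear_map (fun a => t (Psi2 a)) by move=> k x y; rewrite l2 tl.
have [|eta [el eN eE]] := contraction_factor (shom_linear h1) sl.
  move=> x; rewrite tN; apply: (kernel_domination h1 h2) => z z0.
  by have : hom_kernel Psi2 z by rewrite -e12.
have rho := @minimal_subseminorm_rigid R ID _ _ _ (kappa \o eta) qmin.
apply/esym/eqP; rewrite -subr_eq0; apply/eqP/rnorm_eq0.
rewrite -{1}(kt (Psi2 a)) -eE; apply: rho => [k x y|x|_ [d Dd <-]] /=.
- by rewrite el kl.
- exact: le_trans (kN _) (eN _).
- by rewrite -{1}D1 // eE D2 // kt.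
Qed.

Section Surjectivity.
Context {J : set A}.
Hypothesis hJmax : maximal_disjoint_ideal D J.

Let hJ : closed_ideal J. Proof. by have [[]] := hJmax. Qed.
Let hDJ : D `&` J = [set 0]. Proof. by have [[]] := hJmax. Qed.
Local Notation YJ := (@quotient_spectrum R A J).
Local Notation ev := (@quotient_eval R A J).
Local Notation tau := (char_transform (chi := ev)).

Lemma character_real (y : A -> R[i]) a : is_character y -> star a = a ->
  y a = (complex.Re (y a))%:C.
Proof.
move=> yc sa; have := state_sa (character_state yc) sa.
by case: (y a) => u v /= ->.
Qed.

(** The elements of [A] that vanish wherever [a] is below its value at [y] by at
    least [eps] form a closed ideal. It contains [J] strictly, because of the
    positive part of [a - (y a - eps)], and therefore meets [D]. *)
Lemma maximal_ideal_bump a (y : YJ) (eps : R) : star a = a -> 0 < eps ->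
  exists e, [/\ D e, cpos e, rnorm e = 1 &
    forall z : YJ, complex.Re (ev z a) <= complex.Re (ev y a) - eps -> ev z e = 0].
Proof.
move=> sa eps0; set c := complex.Re (ev y a) - eps.
pose K : set A := [set x | forall z : YJ, complex.Re (ev z a) <= c -> ev z x = 0].
have hK : closed_ideal K.
  split.
  - apply: closed_of_approx => x h z za.
    apply: cmod_eq0; apply/eqP; rewrite eq_le cmod_ge0 andbT leNgt; apply/negP => x0.
    have [k Kk] := h _ x0; rewrite ltNge => /negP; apply.
    have [yl _ ysb] := character_state (quotient_evalC z).
    by apply: le_trans (ysb _); rewrite (functionalB yl) (Kk z za) subr0.
  - by move=> z _; have [yl _ _ _] := quotient_evalC z; exact: (functional0 yl).
  - move=> u v Ku Kv z za; have [yl _ _ _] := quotient_evalC z.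
    by rewrite (functionalD yl) Ku // Kv // addr0.
  - by move=> u v Kv; split=> z za; have [_ _ yM _] := quotient_evalC z;
      rewrite yM Kv // ?mulr0 ?mul0r.
have JK : J `<=` K by move=> j Jj [z [zc zJ]] _; exact: zJ.
have [d [Dd Kd d0]] : exists d, [/\ D d, K d & d != 0].
  apply: contrapT => nd.
  have dK : D `&` K = [set 0].
    apply/seteqP; split=> [x [Dx Kx] /=|_ ->].
      by apply/eqP/negPn/negP => x0; apply: nd; exists x.
    by split; [exact: (subalg0 hD)|have [_ h _ _] := hK].
  have KJ : K = J by have [_ h] := hJmax; exact: h.
  pose u := rcst c - a.
  have su : star u = u by rewrite starB star_rcst sa.
  have [p [g [pp sg _ pE [gu _ _ _ _]]]] := negative_part su.
  have zfacts (z : YJ) : [/\ complex.Re (ev z u) = c - complex.Re (ev z a),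
      complex.Re (ev z p) = complex.Re (ev z u) + complex.Re (ev z g) *+ 2,
      0 <= complex.Re (ev z p) &
      complex.Re (ev z g) * complex.Re (ev z u) = - complex.Re (ev z g) ^+ 2].
    have zc := quotient_evalC z; have [yl y1 yM _] := zc.
    have zs := character_state zc.
    split.
    - by rewrite /u (functionalB yl) state_rcst //; case: (ev z a).
    - have ReD (k l : R[i]) : complex.Re (k + l) = complex.Re k + complex.Re l.
        by case: k l => ? ? [].
      by rewrite pE !(functionalD yl) !ReD mulr2n.
    - by rewrite -ler0c -character_real ?cpos_sa //; exact: state_cpos.
    - apply: complexI; rewrite rmorphM rmorphN rmorphXn /=.
      rewrite -!character_real // -yM gu (functionalN yl); congr (- _).
      by rewrite !expr2 yM.
  have Kg : K g.
    move=> z za; rewrite (character_real (quotient_evalC z) sg).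
    have [e1 e2 e3 e4] := zfacts z.
    move: e1 e2 e3 e4; move: (complex.Re (ev z g)) (complex.Re (ev z u)).
    move: (complex.Re (ev z p)) (complex.Re (ev z a)) za => P w za G U e1 e2 e3 e4.
    have U0 : 0 <= U by lra.
    have : G * (U + G) == 0 by rewrite mulrDr e4 -expr2 addNr.
    by rewrite mulf_eq0 => /orP[/eqP ->//|/eqP h]; rewrite (_ : G = 0) //; lra.
  have := zfacts y; rewrite KJ in Kg.
  have -> : ev y g = 0 by case: (y) => y' [yc yJ]; exact: yJ.
  rewrite /= mul0rn addr0 => -[e1 e2 e3 _].
  by move: e1 e2 e3; rewrite /c; lra.
have n0 : 0 < rnorm d.
  by rewrite lt_def rnorm_ge0 andbT; apply: contra_neq d0; exact: rnorm_eq0.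
have n2 : 0 < rnorm d ^+ 2 by rewrite exprn_gt0.
exists ((rnorm d ^+ 2)^-1%:C *: (star d * d)); split.
- by apply: (subalgZ hD); apply: (subalgM hD) => //; exact: (subalg_star hD).
- by apply: cposZ; [rewrite invr_ge0 ltW|exact: cpos_starM].
- by rewrite rnormZr ?invr_ge0 ?(ltW n2) // rnorm_starM mulVf // gt_eqF.
- move=> z za; have [yl _ yM _] := quotient_evalC z.
  by rewrite (functionalZ yl) yM (Kd z za) !mulr0.
Qed.

Lemma linf_cpos (Y : Type) (f : linfA R Y) : (forall y, 0 <= linf_at f y) -> cpos f.
Proof.
move=> f0; split.
  by apply: linf_eqP => y; rewrite linf_at_starE; apply/CrealP/ger0_real.
exists (rnorm f); first exact: rnorm_ge0.
apply: linf_rnorm_le => [|y]; first exact: rnorm_ge0.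
have kE : linf_at f y = (cmod (linf_at f y))%:C by rewrite -cmodE ger0_norm.
rewrite linf_atB (state_rcst _ (linf_at_state y)) kE -rmorphB cmod_real.
by rewrite ger0_norm ?subr_ge0 ?linf_rnorm_ge // gerBl cmod_ge0.
Qed.

(** Positivity of [psi] transports the bumps of [maximal_ideal_bump] into [ID],
    where [iota] preserves their norm. *)
Lemma extension_isometric (psi : linfA R YJ -> ID) : ucp_on setT setT psi ->
  (forall d, D d -> psi (tau d) = iota d) ->
  forall a, rnorm (tau a) <= rnorm (psi (tau a)).
Proof.
move=> pu pD a.
have tauH := char_transform_hom (@quotient_evalC R A J).
have tauE b z : linf_at (tau b) z = ev z b.
  by rewrite char_transformE //; exact: quotient_evalC.
have tl := shom_linear tauH.
have sa_case b (y : YJ) : star b = b -> complex.Re (ev y b) <= rnorm (psi (tau b)).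
  move=> sb; apply/ler_addgt0Pr => eps eps0; rewrite -lerBlDr.
  set c := complex.Re (ev y b) - eps; set N := rnorm b.
  have [cN|cN] := leP c (- N).
    by apply: le_trans cN _; apply: le_trans (rnorm_ge0 _); rewrite oppr_le0 rnorm_ge0.
  have t0 : 0 <= N + c by lra.
  have [e [De ep e1 eK]] := maximal_ideal_bump y sb eps0.
  have tp : cpos (tau (rcst N + b - (N + c)%:C *: e)).
    apply: linf_cpos => z; rewrite tauE.
    have zc := quotient_evalC z; have [yl _ _ _] := zc; have zs := character_state zc.
    have [_ _ zb] := zs.
    rewrite (functionalB yl) (functionalD yl) (state_rcst _ zs) (functionalZ yl).
    rewrite (character_real zc sb) (character_real zc (cpos_sa ep)).
    rewrite -rmorphM -rmorphD -rmorphB ler0c.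
    have [zle|zgt] := leP (complex.Re (ev z b)) c.
      rewrite eK //= mulr0 subr0; have := zb b; rewrite (character_real zc sb) cmod_real.
      by move=> /ler_normlP[]; rewrite -/N; lra.
    have ze1 : complex.Re (ev z e) <= 1.
      by apply: le_trans (Re_le_cmod _) _; rewrite -e1.
    have := ler_wpM2l t0 ze1; lra.
  have i1 : rnorm (iota e) = 1 by rewrite (envelope_rnorm hD hID).
  have : rnorm ((N + c)%:C *: iota e) <= rnorm (rcst N + psi (tau b)).
    apply: cpos_le_rnorm.
      by apply: cposZ => //; apply: (shom_cpos hD (envelope_hom hID)).
    have := ucp_cpos pu tp.
    rewrite (linear_mapB tl) (linear_mapD tl) (shom_rcst subalgT tauH) (linear_mapZ tl).
    by rewrite (ucpB pu) (ucpD pu) (ucp_rcst pu) (ucpZ pu) (pD e De).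
  rewrite rnormZr // i1 mulr1 => /le_trans/(_ (rnormD _ _)).
  have := @rnorm_rcst R ID N (rnorm_ge0 _); lra.
apply: linf_rnorm_le => [|y]; first exact: rnorm_ge0.
have [l [l1 lE]] := exists_phase (linf_at (tau a) y).
have yc := quotient_evalC y; have [yl _ _ ys] := yc.
have e : cmod (linf_at (tau a) y) = complex.Re (ev y (cstarRe (l *: a))).
  rewrite /cstarRe (functionalZ yl) (functionalD yl) ys (functionalZ yl) -tauE lE.
  by rewrite conjRC -rmorphD -rmorphM /=; field.
rewrite e; apply: le_trans (sa_case _ y (cstarRe_sa _)) _.
have -> : psi (tau (cstarRe (l *: a))) = cstarRe (l *: psi (tau a)).
  have [_ _ ts] := tauH.
  rewrite /cstarRe (linear_mapZ tl) (linear_mapD tl) ts // (linear_mapZ tl).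
  by rewrite (ucpZ pu) (ucpD pu) (ucp_star pu) (ucpZ pu).
by apply: le_trans (rnorm_cstarRe _) _; rewrite rnormZ l1 mul1r.
Qed.

(** Equality in the Kadison-Schwarz inequality at every element makes a linear
    map multiplicative, by polarization. *)
Lemma multiplicative_of_schwarz_eq (B : cstarAlgType R) (Phi : A -> B) :
  linear_map Phi -> (forall a, Phi (star a) = star (Phi a)) ->
  (forall a, Phi (star a * a) = star (Phi a) * Phi a) ->
  forall a b, Phi (a * b) = Phi a * Phi b.
Proof.
move=> Pl Ps Psq.
pose F a b := Phi (star a * b) - star (Phi a) * Phi b.
have F0 a : F a a = 0 by rewrite /F Psq subrr.
have FDl a b c : F (a + b) c = F a c + F b c.
  rewrite /F starD mulrDl !(linear_mapD Pl) starD mulrDl opprD.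
  exact: addrACA.
have FDr a b c : F a (b + c) = F a b + F a c.
  by rewrite /F mulrDr !(linear_mapD Pl) mulrDr opprD; exact: addrACA.
have FZl k a b : F (k *: a) b = k^* *: F a b.
  by rewrite /F starZ scalerMl !(linear_mapZ Pl) starZ scalerMl scalerBr.
have FZr k a b : F a (k *: b) = k *: F a b.
  by rewrite /F scalerMr !(linear_mapZ Pl) scalerMr scalerBr.
have anti a b : F b a = - F a b.
  have := F0 (a + b); rewrite FDl !FDr !F0 addr0 add0r => /eqP.
  by rewrite addr_eq0 => /eqP ->; rewrite opprK.
have Fz a b : F a b = 0.
  have := anti a ('i%C *: b); rewrite FZl FZr conj_i anti scaleNr scalerN opprK => h.
  have : 'i%C *: (F a b + F a b) = 0 by rewrite scalerDr {1}h addNr.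
  move=> /(congr1 (fun x => - 'i%C *: x)); rewrite scalerA scaler0 mulNr -expr2 sqr_i.
  by rewrite opprK scale1r => /(congr1 (fun x => (2^-1)%:C *: x)); rewrite halfDD scaler0.
move=> a b; apply/eqP; rewrite -subr_eq0; apply/eqP.
by have := Fz (star a) b; rewrite /F starK Ps starK.
Qed.

(** [Phi] is a ucp extension of [iota] that kills [J]. The characters killing [J]
    factor through [Phi] and extend to states of [ID] that are jointly isometric;
    they annihilate the defect [Phi (star a * a) - star (Phi a) * Phi a], which is
    positive by Kadison-Schwarz for [Phi] and nonpositive by Cauchy-Schwarz for
    the states. Hence the defect is zero and [Phi] is multiplicative. *)
Lemma exists_psexp_of_maximal_ideal :
  exists2 Psi, PsExp_mul D iota Psi & hom_kernel Psi = J.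
Proof.
have [hi iinj hinj _] := hID.
have tauH := char_transform_hom (@quotient_evalC R A J).
have tl := shom_linear tauH; have [_ tM ts] := tauH.
have [psi pu pD] := extend_from_transform (@quotient_evalC R A J) hD hi
  (quotient_norm hD hA hJ hDJ) hinj.
pose Phi a := psi (tau a).
have Pl : linear_map Phi by move=> k a b; rewrite /Phi tl (ucpL pu).
have Ps a : Phi (star a) = star (Phi a) by rewrite /Phi ts // (ucp_star pu).
have [eta [el eN eE]] := contraction_factor Pl tl (extension_isometric pu pD).
have eI : forall x, rnorm (eta x) = rnorm x.
  apply: envelope_isometric => // d Dd.
  by rewrite -pD // -/(Phi d) eE (quotient_rnorm hD hA hJ hDJ).
have P1 : Phi 1 = 1 by rewrite /Phi (shom1 tauH) (ucp1 pu).
have es y : is_state (fun x => linf_at (eta x) y).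
  apply: isometric_state => //; first by rewrite -P1 eE (shom1 tauH).
have PM : forall a b, Phi (a * b) = Phi a * Phi b.
  apply: multiplicative_of_schwarz_eq => // a.
  apply/eqP; rewrite -subr_eq0; apply/eqP/rnorm_eq0; rewrite -eI.
  set x := Phi (star a * a) - _.
  have xp : cpos x.
    by rewrite /x /Phi tM // ts //; exact: (ucp_schwarz pu).
  suff -> : eta x = 0 by rewrite rnorm0.
  apply: linf_eqP => y; apply/eqP; rewrite linf_at0 eq_le (state_cpos (es y)) // andbT.
  rewrite /x (linear_mapB el) eE linf_atB subr_le0 tM // ts // linf_atM linf_at_starE.
  by have := state_cauchy_schwarz (Phi a) (es y); rewrite eE.
have PE : PsExp_mul D iota Phi.
  split; last by move=> d Dd; rewrite /Phi pD.
  by split=> [|a b _ _|a _]; [split=> // k a b _ _; exact: Pl|exact: PM|exact: Ps].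
exists Phi => //; have [_ h] := hJmax; apply: h; first exact: psexp_kernel_disjoint.
move=> j Jj; rewrite /hom_kernel /= /Phi quotient_transform0 //.
exact: (ucp0 pu).
Qed.

End Surjectivity.
End Main.

Lemma set_bij_unique (T U : Type) (X : set T) (Z : set U) (f : T -> U) :
  set_bij X Z f -> (exists x, X = [set x]) <-> (exists! z, Z z).
Proof.
move=> [fZ finj fsurj]; split=> [[x Xx]|[z [Zz zu]]].
  exists (f x); split; first by apply: fZ; rewrite Xx.
  by move=> z /fsurj[x']; rewrite Xx => -> <-.
have [x Xx fx] := fsurj z Zz; exists x; apply/seteqP; split=> [x' Xx'|_ -> //].
apply: finj; [exact/mem_set|exact/mem_set|].
by rewrite fx; apply/esym/zu/fZ.
Qed.

Theorem theorem3p19 (R : realType) (A : cstarAlgType R) (D : set A)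
  (hD : cstar_subalgebra D)
  (hA : forall x y : A, x * y = y * x)
  (ID : cstarAlgType R) (iota : A -> ID)
  (hID : injective_envelope D iota) :
  set_bij (PsExp_mul D iota) [set J | maximal_disjoint_ideal D J]
    (fun Psi : A -> ID => hom_kernel Psi) /\
  ((exists Psi, PsExp_mul D iota = [set Psi]) <->
   (exists! J : set A, maximal_disjoint_ideal D J)).
Proof.
have bij : set_bij (PsExp_mul D iota) [set J | maximal_disjoint_ideal D J]
    (fun Psi : A -> ID => hom_kernel Psi).
  split.
  - by move=> Psi hPsi; exact: (psexp_kernel_maximal hD hA hID hPsi).
  - by move=> Psi1 Psi2; rewrite !inE => h1 h2; exact: (psexp_kernel_inj hD hA hID h1 h2).
  - by move=> J hJ; exact: (exists_psexp_of_maximal_ideal hD hA hID hJ).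
by split=> //; exact: set_bij_unique bij.
Qed.
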